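(* Let $\mathcal{F}_2$ be the class of all $f\in\mathcal{A}$ such that $\left|\frac{f(z)}{g(z)}-1\right|<1$ for all $z\in\mathbb{D}$, for some $g\in\mathcal{A}$ with $\operatorname{Re}\left(\frac{1+z}{z}g(z)\right)>0$ for all $z\in\mathbb{D}$. Write $R_{\mathcal{G}}$ for the $\mathcal{G}$-radius $R_{\mathcal{G}}(\mathcal{F}_2)$. Then the following hold. (i) For $0\le\alpha<1$, $R_{\mathcal{S}^*(\alpha)}=\dfrac{1-\alpha}{2+\sqrt{4+(\alpha-1)^2}}$. (ii) $R_{\mathcal{S}^*_L}\ge\dfrac{\sqrt5-2}{1+\sqrt2}\approx 0.0977$. (iii) $R_{\mathcal{S}_p}=\sqrt{17}-4\approx 0.1231$. (iv) $R_{\mathcal{S}^*_e}=\dfrac{2e-2}{4e+\sqrt{20e^2-8e+4}}\approx 0.1543$. (v) $R_{\mathcal{S}^*_c}=\sqrt{10}-3\approx 0.1623$. (vi) $R_{\mathcal{S}^*_{\sin}}\ge\dfrac{\sin 1}{2+\sqrt{4+\sin 1\,(2+\sin 1)}}\approx 0.1858$. (vii) $R_{\mathcal{S}^*_{\mathrm{lune}}}=\dfrac{2-\sqrt2}{2+\sqrt{10-4\sqrt2}}\approx 0.1434$. (viii) $R_{\mathcal{S}^*_R}=\dfrac{3-2\sqrt2}{2+\sqrt{21-12\sqrt2}}\approx 0.0428$. (ix) $R_{\mathcal{S}^*_{RL}}$ is at least the smallest root $r$ ($\approx 0.0692$) in $[0,1]$ of the equation $$r^2(r+4)^2+(r^2-1)^2+(r^2-1)\sqrt{(r^2+\sqrt2)(2-\sqrt2-r^2)}-\bigl(1+\sqrt2(r^2-1)\bigr)^2=0.$$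 (x) For $0<\gamma\le 1$, $R_{\mathcal{S}^*_\gamma}\ge\dfrac{\sin(\pi\gamma/2)}{2+\sqrt{4+\sin(\pi\gamma/2)}}$.
   Context: $\mathbb{D}=\{z\in\mathbb{C}:|z|<1\}$. $\mathcal{A}$ is the class of analytic functions $f:\mathbb{D}\to\mathbb{C}$ with $f(0)=0$, $f'(0)=1$. Removable singularities at $0$ are understood to be removed. Radius: for families $\mathcal{G},\mathcal{F}\subseteq\mathcal{A}$, the $\mathcal{G}$-radius of $\mathcal{F}$, denoted $R_{\mathcal{G}}(\mathcal{F})$, is the largest number $R$ such that the function $z\mapsto r^{-1}f(rz)$ belongs to $\mathcal{G}$ for all $0<r\le R$ and all $f\in\mathcal{F}$. Subordination: for analytic $f,g$ on $\mathbb{D}$, $f\prec g$ means $f=g\circ w$ for some analytic $w:\mathbb{D}\to\mathbb{D}$ with $w(0)=0$. For an analytic $\varphi$ on $\mathbb{D}$ with $\varphi(0)=1$, $\mathcal{S}^*(\varphi)$ is the class of $f\in\mathcal{A}$ with $zf'(z)/f(z)\prec\varphi(z)$. Classes (principal branches of roots, powers and logarithms): - $\mathcal{S}^*(\alpha)=\mathcal{S}^*\bigl((1+(1-2\alpha)z)/(1-z)\bigr)$ (starlike of order $\alpha$, i.e. $\operatorname{Re}(zf'(z)/f(z))>\alpha$ on $\mathbb{D}$). - $\mathcal{S}^*_L=\mathcal{S}^*(\sqrt{1+z})$. - $\mathcal{S}_p=\mathcal{S}^*(\varphi_{PAR})$, $\varphi_{PAR}(z)=1+\frac{2}{\pi^2}\bigl(\log\frac{1+\sqrt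 z}{1-\sqrt z}\bigr)^2$; here $\varphi_{PAR}(\mathbb{D})=\{w:\operatorname{Re}w>|w-1|\}$. - $\mathcal{S}^*_e=\mathcal{S}^*(e^z)$. - $\mathcal{S}^*_c=\mathcal{S}^*\bigl(1+\tfrac43 z+\tfrac23 z^2\bigr)$. - $\mathcal{S}^*_{\sin}=\mathcal{S}^*(1+\sin z)$. - $\mathcal{S}^*_{\mathrm{lune}}=\mathcal{S}^*(z+\sqrt{1+z^2})$. - $\mathcal{S}^*_R=\mathcal{S}^*(\psi)$, $\psi(z)=1+\frac{zk+z^2}{k^2-kz}$ with $k=\sqrt2+1$. - $\mathcal{S}^*_{RL}=\mathcal{S}^*\Bigl(\sqrt2-(\sqrt2-1)\sqrt{\tfrac{1-z}{1+2(\sqrt2-1)z}}\Bigr)$; geometrically, $zf'(z)/f(z)$ lies in the interior of the left half of the shifted lemniscate given by $|(w-\sqrt2)^2-1|<1$. - $\mathcal{S}^*_\gamma=\mathcal{S}^*\Bigl(\bigl(\tfrac{1+z}{1-z}\bigr)^\gamma\Bigr)$ (strongly starlike of order $\gamma$). Decimal values after $\approx$ are informal four-digit approximations (rounded or truncated). *)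

(* Defs.v *)
From Stdlib Require Import Reals.
From Coquelicot Require Export Coquelicot.

Local Open Scope R_scope.

(** ** Principal branches on [C] *)

Definition Cexp (z : C) : C := (exp (Re z) * cos (Im z), exp (Re z) * sin (Im z)).

Definition Csin (z : C) : C := ((Cexp (Ci * z) - Cexp (- (Ci * z))) / (2 * Ci))%C.

(* The principal argument, in ]-PI, PI]; its value at 0 is irrelevant. *)
Definition Carg (z : C) : R :=
  if Rle_dec 0 (Im z) then acos (Re z / Cmod z) else - acos (Re z / Cmod z).

Definition Clog (z : C) : C := (ln (Cmod z), Carg z).

(* For real exponents [a > 0], which are the only ones used. *)
Definition Cpower (z : C) (a : R) : C :=
  if Ceq_dec z 0 then RtoC 0 else Cexp (a * Clog z).

Definition Csqrt (z : C) : C := Cpower z (1 / 2).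

(** ** Analytic functions on the unit disk *)

(* Functions on the disk are represented by total functions [C -> C] whose
   values outside the disk are never used. *)
Definition D (z : C) : Prop := Cmod z < 1.

Definition analytic (f : C -> C) : Prop :=
  forall z, D z -> ex_derive (V := C_NormedModule) f z.

Definition class_A (f : C -> C) : Prop :=
  analytic f /\ f 0 = 0 /\ is_derive (V := C_NormedModule) f (RtoC 0) (RtoC 1).

(* [q] is the quotient [u / v], with its singularity at 0 removed: it is
   analytic on the whole disk, hence determined by its values off 0. *)
Definition is_quotient (u v q : C -> C) : Prop :=
  analytic q /\
  forall z, D z -> z <> 0 -> v z <> 0 /\ q z = (u z / v z)%C.

Definition subordinate (f g : C -> C) : Prop :=
  exists w : C -> C,
    analytic w /\ (forall z, D z -> D (w z)) /\ w 0 = 0 /\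
    forall z, D z -> f z = g (w z).

Definition starlike_wrt (phi f : C -> C) : Prop :=
  class_A f /\
  exists q, is_quotient (fun z => (z * C_derive f z)%C) f q /\ subordinate q phi.

(** ** Radii *)

Definition dilate (r : R) (f : C -> C) (z : C) : C := (/ r * f (r * z))%C.

(* [rho <= 1] is what makes [f (r * z)] meaningful for every [z] in the disk. *)
Definition radius_ok (G F : (C -> C) -> Prop) (rho : R) : Prop :=
  0 <= rho <= 1 /\
  forall r f, 0 < r <= rho -> F f -> G (dilate r f).

Definition is_radius (G F : (C -> C) -> Prop) (rho : R) : Prop :=
  radius_ok G F rho /\ forall rho', radius_ok G F rho' -> rho' <= rho.

Definition radius_ge (G F : (C -> C) -> Prop) (c : R) : Prop :=
  exists rho, is_radius G F rho /\ c <= rho.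

(** ** Subclasses of starlike functions *)

Definition S_order (alpha : R) : (C -> C) -> Prop :=
  starlike_wrt (fun z => ((1 + (1 - 2 * alpha) * z) / (1 - z))%C).

Definition S_L : (C -> C) -> Prop := starlike_wrt (fun z => Csqrt (1 + z)).

Definition phi_PAR (z : C) : C :=
  (1 + RtoC (2 / PI ^ 2) * Clog ((1 + Csqrt z) / (1 - Csqrt z)) ^ 2)%C.

Definition S_p : (C -> C) -> Prop := starlike_wrt phi_PAR.

Definition S_e : (C -> C) -> Prop := starlike_wrt Cexp.

Definition S_c : (C -> C) -> Prop :=
  starlike_wrt (fun z => (1 + 4 / 3 * z + 2 / 3 * z ^ 2)%C).

Definition S_sin : (C -> C) -> Prop := starlike_wrt (fun z => (1 + Csin z)%C).

Definition S_lune : (C -> C) -> Prop :=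
  starlike_wrt (fun z => (z + Csqrt (1 + z ^ 2))%C).

Definition psi_R (z : C) : C :=
  let k := RtoC (sqrt 2 + 1) in (1 + (z * k + z ^ 2) / (k ^ 2 - k * z))%C.

Definition S_R : (C -> C) -> Prop := starlike_wrt psi_R.

Definition phi_RL (z : C) : C :=
  (sqrt 2 - RtoC (sqrt 2 - 1)
            * Csqrt ((1 - z) / (1 + RtoC (2 * (sqrt 2 - 1)) * z)))%C.

Definition S_RL : (C -> C) -> Prop := starlike_wrt phi_RL.

Definition S_gamma (gamma : R) : (C -> C) -> Prop :=
  starlike_wrt (fun z => Cpower ((1 + z) / (1 - z)) gamma).

(** ** The class of functions with a prescribed ratio *)

Definition class_F2 (f : C -> C) : Prop :=
  class_A f /\
  exists g, class_A g /\
    (exists p, is_quotient (fun z => ((1 + z) * g z)%C) (fun z => z) p /\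
               forall z, D z -> 0 < Re (p z)) /\
    (exists h, is_quotient f g h /\
               forall z, D z -> Cmod (h z - 1) < 1).

Definition RL_equation (r : R) : Prop :=
  r ^ 2 * (r + 4) ^ 2 + (r ^ 2 - 1) ^ 2
  + (r ^ 2 - 1) * sqrt ((r ^ 2 + sqrt 2) * (2 - sqrt 2 - r ^ 2))
  - (1 + sqrt 2 * (r ^ 2 - 1)) ^ 2 = 0.

(* [sqrt] vanishes on negative reals, so beyond [r ^ 2 = 2 - sqrt 2] the equation
   has to be guarded by the sign of the radicand. *)
Definition RL_root (r : R) : Prop :=
  0 <= r <= 1 /\ 0 <= (r ^ 2 + sqrt 2) * (2 - sqrt 2 - r ^ 2) /\ RL_equation r.

Definition RL_smallest_root (r : R) : Prop :=
  RL_root r /\ forall s, RL_root s -> r <= s.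

(* Main.v *)
(** Write [f = z p h / (1 + z)] with [Re p > 0] and [|h - 1| < 1], so that
    [z f' / f = 1 / (1 + z) + z p' / p + z h' / h].  The Schwarz-Pick inequality bounds the
    last two terms by [2 r / (1 - r ^ 2)] and [r (1 + r) / (1 - r ^ 2)] on [|z| = r], while
    [1 / (1 + z)] stays within [r / (1 - r ^ 2)] of [1 / (1 - r ^ 2)].  Hence [z f' / f] maps
    [|z| < c] into the disk of centre [1 / (1 - c ^ 2)] and radius
    [c (c + 4) / (1 - c ^ 2)], and each lower bound says for which [c] this disk lies in
    the image of the function [phi] of the class, an explicit inverse [W] of [phi]
    providing the subordination.  In the sharp cases [phi] omits the reals below
    [1 - 4 c / (1 - c ^ 2)], which are values of [z f' / f] for [f = z (1 - z)^2 / (1 + z)^2].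

    Complex differentiability is only assumed pointwise, so Cauchy's estimates are derived
    from Goursat's lemma on rectangles, applied to [f (z0 + exp w) exp (- w)]. *)

Require Import Defs.
From Stdlib Require Import Reals Lra Psatz Nsatz Ranalysis5 ClassicalEpsilon.
From Coquelicot Require Import Coquelicot.
(* Coquelicot also exports a [D]. *)
Import Defs.
Local Open Scope R_scope.

(** The left end [disk_center c - disk_radius c] of the inclusion disk equals
    [1 - 4 c / (1 - c ^ 2)], which is also the value at [c] of the logarithmic derivative of the
    extremal function. A radius is therefore sharp whenever this left end is the first point of the
    disk to leave the image of [phi]: if [phi] omits the reals below [1 - k], both bounds ask for
    the same equation [4 c / (1 - c ^ 2) = k]. For the classes with a lower bound only, the disk is
    fitted at its right end or at two conjugate points, which the extremal function says nothing
    about. There [radius_ge] still asks for a largest radius, so the supremum of the admissible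
    radii must be shown admissible.

    Subordination requires [z f' / f] to be differentiable, hence [p'] and [h'] too. With
    differentiability assumed only pointwise, that a derivative is again differentiable has to be
    proved; this is what the Cauchy estimates are for. They also give the Schwarz-Pick inequality
    without a maximum principle. *)

(* Coquelicot's [is_derive] on [C], with the norm [Cmod] made explicit. *)
Definition Cderiv (f : C -> C) (z l : C) : Prop :=
  forall eps, 0 < eps -> exists d, 0 < d /\ forall y, Cmod (y - z) < d ->
    Cmod (f y - f z - l * (y - z)) <= eps * Cmod (y - z).

Definition Ccont (f : C -> C) (z : C) : Prop :=
  forall eps, 0 < eps -> exists d, 0 < d /\ forall y, Cmod (y - z) < d ->
    Cmod (f y - f z) < eps.

(** * Rules for continuity and derivatives of complex functions *)

Lemma Cmod_le_triangle_minus (x y : C) : Cmod x - Cmod y <= Cmod (x - y).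
Proof.
  assert (H := Cmod_triangle (x - y) y).
  replace (x - y + y)%C with x in H by ring. lra.
Qed.

Lemma Cmod_minus_diag (x : C) : Cmod (x - x) = 0.
Proof. replace (x - x)%C with (RtoC 0) by ring. apply Cmod_0. Qed.

Lemma Cmod_minus_sym (x y : C) : Cmod (x - y) = Cmod (y - x).
Proof. rewrite <- Cmod_opp. f_equal. ring. Qed.

Lemma is_derive_Cderiv (f : C -> C) (z l : C) :
  is_derive (V := C_NormedModule) f z l <-> Cderiv f z l.
Proof.
  split.
  - intros [_ H] eps He.
    specialize (H z (fun P HP => HP) (mkposreal eps He)).
    destruct H as [d Hd].
    exists d. split; [apply cond_pos|]. intros y Hy.
    specialize (Hd y Hy).
    change (Cmod (f y - f z - (y - z) * l) <= eps * Cmod (y - z)) in Hd.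
    rewrite (Cmult_comm l). exact Hd.
  - intros H. split; [apply is_linear_scal_l|].
    intros x Hx.
    assert (Hzx : z = x) by exact (is_filter_lim_locally_unique (K := C_AbsRing) (V := AbsRing_NormedModule C_AbsRing) z x Hx).
    subst x. intros eps.
    destruct (H eps (cond_pos eps)) as [d [Hd H']].
    exists (mkposreal d Hd). intros y Hy. specialize (H' y Hy).
    change (Cmod (f y - f z - (y - z) * l) <= eps * Cmod (y - z)).
    rewrite (Cmult_comm _ l). exact H'.
Qed.

Lemma ex_derive_Cderiv (f : C -> C) (z : C) :
  ex_derive (V := C_NormedModule) f z <-> exists l, Cderiv f z l.
Proof.
  split; intros [l H]; exists l; apply is_derive_Cderiv; exact H.
Qed.

Lemma C_derive_Cderiv (f : C -> C) (z l : C) : Cderiv f z l -> C_derive f z = l.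
Proof. intros H. apply is_C_derive_unique. apply is_derive_Cderiv. exact H. Qed.

Lemma Ccont_const (c z : C) : Ccont (fun _ => c) z.
Proof.
  intros eps He. exists 1. split; [lra|]. intros y _.
  rewrite Cmod_minus_diag. exact He.
Qed.

Lemma Ccont_id (z : C) : Ccont (fun y => y) z.
Proof. intros eps He. exists eps. split; [exact He|]. intros y Hy. exact Hy. Qed.

Lemma Ccont_plus (f g : C -> C) (z : C) :
  Ccont f z -> Ccont g z -> Ccont (fun y => (f y + g y)%C) z.
Proof.
  intros Hf Hg eps He.
  destruct (Hf (eps / 2)) as [d1 [H1 K1]]; [lra|].
  destruct (Hg (eps / 2)) as [d2 [H2 K2]]; [lra|].
  exists (Rmin d1 d2). split; [apply Rmin_pos; assumption|]. intros y Hy.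
  assert (A1 := K1 y (Rlt_le_trans _ _ _ Hy (Rmin_l _ _))).
  assert (A2 := K2 y (Rlt_le_trans _ _ _ Hy (Rmin_r _ _))).
  replace (f y + g y - (f z + g z))%C with ((f y - f z) + (g y - g z))%C by ring.
  assert (A3 := Cmod_triangle (f y - f z) (g y - g z)). lra.
Qed.

Lemma Ccont_mult (f g : C -> C) (z : C) :
  Ccont f z -> Ccont g z -> Ccont (fun y => (f y * g y)%C) z.
Proof.
  intros Hf Hg eps He.
  assert (P1 := Cmod_ge_0 (f z)). assert (P2 := Cmod_ge_0 (g z)).
  set (K := Cmod (f z) + Cmod (g z) + 1).
  assert (HK : 0 < K) by (unfold K; lra).
  set (e := Rmin 1 (eps / (2 * K))).
  assert (He1 : 0 < eps / (2 * K)) by (apply Rdiv_lt_0_compat; lra).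
  assert (Hepos : 0 < e) by (apply Rmin_pos; lra).
  destruct (Hf e Hepos) as [d1 [H1 K1]].
  destruct (Hg e Hepos) as [d2 [H2 K2]].
  exists (Rmin d1 d2). split; [apply Rmin_pos; assumption|]. intros y Hy.
  assert (A1 := K1 y (Rlt_le_trans _ _ _ Hy (Rmin_l _ _))).
  assert (A2 := K2 y (Rlt_le_trans _ _ _ Hy (Rmin_r _ _))).
  replace (f y * g y - f z * g z)%C
    with ((f y - f z) * (g y - g z) + (f z * (g y - g z) + (f y - f z) * g z))%C by ring.
  eapply Rle_lt_trans; [apply Cmod_triangle|].
  eapply Rle_lt_trans; [apply Rplus_le_compat_l, Cmod_triangle|].
  rewrite !Cmod_mult.
  assert (Q1 := Cmod_ge_0 (f y - f z)). assert (Q2 := Cmod_ge_0 (g y - g z)).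
  assert (E1 : e <= 1) by apply Rmin_l.
  assert (E2 : e * K <= eps / 2).
  { replace (eps / 2) with (eps / (2 * K) * K) by (field; lra).
    apply Rmult_le_compat_r; [lra|apply Rmin_r]. }
  unfold K in E2. nra.
Qed.

Lemma Ccont_opp (f : C -> C) (z : C) : Ccont f z -> Ccont (fun y => (- f y)%C) z.
Proof.
  intros Hf eps He. destruct (Hf eps He) as [d [Hd K]].
  exists d. split; [exact Hd|]. intros y Hy.
  replace (- f y - - f z)%C with (- (f y - f z))%C by ring.
  rewrite Cmod_opp. auto.
Qed.

Lemma Ccont_minus (f g : C -> C) (z : C) :
  Ccont f z -> Ccont g z -> Ccont (fun y => (f y - g y)%C) z.
Proof.
  intros Hf Hg. apply (Ccont_plus f (fun y => (- g y)%C)); [exact Hf|].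
  apply Ccont_opp, Hg.
Qed.

Lemma Ccont_comp (f g : C -> C) (z : C) :
  Ccont g z -> Ccont f (g z) -> Ccont (fun y => f (g y)) z.
Proof.
  intros Hg Hf eps He. destruct (Hf eps He) as [d [Hd K]].
  destruct (Hg d Hd) as [d' [Hd' K']]. exists d'. split; [exact Hd'|].
  intros y Hy. apply K, K', Hy.
Qed.

Lemma Ccont_Cinv (z : C) : z <> 0 -> Ccont Cinv z.
Proof.
  intros Hz eps He. assert (P := proj1 (Cmod_gt_0 z) Hz).
  set (m := Cmod z) in *.
  assert (P2 : 0 < eps * m * m / 2) by (apply Rdiv_lt_0_compat; [apply Rmult_lt_0_compat; [nra|lra]|lra]).
  exists (Rmin (m / 2) (eps * m * m / 2)). split; [apply Rmin_pos; lra|].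
  intros y Hy.
  assert (A1 := Rlt_le_trans _ _ _ Hy (Rmin_l _ _)).
  assert (A2 := Rlt_le_trans _ _ _ Hy (Rmin_r _ _)).
  assert (A3 := Cmod_le_triangle_minus z y).
  rewrite Cmod_minus_sym in A3.
  assert (Hy2 : m / 2 < Cmod y) by (fold m in A3; lra).
  assert (Hy0 : y <> 0) by (apply Cmod_gt_0; lra).
  replace (/ y - / z)%C with (- (y - z) / (y * z))%C by (field; split; assumption).
  rewrite Cmod_div by (apply Cmult_neq_0; assumption).
  rewrite Cmod_opp, Cmod_mult. fold m.
  apply Rmult_lt_reg_r with (Cmod y * m); [nra|].
  unfold Rdiv. rewrite Rmult_assoc, Rinv_l, Rmult_1_r by nra. nra.
Qed.

(* Caratheodory's criterion, through which the rules of differentiation reduce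
   to those of continuity. *)
Lemma Cderiv_caratheodory (f : C -> C) (z l : C) :
  Cderiv f z l <->
  exists phi, Ccont phi z /\ phi z = l /\ forall y, (f y - f z = phi y * (y - z))%C.
Proof.
  split.
  - intros H.
    exists (fun y => if Ceq_dec y z then l else ((f y - f z) / (y - z))%C).
    split; [|split].
    + intros eps He. destruct (H (eps / 2)) as [d [Hd K]]; [lra|].
      exists d. split; [exact Hd|]. intros y Hy.
      destruct (Ceq_dec z z) as [_|n]; [|congruence].
      destruct (Ceq_dec y z) as [->|n].
      * rewrite Cmod_minus_diag. exact He.
      * assert (n' : (y - z <> 0)%C) by (apply Cminus_eq_contra; exact n).
        replace ((f y - f z) / (y - z) - l)%C
          with ((f y - f z - l * (y - z)) / (y - z))%C by (field; exact n').
        rewrite Cmod_div by exact n'.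
        assert (P := proj1 (Cmod_gt_0 _) n').
        apply Rmult_lt_reg_r with (Cmod (y - z)); [exact P|].
        unfold Rdiv. rewrite Rmult_assoc, Rinv_l, Rmult_1_r by lra.
        specialize (K y Hy). nra.
    + destruct (Ceq_dec z z); congruence.
    + intros y. destruct (Ceq_dec y z) as [->|n]; [ring|].
      field. apply Cminus_eq_contra; exact n.
  - intros [phi [Hc [<- Hphi]]] eps He. destruct (Hc eps He) as [d [Hd K]].
    exists d. split; [exact Hd|]. intros y Hy.
    replace (f y - f z - phi z * (y - z))%C with ((phi y - phi z) * (y - z))%C
      by (rewrite Hphi; ring).
    rewrite Cmod_mult. apply Rmult_le_compat_r; [apply Cmod_ge_0|].
    left. apply K, Hy.
Qed.

Lemma Cderiv_cont (f : C -> C) (z l : C) : Cderiv f z l -> Ccont f z.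
Proof.
  intros H. apply Cderiv_caratheodory in H. destruct H as [phi [Hc [_ Hphi]]].
  assert (A : Ccont (fun y => (f z + phi y * (y - z))%C) z).
  { apply Ccont_plus; [apply Ccont_const|].
    apply Ccont_mult; [exact Hc|].
    apply Ccont_minus; [apply Ccont_id|apply Ccont_const]. }
  intros eps He. destruct (A eps He) as [d [Hd K]]. exists d. split; [exact Hd|].
  intros y Hy. specialize (K y Hy).
  replace (f y - f z)%C with (f z + phi y * (y - z) - (f z + phi z * (z - z)))%C; [exact K|].
  rewrite Hphi. ring.
Qed.

Lemma Cderiv_eq (f : C -> C) (z l l' : C) : Cderiv f z l -> l = l' -> Cderiv f z l'.
Proof. intros H <-. exact H. Qed.

Lemma Cderiv_ext_loc (f g : C -> C) (z l : C) (d : R) :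
  0 < d -> (forall y, Cmod (y - z) < d -> f y = g y) -> Cderiv f z l -> Cderiv g z l.
Proof.
  intros Hd E H eps He. destruct (H eps He) as [d' [Hd' K]].
  exists (Rmin d d'). split; [apply Rmin_pos; assumption|]. intros y Hy.
  assert (A1 := Rlt_le_trans _ _ _ Hy (Rmin_l _ _)).
  assert (A2 := Rlt_le_trans _ _ _ Hy (Rmin_r _ _)).
  rewrite <- (E y A1), <- (E z); [apply K, A2|].
  rewrite Cmod_minus_diag. exact Hd.
Qed.

Lemma Cderiv_ext (f g : C -> C) (z l : C) :
  (forall y, f y = g y) -> Cderiv f z l -> Cderiv g z l.
Proof. intros E. apply (Cderiv_ext_loc f g z l 1); [lra|]. intros; apply E. Qed.

Lemma Cderiv_const (c z : C) : Cderiv (fun _ => c) z 0.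
Proof.
  apply Cderiv_caratheodory. exists (fun _ => RtoC 0).
  split; [apply Ccont_const|]. split; [reflexivity|]. intros; ring.
Qed.

Lemma Cderiv_id (z : C) : Cderiv (fun y => y) z 1.
Proof.
  apply Cderiv_caratheodory. exists (fun _ => RtoC 1).
  split; [apply Ccont_const|]. split; [reflexivity|]. intros; ring.
Qed.

Lemma Cderiv_plus (f g : C -> C) (z l m : C) :
  Cderiv f z l -> Cderiv g z m -> Cderiv (fun y => (f y + g y)%C) z (l + m).
Proof.
  intros Hf Hg. apply Cderiv_caratheodory in Hf, Hg.
  destruct Hf as [u [U1 [U2 U3]]]. destruct Hg as [v [V1 [V2 V3]]].
  apply Cderiv_caratheodory. exists (fun y => (u y + v y)%C).
  split; [apply Ccont_plus; assumption|]. split; [congruence|].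
  intros y. transitivity ((f y - f z) + (g y - g z))%C; [ring|].
  rewrite U3, V3. ring.
Qed.

Lemma Cderiv_mult (f g : C -> C) (z l m : C) :
  Cderiv f z l -> Cderiv g z m ->
  Cderiv (fun y => (f y * g y)%C) z (l * g z + f z * m).
Proof.
  intros Hf Hg. assert (Cg := Cderiv_cont _ _ _ Hg).
  apply Cderiv_caratheodory in Hf, Hg.
  destruct Hf as [u [U1 [U2 U3]]]. destruct Hg as [v [V1 [V2 V3]]].
  apply Cderiv_caratheodory. exists (fun y => (u y * g y + f z * v y)%C).
  split; [|split].
  - apply Ccont_plus; apply Ccont_mult; try assumption. apply Ccont_const.
  - congruence.
  - intros y. transitivity ((f y - f z) * g y + f z * (g y - g z))%C; [ring|].
    rewrite U3, V3. ring.
Qed.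

Lemma Cderiv_opp (f : C -> C) (z l : C) :
  Cderiv f z l -> Cderiv (fun y => (- f y)%C) z (- l).
Proof.
  intros H. eapply Cderiv_eq;
    [apply (Cderiv_ext (fun y => (- RtoC 1 * f y)%C)); [|apply Cderiv_mult; [apply Cderiv_const|exact H]]|].
  - intros y. ring.
  - cbv beta. ring.
Qed.

Lemma Cderiv_minus (f g : C -> C) (z l m : C) :
  Cderiv f z l -> Cderiv g z m -> Cderiv (fun y => (f y - g y)%C) z (l - m).
Proof.
  intros Hf Hg. apply (Cderiv_plus f (fun y => (- g y)%C)); [exact Hf|].
  apply Cderiv_opp, Hg.
Qed.

Lemma Cderiv_comp (f g : C -> C) (z l m : C) :
  Cderiv f (g z) l -> Cderiv g z m -> Cderiv (fun y => f (g y)) z (l * m).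
Proof.
  intros Hf Hg. assert (Cg := Cderiv_cont _ _ _ Hg).
  apply Cderiv_caratheodory in Hf, Hg.
  destruct Hf as [u [U1 [U2 U3]]]. destruct Hg as [v [V1 [V2 V3]]].
  apply Cderiv_caratheodory. exists (fun y => (u (g y) * v y)%C).
  split; [|split].
  - apply Ccont_mult; [|exact V1]. apply (Ccont_comp u g); assumption.
  - congruence.
  - intros y. rewrite U3, V3. ring.
Qed.

Lemma Cderiv_Cinv (z : C) : z <> 0 -> Cderiv Cinv z (- / (z * z)).
Proof.
  intros Hz eps He.
  assert (P := proj1 (Cmod_gt_0 z) Hz).
  destruct (Ccont_Cinv z Hz (eps * Cmod z)) as [d [Hd K]]; [nra|].
  exists (Rmin d (Cmod z)). split; [apply Rmin_pos; assumption|]. intros y Hy.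
  assert (A1 := Rlt_le_trans _ _ _ Hy (Rmin_l _ _)).
  assert (A2 := Rlt_le_trans _ _ _ Hy (Rmin_r _ _)).
  assert (Hy0 : y <> 0).
  { intros ->. replace (0 - z)%C with (- z)%C in A2 by ring. rewrite Cmod_opp in A2. lra. }
  replace (/ y - / z - - / (z * z) * (y - z))%C
    with (- (/ y - / z) * / z * (y - z))%C by (field; split; assumption).
  rewrite !Cmod_mult, Cmod_opp, Cmod_inv by assumption.
  apply Rmult_le_compat_r; [apply Cmod_ge_0|].
  specialize (K y A1).
  apply Rmult_le_reg_r with (Cmod z); [exact P|].
  rewrite Rmult_assoc, Rinv_l, Rmult_1_r; lra.
Qed.

Lemma Cderiv_inv (f : C -> C) (z l : C) :
  Cderiv f z l -> f z <> 0 -> Cderiv (fun y => (/ f y)%C) z (- l / (f z * f z)).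
Proof.
  intros Hf Hz. eapply Cderiv_eq.
  - apply (Cderiv_comp Cinv f); [apply Cderiv_Cinv, Hz|exact Hf].
  - field. exact Hz.
Qed.

Lemma Cderiv_div (f g : C -> C) (z l m : C) :
  Cderiv f z l -> Cderiv g z m -> g z <> 0 ->
  Cderiv (fun y => (f y / g y)%C) z ((l * g z - f z * m) / (g z * g z)).
Proof.
  intros Hf Hg Hz. eapply Cderiv_eq.
  - apply (Cderiv_mult f (fun y => (/ g y)%C)); [exact Hf|apply Cderiv_inv; eassumption].
  - field. exact Hz.
Qed.

Lemma Cderiv_scal (c : C) (f : C -> C) (z l : C) :
  Cderiv f z l -> Cderiv (fun y => (c * f y)%C) z (c * l).
Proof.
  intros H. eapply Cderiv_eq; [apply Cderiv_mult; [apply Cderiv_const|exact H]|]. cbv beta. ring.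
Qed.

(** If [u] is the slope function of [E] at [L z], then [y - z = u (L y) * (L y - L z)] near [z]. By
    continuity [u (L y)] stays away from 0, and dividing exhibits [/ u (L y)] as the slope function
    of [L]. Only a continuous right inverse is needed, not injectivity of [E]. *)
Lemma Cderiv_inverse (E L : C -> C) (z l : C) (d : R) :
  0 < d -> (forall y, Cmod (y - z) < d -> E (L y) = y) ->
  Ccont L z -> Cderiv E (L z) l -> l <> 0 -> Cderiv L z (/ l).
Proof.
  intros Hd HEL Hc HE Hl.
  assert (Hz : E (L z) = z).
  { apply HEL. rewrite Cmod_minus_diag. exact Hd. }
  apply Cderiv_caratheodory in HE. destruct HE as [u [U1 [U2 U3]]].
  assert (Cu : Ccont (fun y => u (L y)) z) by (apply Ccont_comp; assumption).
  assert (P : 0 < Cmod l) by (apply Cmod_gt_0; exact Hl).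
  destruct (Cu (Cmod l) P) as [d' [Hd' K]].
  apply (Cderiv_ext_loc (fun y => (L z + / u (L y) * (y - z))%C) L z (/ l) (Rmin d d')).
  - apply Rmin_pos; assumption.
  - intros y Hy.
    assert (A1 := Rlt_le_trans _ _ _ Hy (Rmin_l _ _)).
    assert (A2 := Rlt_le_trans _ _ _ Hy (Rmin_r _ _)).
    specialize (K y A2). rewrite U2 in K.
    assert (N : u (L y) <> 0).
    { intros H0. rewrite H0 in K. replace (0 - l)%C with (- l)%C in K by ring.
      rewrite Cmod_opp in K. lra. }
    specialize (U3 (L y)). rewrite Hz, (HEL y A1) in U3.
    rewrite U3. field. exact N.
  - apply Cderiv_caratheodory. exists (fun y => (/ u (L y))%C).
    split; [|split].
    + apply (Ccont_comp Cinv (fun y => u (L y))); [exact Cu|].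
      apply Ccont_Cinv. rewrite U2. exact Hl.
    + rewrite U2. reflexivity.
    + intros y. ring.
Qed.

(** * The complex exponential *)

Lemma Cexp_add (z w : C) : Cexp (z + w) = (Cexp z * Cexp w)%C.
Proof.
  destruct z as [a b], w as [c d]. apply injective_projections; simpl;
    rewrite exp_plus, ?cos_plus, ?sin_plus; ring.
Qed.

Lemma Cexp_0 : Cexp 0 = 1.
Proof. apply injective_projections; simpl; rewrite exp_0, ?cos_0, ?sin_0; ring. Qed.

Lemma Cexp_opp_l (z : C) : (Cexp (- z) * Cexp z)%C = 1.
Proof. rewrite <- Cexp_add, <- Cexp_0. f_equal. ring. Qed.

Lemma Cmod_polar (r t : R) : 0 <= r -> Cmod (r * cos t, r * sin t) = r.
Proof.
  intros Hr. unfold Cmod. simpl.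
  replace (r * cos t * (r * cos t * 1) + r * sin t * (r * sin t * 1))
    with ((r * r) * (Rsqr (sin t) + Rsqr (cos t))) by (unfold Rsqr; ring).
  rewrite sin2_cos2, Rmult_1_r. apply sqrt_square, Hr.
Qed.

Lemma Cmod_Cexp (z : C) : Cmod (Cexp z) = exp (Re z).
Proof. apply Cmod_polar. left. apply exp_pos. Qed.

Lemma Cexp_neq_0 (z : C) : Cexp z <> 0.
Proof. apply Cmod_gt_0. rewrite Cmod_Cexp. apply exp_pos. Qed.

Lemma Cexp_opp (z : C) : Cexp (- z) = (/ Cexp z)%C.
Proof.
  assert (N := Cexp_neq_0 z). assert (H := Cexp_opp_l z).
  transitivity (Cexp (- z) * Cexp z / Cexp z)%C; [field; exact N|].
  rewrite H. field. exact N.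
Qed.

Lemma Cmod_le_Rabs (z : C) : Cmod z <= Rabs (Re z) + Rabs (Im z).
Proof.
  destruct z as [x y]. simpl.
  replace (x, y) with (RtoC x + RtoC y * Ci)%C
    by (apply injective_projections; simpl; ring).
  eapply Rle_trans; [apply Cmod_triangle|].
  rewrite Cmod_mult, Cmod_Ci, !Cmod_R. lra.
Qed.

Lemma im_le_Cmod (z : C) : Rabs (Im z) <= Cmod z.
Proof. eapply Rle_trans; [apply Rmax_r|apply Rmax_Cmod]. Qed.

Lemma derivable_pt_lim_abs (f : R -> R) (x l : R) :
  derivable_pt_lim f x l -> forall eps, 0 < eps -> exists d, 0 < d /\
    forall h, Rabs h < d -> Rabs (f (x + h) - f x - l * h) <= eps * Rabs h.
Proof.
  intros H eps He. destruct (H eps He) as [d K]. exists d. split; [apply cond_pos|].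
  intros h Hh. destruct (Req_dec h 0) as [->|n].
  - rewrite Rplus_0_r, Rmult_0_r, !Rminus_diag, Rabs_R0. lra.
  - specialize (K h n Hh).
    replace (f (x + h) - f x - l * h) with (((f (x + h) - f x) / h - l) * h)
      by (field; exact n).
    rewrite Rabs_mult. apply Rmult_le_compat_r; [apply Rabs_pos|lra].
Qed.

Lemma Cderiv_Cexp_0 : Cderiv Cexp 0 1.
Proof.
  intros eps He.
  (* The two components contribute errors of at most [4 e h] and [5 e h] with [h = Cmod y]; the
     bound [e <= 1] keeps [exp a] below 3. *)
  set (e := Rmin 1 (eps / 20)).
  assert (He' : 0 < e) by (apply Rmin_pos; lra).
  assert (e1 : e <= 1) by apply Rmin_l.
  assert (e2 : e <= eps / 20) by apply Rmin_r.
  destruct (derivable_pt_lim_abs _ _ _ (derivable_pt_lim_exp 0) e He') as [d1 [D1 K1]].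
  destruct (derivable_pt_lim_abs _ _ _ (derivable_pt_lim_cos 0) e He') as [d2 [D2 K2]].
  destruct (derivable_pt_lim_abs _ _ _ (derivable_pt_lim_sin 0) e He') as [d3 [D3 K3]].
  rewrite exp_0 in K1. rewrite sin_0, cos_0 in K2. rewrite sin_0, cos_0 in K3.
  exists (Rmin e (Rmin d1 (Rmin d2 d3))). split.
  { apply Rmin_pos; [exact He'|]. apply Rmin_pos; [exact D1|]. apply Rmin_pos; assumption. }
  intros [a b] Hy. rewrite Cexp_0.
  replace ((a, b) - 0)%C with ((a, b) : C) in * by (apply injective_projections; simpl; ring).
  assert (Ha := re_le_Cmod (a, b)). assert (Hb := im_le_Cmod (a, b)). simpl in Ha, Hb.
  assert (M1 := Rmin_l e (Rmin d1 (Rmin d2 d3))).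
  assert (M2 := Rmin_r e (Rmin d1 (Rmin d2 d3))).
  assert (M3 := Rmin_l d1 (Rmin d2 d3)). assert (M4 := Rmin_r d1 (Rmin d2 d3)).
  assert (M5 := Rmin_l d2 d3). assert (M6 := Rmin_r d2 d3).
  specialize (K1 a). specialize (K2 b). specialize (K3 b).
  rewrite Rplus_0_l in K1, K2, K3.
  assert (L1 : Rabs (exp a - 1 - 1 * a) <= e * Rabs a) by (apply K1; lra).
  assert (L2 : Rabs (cos b - 1 - -0 * b) <= e * Rabs b) by (apply K2; lra).
  assert (L3 : Rabs (sin b - 0 - 1 * b) <= e * Rabs b) by (apply K3; lra).
  eapply Rle_trans; [apply Cmod_le_Rabs|].
  unfold Cexp, Re, Im. simpl.
  set (h := Cmod (a, b)) in *.
  assert (P1 := Rabs_pos a). assert (P2 := Rabs_pos b).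
  assert (Q1 : Rabs (exp a - 1) <= 2 * h).
  { replace (exp a - 1) with ((exp a - 1 - 1 * a) + a) by ring.
    eapply Rle_trans; [apply Rabs_triang|]. nra. }
  assert (Q2 : Rabs (exp a) <= 3).
  { replace (exp a) with ((exp a - 1) + 1) by ring.
    eapply Rle_trans; [apply Rabs_triang|]. rewrite Rabs_R1. lra. }
  assert (A1 : Rabs (exp a * cos b + - (1) + - (1 * a - 0 * b)) <= 4 * e * h).
  { replace (exp a * cos b + - (1) + - (1 * a - 0 * b))
      with (exp a * (cos b - 1 - -0 * b) + (exp a - 1 - 1 * a)) by ring.
    eapply Rle_trans; [apply Rabs_triang|]. rewrite Rabs_mult.
    assert (Rabs (exp a) * Rabs (cos b - 1 - -0 * b) <= 3 * (e * Rabs b)).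
    { apply Rmult_le_compat; try apply Rabs_pos; assumption. }
    nra. }
  assert (A2 : Rabs (exp a * sin b + - 0 + - (1 * b + 0 * a)) <= 5 * e * h).
  { replace (exp a * sin b + - 0 + - (1 * b + 0 * a))
      with (exp a * (sin b - 0 - 1 * b) + (exp a - 1) * b) by ring.
    eapply Rle_trans; [apply Rabs_triang|]. rewrite !Rabs_mult.
    assert (Rabs (exp a) * Rabs (sin b - 0 - 1 * b) <= 3 * (e * Rabs b)).
    { apply Rmult_le_compat; try apply Rabs_pos; assumption. }
    assert (Rabs (exp a - 1) * Rabs b <= 2 * h * e).
    { apply Rmult_le_compat; try apply Rabs_pos; lra. }
    nra. }
  assert (0 <= h) by apply Cmod_ge_0. nra.
Qed.

Lemma Cderiv_Cexp (z : C) : Cderiv Cexp z (Cexp z).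
Proof.
  apply (Cderiv_ext (fun y => (Cexp z * Cexp (y - z))%C)).
  - intros y. rewrite <- Cexp_add. f_equal. ring.
  - eapply Cderiv_eq.
    + apply Cderiv_scal. apply (Cderiv_comp Cexp (fun y => (y - z)%C)).
      * replace (z - z)%C with (RtoC 0) by ring. apply Cderiv_Cexp_0.
      * apply Cderiv_minus; [apply Cderiv_id|apply Cderiv_const].
    + ring.
Qed.

(** * Integrals along segments and Goursat's lemma *)

Definition CI (f : R -> C) (a b : R) : C :=
  (RInt (fun t => Re (f t)) a b, RInt (fun t => Im (f t)) a b).

Definition path_cont (f : R -> C) (t : R) : Prop :=
  forall eps, 0 < eps -> exists d, 0 < d /\ forall s, Rabs (s - t) < d ->
    Cmod (f s - f t) < eps.

Lemma path_cont_comp (f : C -> C) (g : R -> C) (t : R) :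
  Ccont f (g t) -> path_cont g t -> path_cont (fun s => f (g s)) t.
Proof.
  intros Hf Hg eps He. destruct (Hf eps He) as [d [Hd K]].
  destruct (Hg d Hd) as [d' [Hd' K']]. exists d'. split; [exact Hd'|]. auto.
Qed.

Lemma path_cont_h (c t : R) : path_cont (fun s => (s, c)) t.
Proof.
  intros eps He. exists eps. split; [exact He|]. intros s Hs.
  replace ((s, c) - (t, c))%C with (RtoC (s - t)).
  - rewrite Cmod_R. exact Hs.
  - apply injective_projections; simpl; ring.
Qed.

Lemma path_cont_v (a t : R) : path_cont (fun s => (a, s)) t.
Proof.
  intros eps He. exists eps. split; [exact He|]. intros s Hs.
  replace ((a, s) - (a, t))%C with (Ci * RtoC (s - t))%C.
  - rewrite Cmod_mult, Cmod_Ci, Cmod_R. lra.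
  - apply injective_projections; simpl; ring.
Qed.

Lemma path_cont_minus (f g : R -> C) (t : R) :
  path_cont f t -> path_cont g t -> path_cont (fun s => (f s - g s)%C) t.
Proof.
  intros Hf Hg eps He.
  destruct (Hf (eps / 2)) as [d1 [H1 K1]]; [lra|].
  destruct (Hg (eps / 2)) as [d2 [H2 K2]]; [lra|].
  exists (Rmin d1 d2). split; [apply Rmin_pos; assumption|]. intros y Hy.
  assert (A1 := K1 y (Rlt_le_trans _ _ _ Hy (Rmin_l _ _))).
  assert (A2 := K2 y (Rlt_le_trans _ _ _ Hy (Rmin_r _ _))).
  replace (f y - g y - (f t - g t))%C with ((f y - f t) + - (g y - g t))%C by ring.
  assert (A3 := Cmod_triangle (f y - f t) (- (g y - g t))).
  rewrite Cmod_opp in A3. lra.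
Qed.

Lemma path_cont_scal (c : C) (f : R -> C) (t : R) :
  path_cont f t -> path_cont (fun s => (c * f s)%C) t.
Proof.
  apply (path_cont_comp (fun z => (c * z)%C)).
  apply Ccont_mult; [apply Ccont_const|apply Ccont_id].
Qed.

Lemma path_cont_const (c : C) (t : R) : path_cont (fun _ => c) t.
Proof. apply (path_cont_comp (fun _ => c) (fun s => (s, 0))); [apply Ccont_const|apply path_cont_h]. Qed.

Lemma path_cont_component (p : C -> R) (f : R -> C) (t : R) :
  (forall z w, Rabs (p z - p w) <= Cmod (z - w)) -> path_cont f t ->
  continuous (fun s => p (f s)) t.
Proof.
  intros Hp H. apply (proj2 (filterlim_locally (fun s => p (f s)) (p (f t)))).
  intros eps. destruct (H eps (cond_pos eps)) as [d [Hd K]].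
  exists (mkposreal d Hd). intros s Hs. exact (Rle_lt_trans _ _ _ (Hp _ _) (K s Hs)).
Qed.

Lemma path_cont_Re (f : R -> C) (t : R) :
  path_cont f t -> continuous (fun s => Re (f s)) t.
Proof. apply (path_cont_component Re). intros z w. exact (re_le_Cmod (z - w)). Qed.

Lemma path_cont_Im (f : R -> C) (t : R) :
  path_cont f t -> continuous (fun s => Im (f s)) t.
Proof. apply (path_cont_component Im). intros z w. exact (im_le_Cmod (z - w)). Qed.

Definition path_cont_on (f : R -> C) (a b : R) : Prop :=
  forall t, a <= t <= b -> path_cont f t.

Lemma ex_RInt_Re (f : R -> C) (a b : R) :
  a <= b -> path_cont_on f a b -> ex_RInt (fun t => Re (f t)) a b.
Proof.
  intros Hab H. apply (ex_RInt_continuous (V := R_CompleteNormedModule)). intros t Ht.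
  rewrite Rmin_left, Rmax_right in Ht by exact Hab. apply path_cont_Re, H, Ht.
Qed.

Lemma ex_RInt_Im (f : R -> C) (a b : R) :
  a <= b -> path_cont_on f a b -> ex_RInt (fun t => Im (f t)) a b.
Proof.
  intros Hab H. apply (ex_RInt_continuous (V := R_CompleteNormedModule)). intros t Ht.
  rewrite Rmin_left, Rmax_right in Ht by exact Hab. apply path_cont_Im, H, Ht.
Qed.

Lemma CI_ext (f g : R -> C) (a b : R) :
  a <= b -> (forall t, a <= t <= b -> f t = g t) -> CI f a b = CI g a b.
Proof.
  intros Hab H. unfold CI. f_equal; apply RInt_ext; intros t Ht;
    rewrite Rmin_left, Rmax_right in Ht by exact Hab; rewrite H by lra; reflexivity.
Qed.

Lemma CI_minus (f g : R -> C) (a b : R) :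
  a <= b -> path_cont_on f a b -> path_cont_on g a b ->
  CI (fun t => (f t - g t)%C) a b = (CI f a b - CI g a b)%C.
Proof.
  intros Hab Hf Hg.
  assert (A := RInt_minus _ _ _ _ (ex_RInt_Re f a b Hab Hf) (ex_RInt_Re g a b Hab Hg)).
  assert (B := RInt_minus _ _ _ _ (ex_RInt_Im f a b Hab Hf) (ex_RInt_Im g a b Hab Hg)).
  unfold CI. apply injective_projections; simpl.
  - exact A.
  - exact B.
Qed.

Lemma CI_Chasles (f : R -> C) (a m b : R) :
  a <= m <= b -> path_cont_on f a b -> CI f a b = (CI f a m + CI f m b)%C.
Proof.
  intros Hm Hf.
  assert (F1 : path_cont_on f a m) by (intros t Ht; apply Hf; lra).
  assert (F2 : path_cont_on f m b) by (intros t Ht; apply Hf; lra).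
  unfold CI. apply injective_projections; simpl; symmetry.
  - apply (RInt_Chasles (fun t => Re (f t))); apply ex_RInt_Re; (lra || assumption).
  - apply (RInt_Chasles (fun t => Im (f t))); apply ex_RInt_Im; (lra || assumption).
Qed.

Lemma CI_scal (c : C) (f : R -> C) (a b : R) :
  a <= b -> path_cont_on f a b -> CI (fun t => (c * f t)%C) a b = (c * CI f a b)%C.
Proof.
  intros Hab Hf.
  assert (E1 := ex_RInt_Re f a b Hab Hf). assert (E2 := ex_RInt_Im f a b Hab Hf).
  assert (S1 := fun k => RInt_scal _ _ _ k E1). assert (S2 := fun k => RInt_scal _ _ _ k E2).
  assert (X1 := fun k => ex_RInt_scal _ _ _ k E1). assert (X2 := fun k => ex_RInt_scal _ _ _ k E2).
  destruct c as [x y]. unfold CI. apply injective_projections; simpl.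
  - etransitivity; [exact (RInt_minus _ _ a b (X1 x) (X2 y))|]. rewrite S1, S2. reflexivity.
  - etransitivity; [exact (RInt_plus _ _ a b (X2 x) (X1 y))|]. rewrite S1, S2. reflexivity.
Qed.

Lemma CI_const (c : C) (a b : R) : CI (fun _ => c) a b = (RtoC (b - a) * c)%C.
Proof.
  unfold CI. rewrite !RInt_const. destruct c as [x y].
  unfold scal; simpl; unfold mult; simpl. apply injective_projections; simpl; ring.
Qed.

(** The rotation onto the nonnegative real axis: applied to an integral or an increment, it reduces
    the estimate of a modulus to that of a single real part. *)
Lemma Cmod_unit (z : C) : exists u, Cmod u = 1 /\ (u * z)%C = RtoC (Cmod z).
Proof.
  destruct (Ceq_dec z 0) as [->|n].
  - exists (RtoC 1). rewrite Cmod_1, Cmod_0. split; [reflexivity|ring].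
  - assert (P := proj1 (Cmod_gt_0 z) n).
    assert (N : RtoC (Cmod z) <> 0) by (intros H; apply RtoC_inj in H; lra).
    exists (Cconj z / RtoC (Cmod z))%C. split.
    + rewrite Cmod_div, Cmod_conj, Cmod_R, Rabs_pos_eq by (try exact N; lra). field. lra.
    + transitivity ((z * Cconj z) / RtoC (Cmod z))%C; [field; exact N|].
      rewrite <- Cmod2_conj, RtoC_pow. field. exact N.
Qed.

Lemma Re_le_Cmod (z : C) : Re z <= Cmod z.
Proof. eapply Rle_trans; [apply Rle_abs|apply re_le_Cmod]. Qed.

Lemma CI_bound (f : R -> C) (a b M : R) :
  a <= b -> path_cont_on f a b -> (forall t, a <= t <= b -> Cmod (f t) <= M) ->
  Cmod (CI f a b) <= M * (b - a).
Proof.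
  intros Hab Hf HM. destruct (Cmod_unit (CI f a b)) as [u [Hu E]].
  rewrite <- CI_scal in E by assumption.
  assert (Hc : path_cont_on (fun t => (u * f t)%C) a b)
    by (intros t Ht; apply path_cont_scal, Hf, Ht).
  replace (Cmod (CI f a b)) with (RInt (fun t => Re (u * f t)%C) a b)
    by (apply (f_equal Re) in E; exact E).
  replace (M * (b - a)) with (RInt (fun _ => M) a b)
    by (rewrite RInt_const; unfold scal; simpl; unfold mult; simpl; ring).
  apply RInt_le; [exact Hab|apply ex_RInt_Re; assumption|apply ex_RInt_const|].
  intros t Ht. eapply Rle_trans; [apply Re_le_Cmod|].
  rewrite Cmod_mult, Hu, Rmult_1_l. apply HM. lra.
Qed.

(** The counterclockwise boundary integral, with opposite sides paired under one integral sign so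
    that their common part cancels before any estimate. *)
Definition rect_int (G : C -> C) (a b c d : R) : C :=
  (CI (fun s => G (s, c) - G (s, d)) a b + Ci * CI (fun t => G (b, t) - G (a, t)) c d)%C.

Section Rectangle.
Variable G : C -> C.
Variables a0 b0 c0 d0 : R.
Hypothesis HG : forall x y, a0 <= x <= b0 -> c0 <= y <= d0 -> Ccont G (x, y).

Lemma path_cont_on_h (a b c : R) :
  a0 <= a -> b <= b0 -> c0 <= c <= d0 -> path_cont_on (fun s => G (s, c)) a b.
Proof.
  intros Ha Hb Hc t Ht. apply (path_cont_comp G); [apply HG; lra|apply path_cont_h].
Qed.

Lemma path_cont_on_v (a c d : R) :
  c0 <= c -> d <= d0 -> a0 <= a <= b0 -> path_cont_on (fun t => G (a, t)) c d.
Proof.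
  intros Hc Hd Ha t Ht. apply (path_cont_comp G); [apply HG; lra|apply path_cont_v].
Qed.

Lemma path_cont_on_minus (f g : R -> C) (a b : R) :
  path_cont_on f a b -> path_cont_on g a b -> path_cont_on (fun t => (f t - g t)%C) a b.
Proof. intros Hf Hg t Ht. apply path_cont_minus; [apply Hf, Ht|apply Hg, Ht]. Qed.

Lemma rect_int_split_h (a m b c d : R) :
  a0 <= a -> a <= m <= b -> b <= b0 -> c0 <= c -> c <= d -> d <= d0 ->
  rect_int G a b c d = (rect_int G a m c d + rect_int G m b c d)%C.
Proof.
  intros. unfold rect_int.
  rewrite (CI_Chasles _ a m b); [|assumption|].
  2:{ apply path_cont_on_minus; apply path_cont_on_h; lra. }
  rewrite !CI_minus with (a := c) (b := d); try assumption;
    try (apply path_cont_on_v; lra).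
  ring.
Qed.

Lemma rect_int_split_v (a b c m d : R) :
  a0 <= a -> a <= b -> b <= b0 -> c0 <= c -> c <= m <= d -> d <= d0 ->
  rect_int G a b c d = (rect_int G a b c m + rect_int G a b m d)%C.
Proof.
  intros. unfold rect_int.
  rewrite (CI_Chasles _ c m d); [|assumption|].
  2:{ apply path_cont_on_minus; apply path_cont_on_v; lra. }
  rewrite !CI_minus with (a := a) (b := b); try assumption;
    try (apply path_cont_on_h; lra).
  ring.
Qed.

(* Constants cancel between opposite sides, and so do the two contributions of a
   linear term; only the remainder of the derivative is left. *)
Lemma rect_int_small (a b c d x y eps dl : R) (l : C) :
  a0 <= a -> a <= x <= b -> b <= b0 -> c0 <= c -> c <= y <= d -> d <= d0 ->
  (forall w, Cmod (w - (x, y)) < dl ->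
     Cmod (G w - G (x, y) - l * (w - (x, y))) <= eps * Cmod (w - (x, y))) ->
  0 <= eps -> b - a + (d - c) < dl ->
  Cmod (rect_int G a b c d) <= 2 * eps * (b - a + (d - c)) ^ 2.
Proof.
  intros H1 H2 H3 H4 H5 H6 HE He Hs. set (p := b - a + (d - c)) in *.
  assert (Near : forall s t, a <= s <= b -> c <= t <= d -> Cmod ((s, t) - (x, y)) <= p).
  { intros s t Hs' Ht'. eapply Rle_trans; [apply Cmod_le_Rabs|]. simpl.
    unfold p. apply Rplus_le_compat; apply Rabs_le; lra. }
  set (E := fun w => (G w - G (x, y) - l * (w - (x, y)))%C).
  assert (EB : forall s t, a <= s <= b -> c <= t <= d -> Cmod (E (s, t)) <= eps * p).
  { intros s t Hs' Ht'. assert (N := Near s t Hs' Ht').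
    eapply Rle_trans; [apply HE; lra|]. apply Rmult_le_compat_l; assumption. }
  set (f1 := fun s => (G (s, c) - G (s, d) - l * (Ci * RtoC (c - d)))%C).
  set (f2 := fun t => (G (b, t) - G (a, t) - l * RtoC (b - a))%C).
  assert (C1 : path_cont_on (fun s => (G (s, c) - G (s, d))%C) a b)
    by (apply path_cont_on_minus; apply path_cont_on_h; lra).
  assert (C2 : path_cont_on (fun t => (G (b, t) - G (a, t))%C) c d)
    by (apply path_cont_on_minus; apply path_cont_on_v; lra).
  assert (I1 : CI f1 a b = (CI (fun s => G (s, c) - G (s, d)) a b
                            - RtoC (b - a) * (l * (Ci * RtoC (c - d))))%C).
  { unfold f1. rewrite CI_minus; [rewrite CI_const; reflexivity|lra|exact C1|].
    intros t _. apply path_cont_const. }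
  assert (I2 : CI f2 c d = (CI (fun t => G (b, t) - G (a, t)) c d
                            - RtoC (d - c) * (l * RtoC (b - a)))%C).
  { unfold f2. rewrite CI_minus; [rewrite CI_const; reflexivity|lra|exact C2|].
    intros t _. apply path_cont_const. }
  assert (I : rect_int G a b c d = (CI f1 a b + Ci * CI f2 c d)%C).
  { unfold rect_int. rewrite I1, I2, !RtoC_minus. ring. }
  assert (B1 : Cmod (CI f1 a b) <= 2 * eps * p * (b - a)).
  { apply CI_bound; [lra| |].
    - apply path_cont_on_minus; [exact C1|]. intros t _; apply path_cont_const.
    - intros t Ht.
      replace (f1 t) with (E (t, c) + - E (t, d))%C.
      + eapply Rle_trans; [apply Cmod_triangle|]. rewrite Cmod_opp.
        assert (T1 := EB t c Ht ltac:(lra)). assert (T2 := EB t d Ht ltac:(lra)). lra.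
      + unfold f1, E. replace (Ci * RtoC (c - d))%C with ((t, c) - (t, d))%C
          by (apply injective_projections; simpl; ring). ring. }
  assert (B2 : Cmod (CI f2 c d) <= 2 * eps * p * (d - c)).
  { apply CI_bound; [lra| |].
    - apply path_cont_on_minus; [exact C2|]. intros t _; apply path_cont_const.
    - intros t Ht.
      replace (f2 t) with (E (b, t) + - E (a, t))%C.
      + eapply Rle_trans; [apply Cmod_triangle|]. rewrite Cmod_opp.
        assert (T1 := EB b t ltac:(lra) Ht). assert (T2 := EB a t ltac:(lra) Ht). lra.
      + unfold f2, E. replace (RtoC (b - a)) with ((b, t) - (a, t))%C
          by (apply injective_projections; simpl; ring). ring. }
  rewrite I. eapply Rle_trans; [apply Cmod_triangle|].
  rewrite Cmod_mult, Cmod_Ci, Rmult_1_l.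
  replace (2 * eps * p ^ 2) with (2 * eps * p * (b - a) + 2 * eps * p * (d - c))
    by (unfold p; ring). lra.
Qed.

End Rectangle.

(** * Bisection and Goursat's lemma *)

Lemma pow_half_small (w eps : R) : 0 < eps -> exists n, w / 2 ^ n < eps.
Proof.
  intros He.
  destruct (Rle_lt_dec w 0) as [Hw|Hw].
  { exists 0%nat. simpl. lra. }
  destruct (pow_lt_1_zero (/ 2)) with (y := eps / w) as [n Hn].
  - rewrite Rabs_pos_eq; lra.
  - apply Rdiv_lt_0_compat; assumption.
  - exists n. specialize (Hn n (Nat.le_refl n)).
    rewrite Rabs_pos_eq in Hn by (apply pow_le; lra).
    rewrite pow_inv in Hn. unfold Rdiv.
    apply Rmult_lt_compat_l with (r := w) in Hn; [|exact Hw].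
    replace (w * (eps / w)) with eps in Hn by (field; lra). exact Hn.
Qed.

(** Left ends increase and right ends decrease, so every left end lies below every right end; the
    supremum of the left ends belongs to all the intervals. *)
Lemma nested_bisection (u : nat -> R) (w : R) :
  0 <= w ->
  (forall n, u (S n) = u n \/ u (S n) = u n + w / 2 ^ S n) ->
  exists x, forall n, u n <= x <= u n + w / 2 ^ n.
Proof.
  intros Hw Hu.
  assert (Hp : forall n, 0 <= w / 2 ^ n).
  { intros n. apply Rmult_le_pos; [exact Hw|]. left. apply Rinv_0_lt_compat, pow_lt. lra. }
  assert (Hs : forall n, w / 2 ^ n = 2 * (w / 2 ^ S n)).
  { intros n. simpl. field. apply pow_nonzero. lra. }
  assert (Step : forall n, u n <= u (S n) /\ u (S n) + w / 2 ^ S n <= u n + w / 2 ^ n).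
  { intros n. rewrite (Hs n). specialize (Hp (S n)). destruct (Hu n) as [->| ->]; lra. }
  assert (Mono : forall n k, u n <= u (n + k)%nat /\ u (n + k)%nat + w / 2 ^ (n + k) <= u n + w / 2 ^ n).
  { intros n k. induction k as [|k IH].
    - rewrite Nat.add_0_r. lra.
    - rewrite Nat.add_succ_r. specialize (Step (n + k)%nat). lra. }
  assert (Cross : forall n m, u n <= u m + w / 2 ^ m).
  { intros n m. destruct (Nat.le_ge_cases n m) as [H|H].
    - destruct (Mono n (m - n)%nat) as [M1 _]. replace (n + (m - n))%nat with m in M1 by lia.
      specialize (Hp m). lra.
    - destruct (Mono m (n - m)%nat) as [_ M2]. replace (m + (n - m))%nat with n in M2 by lia.
      specialize (Hp n). lra. }
  destruct (completeness (fun r => exists n, r = u n)) as [x [X1 X2]].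
  - exists (u 0%nat + w / 2 ^ 0). intros r [n ->]. apply Cross.
  - exists (u 0%nat), 0%nat. reflexivity.
  - exists x. intros n. split; [apply X1; exists n; reflexivity|].
    apply X2. intros r [m ->]. apply Cross.
Qed.

(** If [P] failed, it would fail on some quarter, then on a quarter of that quarter, and so on; the
    failing rectangles shrink to a point, where the local hypothesis gives [P] for all small
    rectangles around it. *)
Lemma rect_bisection (P : R -> R -> R -> R -> Prop) (a b c d : R) :
  a <= b -> c <= d ->
  (forall a' b' c' d', a <= a' -> a' <= b' -> b' <= b -> c <= c' -> c' <= d' -> d' <= d ->
     let m := (a' + b') / 2 in let k := (c' + d') / 2 in
     P a' m c' k -> P m b' c' k -> P a' m k d' -> P m b' k d' -> P a' b' c' d') ->
  (forall x y, a <= x <= b -> c <= y <= d -> exists dl, 0 < dl /\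
     forall a' b' c' d', a <= a' -> a' <= x <= b' -> b' <= b ->
       c <= c' -> c' <= y <= d' -> d' <= d -> b' - a' + (d' - c') < dl -> P a' b' c' d') ->
  P a b c d.
Proof.
  intros Hab Hcd Hstep Hloc.
  apply NNPP. intros HnP.
  set (w := b - a). set (h := d - c).
  (* A rectangle of generation [n] is coded by its lower left corner, since its sides [w / 2 ^ n]
     and [h / 2 ^ n] are known. *)
  set (Q := fun n (u : R * R) => P (fst u) (fst u + w / 2 ^ n) (snd u) (snd u + h / 2 ^ n)).
  set (inside := fun n (u : R * R) => a <= fst u /\ fst u + w / 2 ^ n <= b /\
                                      c <= snd u /\ snd u + h / 2 ^ n <= d).
  assert (Hp : forall n, 0 < 2 ^ n) by (intros; apply pow_lt; lra).
  assert (Hw : forall n, 0 <= w / 2 ^ n).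
  { intros n. apply Rmult_le_pos; [unfold w; lra|]. left. apply Rinv_0_lt_compat, Hp. }
  assert (Hh : forall n, 0 <= h / 2 ^ n).
  { intros n. apply Rmult_le_pos; [unfold h; lra|]. left. apply Rinv_0_lt_compat, Hp. }
  assert (Hws : forall n, w / 2 ^ n = 2 * (w / 2 ^ S n)) by (intros n; simpl; field; apply Rgt_not_eq, Hp).
  assert (Hhs : forall n, h / 2 ^ n = 2 * (h / 2 ^ S n)) by (intros n; simpl; field; apply Rgt_not_eq, Hp).
  (* The quantifier on [v] precedes the hypotheses, so that choice yields a total function [next]
     that can be iterated without carrying proofs. *)
  assert (Next : forall n u, exists v, inside n u -> ~ Q n u ->
    inside (S n) v /\ ~ Q (S n) v /\
    (fst v = fst u \/ fst v = fst u + w / 2 ^ S n) /\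
    (snd v = snd u \/ snd v = snd u + h / 2 ^ S n)).
  { intros n [x y].
    set (w' := w / 2 ^ S n). set (h' := h / 2 ^ S n).
    assert (T : exists v, (fst v = x \/ fst v = x + w') /\ (snd v = y \/ snd v = y + h') /\
                 (inside n (x, y) -> ~ Q n (x, y) -> ~ Q (S n) v)).
    { destruct (classic (Q (S n) (x, y))) as [q1|q1];
        [|exists (x, y); simpl; auto].
      destruct (classic (Q (S n) (x + w', y))) as [q2|q2];
        [|exists (x + w', y); simpl; auto].
      destruct (classic (Q (S n) (x, y + h'))) as [q3|q3];
        [|exists (x, y + h'); simpl; auto].
      exists (x + w', y + h'). simpl. do 2 (split; [auto|]).
      intros Hi HQ q4. apply HQ. unfold Q in *; simpl fst in *; simpl snd in *.
      destruct Hi as [i1 [i2 [i3 i4]]]; simpl fst in *; simpl snd in *.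
      rewrite (Hws n) in i2 |- *. rewrite (Hhs n) in i4 |- *. fold w' h' in q1, q2, q3, q4 |- *. fold w' in i2. fold h' in i4.
      assert (0 <= w') by apply Hw. assert (0 <= h') by apply Hh.
      apply Hstep; try lra; cbv zeta;
        replace ((x + (x + 2 * w')) / 2) with (x + w') by lra;
        replace ((y + (y + 2 * h')) / 2) with (y + h') by lra;
        try replace (x + 2 * w') with (x + w' + w') by lra;
        try replace (y + 2 * h') with (y + h' + h') by lra; assumption. }
    destruct T as [v [V1 [V2 V3]]]. exists v. intros Hi HQ.
    specialize (V3 Hi HQ). destruct Hi as [i1 [i2 [i3 i4]]]. simpl fst in *; simpl snd in *.
    rewrite (Hws n) in i2. rewrite (Hhs n) in i4. fold w' in i2. fold h' in i4.
    assert (0 <= w') by apply Hw. assert (0 <= h') by apply Hh.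
    split; [|auto]. unfold inside. fold w' h'.
    destruct V1 as [-> | ->]; destruct V2 as [-> | ->]; repeat split; lra. }
  set (next := fun n u => proj1_sig (constructive_indefinite_description _ (Next n u))).
  set (z := fix z n := match n with O => (a, c) | S k => next k (z k) end).
  assert (Inv : forall n, inside n (z n) /\ ~ Q n (z n)).
  { induction n as [|n [I1 I2]].
    - split.
      + unfold inside. simpl. unfold w, h. lra.
      + unfold Q. simpl. intros q. apply HnP.
        replace b with (a + w / 1) by (unfold w; field).
        replace d with (c + h / 1) by (unfold h; field). exact q.
    - change (z (S n)) with (next n (z n)).
      destruct (proj2_sig (constructive_indefinite_description _ (Next n (z n))) I1 I2)
        as [J1 [J2 _]]. split; assumption. }
  assert (Stp : forall n, (fst (z (S n)) = fst (z n) \/ fst (z (S n)) = fst (z n) + w / 2 ^ S n) /\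
                          (snd (z (S n)) = snd (z n) \/ snd (z (S n)) = snd (z n) + h / 2 ^ S n)).
  { intros n. destruct (Inv n) as [I1 I2]. change (z (S n)) with (next n (z n)).
    destruct (proj2_sig (constructive_indefinite_description _ (Next n (z n))) I1 I2)
      as [_ [_ J]]. exact J. }
  destruct (nested_bisection (fun n => fst (z n)) w) as [x Hx];
    [unfold w; lra|intros n; apply Stp|].
  destruct (nested_bisection (fun n => snd (z n)) h) as [y Hy];
    [unfold h; lra|intros n; apply Stp|].
  assert (X0 := Hx 0%nat). assert (Y0 := Hy 0%nat). simpl in X0, Y0.
  unfold Rdiv in X0, Y0. rewrite Rinv_1, Rmult_1_r in X0, Y0.
  destruct (Hloc x y) as [dl [Hdl Hl]]; [unfold w in X0; lra|unfold h in Y0; lra|].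
  destruct (pow_half_small (w + h) dl Hdl) as [n Hn].
  destruct (Inv n) as [[i1 [i2 [i3 i4]]] HQ]. apply HQ. unfold Q.
  specialize (Hx n). specialize (Hy n). simpl in Hx, Hy.
  apply Hl; try assumption.
  replace ((w + h) / 2 ^ n) with (w / 2 ^ n + h / 2 ^ n) in Hn by (field; apply Rgt_not_eq, Hp).
  lra.
Qed.

(** The bound [eps * p ^ 2], with [p] half the perimeter, is additive under quartering: each of the
    four quarters has half perimeter [p / 2]. Bisection thus reduces it to small rectangles, where
    it is [rect_int_small]; then [eps] tends to 0. *)
Lemma Goursat (G : C -> C) (a b c d : R) :
  a <= b -> c <= d ->
  (forall x y, a <= x <= b -> c <= y <= d -> exists l, Cderiv G (x, y) l) ->
  rect_int G a b c d = 0.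
Proof.
  intros Hab Hcd HG.
  assert (Hc : forall x y, a <= x <= b -> c <= y <= d -> Ccont G (x, y)).
  { intros x y Hx Hy. destruct (HG x y Hx Hy) as [l Hl]. apply (Cderiv_cont _ _ _ Hl). }
  assert (Small : forall eps, 0 < eps ->
    Cmod (rect_int G a b c d) <= eps * (b - a + (d - c)) ^ 2).
  { intros eps He.
    apply (rect_bisection (fun a b c d => Cmod (rect_int G a b c d) <= eps * (b - a + (d - c)) ^ 2));
      try assumption.
    - intros a' b' c' d' A1 A2 A3 B1 B2 B3 m k Q1 Q2 Q3 Q4.
      rewrite (rect_int_split_h G a b c d Hc a' m b' c' d'); try (unfold m; lra); try assumption.
      rewrite (rect_int_split_v G a b c d Hc a' m c' k d'); try (unfold m, k; lra); try assumption.
      rewrite (rect_int_split_v G a b c d Hc m b' c' k d'); try (unfold m, k; lra); try assumption.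
      eapply Rle_trans; [apply Cmod_triangle|].
      eapply Rle_trans; [apply Rplus_le_compat; apply Cmod_triangle|].
      replace (eps * (b' - a' + (d' - c')) ^ 2)
        with (eps * (m - a' + (k - c')) ^ 2 + eps * (m - a' + (d' - k)) ^ 2
              + (eps * (b' - m + (k - c')) ^ 2 + eps * (b' - m + (d' - k)) ^ 2))
        by (unfold m, k; field).
      lra.
    - intros x y Hx Hy. destruct (HG x y Hx Hy) as [l Hl].
      destruct (Hl (eps / 2)) as [dl [Hdl K]]; [lra|].
      exists dl. split; [exact Hdl|]. intros a' b' c' d' A1 A2 A3 B1 B2 B3 S.
      replace eps with (2 * (eps / 2)) by lra.
      apply (rect_int_small G a b c d Hc a' b' c' d' x y (eps / 2) dl l); try assumption; lra. }
  apply Cmod_eq_0. apply Rle_antisym; [|apply Cmod_ge_0].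
  apply Rnot_lt_le. intros HP.
  set (p := (b - a + (d - c)) ^ 2) in *.
  assert (Hp : 0 <= p) by apply pow2_ge_0.
  set (I := Cmod (rect_int G a b c d)) in *.
  specialize (Small (I / (2 * (p + 1)))).
  assert (T : 0 < I / (2 * (p + 1))) by (apply Rdiv_lt_0_compat; lra).
  specialize (Small T).
  assert (E : I / (2 * (p + 1)) * (2 * (p + 1)) = I) by (field; lra). nra.
Qed.

(** * Cauchy estimates *)

Lemma Cexp_periodic (s : R) : Cexp (s, 2 * PI) = Cexp (s, 0).
Proof.
  apply injective_projections; simpl; f_equal.
  - rewrite cos_2PI, cos_0. reflexivity.
  - rewrite sin_2PI, sin_0. reflexivity.
Qed.

(** Allows the constant [f z0] to be subtracted from [f] under the integral of
    [circle_derivative]. *)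
Lemma CI_Cexp_circle (s : R) : CI (fun t => Cexp (- (s, t))) 0 (2 * PI) = 0.
Proof.
  unfold CI. apply injective_projections.
  - change (RInt (fun t => exp (- s) * cos (- t)) 0 (2 * PI) = 0).
    apply is_RInt_unique.
    replace 0 with (minus (exp (- s) * sin (2 * PI)) (exp (- s) * sin 0)) at 2
      by (rewrite sin_2PI, sin_0; unfold minus, plus, opp; simpl; ring).
    apply (is_RInt_derive (V := R_CompleteNormedModule) (fun t => exp (- s) * sin t)).
    + intros t _. auto_derive; [exact I|]. rewrite cos_neg. ring.
    + intros t _. apply (ex_derive_continuous (V := R_NormedModule)). auto_derive. exact I.
  - change (RInt (fun t => exp (- s) * sin (- t)) 0 (2 * PI) = 0).
    apply is_RInt_unique.
    replace 0 with (minus (exp (- s) * cos (2 * PI)) (exp (- s) * cos 0)) at 2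
      by (rewrite cos_2PI, cos_0; unfold minus, plus, opp; simpl; ring).
    apply (is_RInt_derive (V := R_CompleteNormedModule) (fun t => exp (- s) * cos t)).
    + intros t _. auto_derive; [exact I|]. rewrite sin_neg. ring.
    + intros t _. apply (ex_derive_continuous (V := R_NormedModule)). auto_derive. exact I.
Qed.

Lemma Ccont_Cexp (z : C) : Ccont Cexp z.
Proof. exact (Cderiv_cont _ _ _ (Cderiv_Cexp z)). Qed.

Lemma path_cont_Cexp_opp (s t : R) : path_cont (fun t => Cexp (- (s, t))) t.
Proof.
  apply (path_cont_comp (fun z => Cexp (- z)) (fun t => (s, t))); [|apply path_cont_v].
  apply (Ccont_comp Cexp Copp); [apply Ccont_opp, Ccont_id|apply Ccont_Cexp].
Qed.

(* [zeta |-> f (z0 + exp zeta) exp (- zeta)] has period [2 i PI]: by Goursat's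
   lemma its mean over a vertical period does not depend on the abscissa, and it
   tends to [f' z0] when the abscissa goes to minus infinity. *)
Lemma circle_derivative (f : C -> C) (z0 l : C) (R0 s : R) :
  (forall y, Cmod (y - z0) < R0 -> exists m, Cderiv f y m) ->
  Cderiv f z0 l -> exp s < R0 ->
  CI (fun t => f (z0 + Cexp (s, t)) * Cexp (- (s, t)))%C 0 (2 * PI) = (RtoC (2 * PI) * l)%C.
Proof.
  intros Hf Hl Hs. assert (HPI := PI_RGT_0).
  set (G := fun z => (f (z0 + Cexp z) * Cexp (- z))%C).
  set (V := fun s => CI (fun t => G (s, t)) 0 (2 * PI)).
  change (V s = (RtoC (2 * PI) * l)%C).
  assert (HG : forall x y, x <= s -> exists m, Cderiv G (x, y) m).
  { intros x y Hx.
    destruct (Hf (z0 + Cexp (x, y))%C) as [m Hm].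
    { replace (z0 + Cexp (x, y) - z0)%C with (Cexp (x, y)) by ring.
      rewrite Cmod_Cexp. simpl. apply Rle_lt_trans with (2 := Hs).
      destruct Hx as [Hx| ->]; [left; apply exp_increasing, Hx|right; reflexivity]. }
    eexists. unfold G. apply (Cderiv_mult (fun z => f (z0 + Cexp z)%C) (fun z => Cexp (- z)%C)).
    - apply (Cderiv_comp f (fun z => (z0 + Cexp z)%C)); [exact Hm|].
      apply Cderiv_plus; [apply Cderiv_const|apply Cderiv_Cexp].
    - apply (Cderiv_comp Cexp Copp); [apply Cderiv_Cexp|apply Cderiv_opp, Cderiv_id]. }
  assert (HGc : forall x, x <= s -> path_cont_on (fun t => G (x, t)) 0 (2 * PI)).
  { intros x Hx t _. destruct (HG x t Hx) as [m Hm].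
    apply (path_cont_comp G); [apply (Cderiv_cont _ _ _ Hm)|apply path_cont_v]. }
  assert (HV : forall s', s' <= s -> V s' = V s).
  { intros s' Hs'.
    (* The horizontal sides, at heights 0 and [2 * PI], cancel by periodicity; what remains is the
       difference of the two vertical integrals. *)
    assert (E := Goursat G s' s 0 (2 * PI) Hs' ltac:(lra) (fun x y Hx _ => HG x y (proj2 Hx))).
    unfold rect_int in E.
    rewrite (CI_ext _ (fun _ => RtoC 0)) in E by
      (try exact Hs'; intros t _; unfold G; rewrite !Cexp_opp, Cexp_periodic; ring).
    rewrite CI_const in E.
    rewrite CI_minus in E by (try lra; apply HGc; lra).
    fold (V s) in E. fold (V s') in E.
    assert (E' : (Ci * (V s - V s') = 0)%C) by (rewrite <- E; ring).
    replace (V s') with (V s + Ci * (Ci * (V s - V s')))%C.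
    - rewrite E'. ring.
    - replace (Ci * (Ci * (V s - V s')))%C with (Ci * Ci * (V s - V s'))%C by ring.
      replace (Ci * Ci)%C with (- (1))%C by (apply injective_projections; simpl; ring). ring. }
  assert (Small : forall eps, 0 < eps -> Cmod (V s - RtoC (2 * PI) * l) <= eps * (2 * PI - 0)).
  { intros eps He. destruct (Hl eps He) as [d [Hd K]].
    (* The circle of radius [exp s'] lies in the disk of radius [d] where [f] is within [eps] of its
       linear approximation. *)
    set (s' := Rmin s (ln d - 1)).
    assert (Hs' : s' <= s) by apply Rmin_l.
    assert (Hsd : exp s' < d).
    { rewrite <- (exp_ln d Hd). apply exp_increasing.
      apply Rle_lt_trans with (ln d - 1); [apply Rmin_r|lra]. }
    rewrite <- (HV s' Hs').
    set (h := fun t => (f z0 * Cexp (- (s', t)))%C).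
    assert (Hh : path_cont_on h 0 (2 * PI)) by (intros t _; apply path_cont_scal, path_cont_Cexp_opp).
    assert (Eq : (V s' - RtoC (2 * PI) * l)%C
                 = CI (fun t => (G (s', t) - h t - l)%C) 0 (2 * PI)).
    { rewrite (CI_minus (fun t => (G (s', t) - h t)%C) (fun _ => l)); try lra.
      - rewrite CI_minus; [|lra|apply HGc, Hs'|exact Hh]. rewrite CI_const.
        unfold h. rewrite (CI_scal (f z0)); [|lra|intros t _; apply path_cont_Cexp_opp].
        rewrite CI_Cexp_circle, Rminus_0_r. fold (V s'). ring.
      - intros t Ht. apply path_cont_minus; [apply HGc|apply Hh]; assumption.
      - intros t _. apply path_cont_const. }
    rewrite Eq. apply CI_bound; [lra| |].
    - intros t Ht. apply path_cont_minus; [|apply path_cont_const].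
      apply path_cont_minus; [apply HGc|apply Hh]; assumption.
    - intros t _. unfold G, h. set (e := Cexp (s', t)).
      assert (Hm : Cmod e = exp s') by apply Cmod_Cexp.
      assert (He0 : e <> 0) by apply Cexp_neq_0.
      rewrite Cexp_opp. fold e.
      assert (K' : Cmod (f (z0 + e) - f z0 - l * (z0 + e - z0))%C <= eps * Cmod (z0 + e - z0)).
      { apply K. replace (z0 + e - z0)%C with e by ring. rewrite Hm. exact Hsd. }
      replace (f (z0 + e) * / e - f z0 * / e - l)%C
        with ((f (z0 + e) - f z0 - l * (z0 + e - z0)) * / e)%C by (field; exact He0).
      rewrite Cmod_mult, Cmod_inv by exact He0.
      replace (z0 + e - z0)%C with e in * by ring.
      assert (P := proj1 (Cmod_gt_0 e) He0).
      apply Rmult_le_reg_r with (Cmod e); [exact P|].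
      rewrite Rmult_assoc, Rinv_l, Rmult_1_r by lra. exact K'. }
  apply Ceq_minus, Cmod_eq_0. apply Rle_antisym; [|apply Cmod_ge_0].
  apply Rnot_lt_le. intros HP. set (I := Cmod (V s - RtoC (2 * PI) * l)) in *.
  specialize (Small (I / (4 * PI)) ltac:(apply Rdiv_lt_0_compat; lra)).
  replace (I / (4 * PI) * (2 * PI - 0)) with (I / 2) in Small by (field; lra). lra.
Qed.

Lemma path_cont_circle (f : C -> C) (z0 : C) (s t : R) :
  Ccont f (z0 + Cexp (s, t))%C ->
  path_cont (fun t => f (z0 + Cexp (s, t)) * Cexp (- (s, t)))%C t.
Proof.
  intros Hf.
  apply (path_cont_comp (fun z => (f (z0 + Cexp z) * Cexp (- z))%C) (fun t => (s, t)));
    [|apply path_cont_v].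
  apply Ccont_mult.
  - apply (Ccont_comp f (fun z => (z0 + Cexp z)%C)); [|exact Hf].
    apply Ccont_plus; [apply Ccont_const|apply Ccont_Cexp].
  - apply (Ccont_comp Cexp Copp); [apply Ccont_opp, Ccont_id|apply Ccont_Cexp].
Qed.

Lemma CI_circle_bound (f : C -> C) (z0 : C) (s M : R) :
  (forall t, Ccont f (z0 + Cexp (s, t))%C) ->
  (forall t, Cmod (f (z0 + Cexp (s, t))%C) <= M) ->
  Cmod (CI (fun t => f (z0 + Cexp (s, t)) * Cexp (- (s, t)))%C 0 (2 * PI))
  <= M * exp (- s) * (2 * PI).
Proof.
  intros Hc HM. assert (HPI := PI_RGT_0).
  replace (2 * PI) with (2 * PI - 0) at 2 by ring.
  apply CI_bound; [lra| |].
  - intros t _. apply path_cont_circle, Hc.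
  - intros t _. rewrite Cmod_mult, Cmod_Cexp.
    apply Rmult_le_compat_r; [left; apply exp_pos|apply HM].
Qed.

Lemma Cmod_RtoC_pos (x : R) : 0 <= x -> Cmod (RtoC x) = x.
Proof. intros H. rewrite Cmod_R. apply Rabs_pos_eq, H. Qed.

(** [circle_derivative] gives the bound on every circle of radius [r < R0], and [r] tends to [R0].
    Nothing is thus asked of [f] on the boundary, and the open unit disk can be used with
    [R0 = 1]. *)
Lemma Cauchy_estimate (f : C -> C) (z0 l : C) (R0 M : R) :
  0 < R0 ->
  (forall y, Cmod (y - z0) < R0 -> exists m, Cderiv f y m) ->
  (forall y, Cmod (y - z0) < R0 -> Cmod (f y) <= M) ->
  Cderiv f z0 l -> Cmod l * R0 <= M.
Proof.
  intros HR Hf HM Hl. assert (HPI := PI_RGT_0).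
  assert (B : forall r, 0 < r < R0 -> Cmod l * r <= M).
  { intros r Hr. set (s := ln r). assert (Hs : exp s = r) by (apply exp_ln; lra).
    assert (In : forall t, Cmod (z0 + Cexp (s, t) - z0) < R0).
    { intros t. replace (z0 + Cexp (s, t) - z0)%C with (Cexp (s, t)) by ring.
      rewrite Cmod_Cexp. simpl. rewrite Hs. lra. }
    assert (E := circle_derivative f z0 l R0 s Hf Hl ltac:(lra)).
    assert (Bd := CI_circle_bound f z0 s M).
    rewrite E, Cmod_mult, Cmod_RtoC_pos in Bd by lra.
    rewrite exp_Ropp, Hs in Bd.
    assert (2 * PI * Cmod l <= M * / r * (2 * PI)).
    { apply Bd.
      - intros t. destruct (Hf _ (In t)) as [m Hm]. apply (Cderiv_cont _ _ _ Hm).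
      - intros t. apply HM, In. }
    assert (Cmod l <= M * / r) by nra.
    apply Rmult_le_compat_r with (r := r) in H0; [|lra].
    rewrite Rmult_assoc, Rinv_l, Rmult_1_r in H0; lra. }
  assert (P := Cmod_ge_0 l).
  apply Rnot_lt_le. intros H.
  assert (HM0 : 0 <= M).
  { eapply Rle_trans; [apply Cmod_ge_0|apply (HM z0)].
    rewrite Cmod_minus_diag. exact HR. }
  assert (Pl : 0 < Cmod l) by (apply Rnot_le_lt; intros H'; nra).
  assert (Q : M / Cmod l < R0).
  { apply Rmult_lt_reg_r with (Cmod l); [exact Pl|].
    unfold Rdiv. rewrite Rmult_assoc, Rinv_l; lra. }
  assert (Q0 : 0 <= M / Cmod l) by (apply Rdiv_le_0_compat; assumption).
  (* A radius strictly between [M / Cmod l] and [R0] violates [B]. *)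
  assert (B' := B ((M / Cmod l + R0) / 2) ltac:(lra)).
  replace (Cmod l * ((M / Cmod l + R0) / 2)) with ((M + Cmod l * R0) / 2) in B' by (field; lra).
  lra.
Qed.

(** * Lipschitz bounds and differentiability of the derivative *)

Lemma Cderiv_real_path (f : C -> C) (z v l : C) (t : R) :
  Cderiv f (z + RtoC t * v)%C l ->
  forall u, derivable_pt_lim (fun t => Re (u * f (z + RtoC t * v)%C)%C) t (Re (u * (l * v))%C).
Proof.
  intros H u.
  set (V1 := Cmod v + 1). set (U1 := Cmod u + 1).
  assert (Pv := Cmod_ge_0 v). assert (Pu := Cmod_ge_0 u).
  intros eps He.
  destruct (H (eps / (2 * (U1 * V1)))) as [d [Hd K]].
  { apply Rdiv_lt_0_compat; [exact He|]. unfold U1, V1. nra. }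
  assert (Pd : 0 < d / V1) by (apply Rdiv_lt_0_compat; unfold V1; lra).
  exists (mkposreal _ Pd). intros h Hh0 Hh. simpl in Hh.
  specialize (K (z + RtoC (t + h) * v)%C).
  replace (z + RtoC (t + h) * v - (z + RtoC t * v))%C with (RtoC h * v)%C in K
    by (rewrite RtoC_plus; ring).
  rewrite !Cmod_mult, Cmod_R in K.
  assert (Pa := Rabs_pos_lt h Hh0).
  assert (K1 : Rabs h * V1 < d).
  { apply Rmult_lt_compat_r with (r := V1) in Hh; [|unfold V1; lra].
    unfold Rdiv in Hh. rewrite Rmult_assoc, Rinv_l in Hh; [lra|unfold V1; lra]. }
  assert (K2 := K ltac:(unfold V1 in K1; nra)).
  set (E := (f (z + RtoC (t + h) * v) - f (z + RtoC t * v) - l * (RtoC h * v))%C) in *.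
  replace ((Re (u * f (z + RtoC (t + h) * v)%C)%C - Re (u * f (z + RtoC t * v)%C)%C) / h - Re (u * (l * v))%C)
    with (Re (u * E)%C / h).
  2:{ unfold E. destruct (f (z + RtoC (t + h) * v)%C) as [x1 y1], (f (z + RtoC t * v)%C) as [x2 y2].
      destruct u as [u1 u2], l as [l1 l2], v as [v1 v2]. simpl. field. exact Hh0. }
  unfold Rdiv. rewrite Rabs_mult, Rabs_inv.
  assert (B : Rabs (Re (u * E)%C) <= Cmod u * Cmod E)
    by (rewrite <- Cmod_mult; apply re_le_Cmod).
  apply Rmult_lt_reg_r with (Rabs h); [exact Pa|].
  rewrite Rmult_assoc, Rinv_l, Rmult_1_r by lra.
  apply Rle_lt_trans with (1 := B).
  assert (PE := Cmod_ge_0 E).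
  set (k := eps / (2 * (U1 * V1))) in *.
  assert (Hk : k * (U1 * V1) = eps / 2) by (unfold k; field; unfold U1, V1; split; lra).
  assert (Hk0 : 0 < k) by (unfold k; apply Rdiv_lt_0_compat; [exact He|unfold U1, V1; nra]).
  apply Rle_lt_trans with (U1 * (k * (Rabs h * V1))).
  - apply Rmult_le_compat; try assumption; [unfold U1; lra|].
    eapply Rle_trans; [exact K2|]. apply Rmult_le_compat_l; [lra|].
    apply Rmult_le_compat_l; [lra|unfold V1; lra].
  - replace (U1 * (k * (Rabs h * V1))) with (k * (U1 * V1) * Rabs h) by ring. rewrite Hk. nra.
Qed.

(** The mean value theorem fails for complex values, but it applies to the real part of [u * f],
    where [u] turns the increment [f b - f a] onto the positive axis. *)
Lemma mean_value_Cmod (f df : C -> C) (a b : C) (L : R) :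
  (forall t, 0 <= t <= 1 -> Cderiv f (a + RtoC t * (b - a))%C (df (a + RtoC t * (b - a))%C)) ->
  (forall t, 0 <= t <= 1 -> Cmod (df (a + RtoC t * (b - a))%C) <= L) ->
  Cmod (f b - f a) <= L * Cmod (b - a).
Proof.
  intros Hf HL. destruct (Cmod_unit (f b - f a)) as [u [Hu E]].
  set (F := fun t => Re (u * f (a + RtoC t * (b - a)))%C).
  destruct (MVT_cor2 F (fun t => Re (u * (df (a + RtoC t * (b - a)) * (b - a)))%C) 0 1)
    as [t [Ht1 Ht2]]; [lra| |].
  - intros t Ht. unfold F. apply Cderiv_real_path. apply Hf, Ht.
  - assert (E1 : F 1 - F 0 = Cmod (f b - f a)).
    { unfold F. replace (a + RtoC 1 * (b - a))%C with b by ring.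
      replace (a + RtoC 0 * (b - a))%C with a by ring.
      change (Cmod (f b - f a)) with (Re (RtoC (Cmod (f b - f a)))). rewrite <- E.
      destruct (f a), (f b), u. simpl. ring. }
    rewrite <- E1, Ht1, Rminus_0_r, Rmult_1_r.
    eapply Rle_trans; [apply Re_le_Cmod|]. rewrite !Cmod_mult, Hu, Rmult_1_l.
    apply Rmult_le_compat_r; [apply Cmod_ge_0|]. apply HL. lra.
Qed.

Lemma Cmod_convex (a b c : C) (t r : R) :
  0 <= t <= 1 -> Cmod (a - c) < r -> Cmod (b - c) < r -> Cmod (a + RtoC t * (b - a) - c) < r.
Proof.
  intros Ht Ha Hb.
  replace (a + RtoC t * (b - a) - c)%C with (RtoC (1 - t) * (a - c) + RtoC t * (b - c))%C
    by (rewrite RtoC_minus; ring).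
  eapply Rle_lt_trans; [apply Cmod_triangle|].
  rewrite !Cmod_mult, !Cmod_RtoC_pos by lra.
  destruct (Req_dec t 0) as [->|n]; nra.
Qed.

(* On small disks Cauchy's estimate bounds [f'], so [f] is Lipschitz there; applied to
   [f (z + .) - f (w + .)] it makes [f'] Lipschitz, and the Taylor remainder of [f] is
   then uniformly quadratic, which allows differentiation under the integral. *)
Lemma bounded_deriv_deriv (f df : C -> C) (z0 : C) (rho M : R) :
  0 < rho ->
  (forall z, Cmod (z - z0) < 4 * rho -> Cderiv f z (df z)) ->
  (forall z, Cmod (z - z0) < 4 * rho -> Cmod (f z) <= M) ->
  exists m, Cderiv df z0 m.
Proof.
  intros Hr Hf HM.
  assert (Tri : forall x y z r s, Cmod (x - y) < r -> Cmod (y - z) < s -> Cmod (x - z) < r + s).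
  { intros x y z r s H1 H2. replace (x - z)%C with ((x - y) + (y - z))%C by ring.
    eapply Rle_lt_trans; [apply Cmod_triangle|lra]. }
  (* Each use of Cauchy's estimate costs one [rho]: [df] is bounded within [3 * rho] and Lipschitz
     within [2 * rho]. The last two are spent on the circle of integration and on the increment
     [h]. *)
  assert (Bd : forall z, Cmod (z - z0) < 3 * rho -> Cmod (df z) <= M / rho).
  { intros z Hz. apply Rmult_le_reg_r with rho; [exact Hr|].
    unfold Rdiv. rewrite Rmult_assoc, Rinv_l, Rmult_1_r by lra.
    apply (Cauchy_estimate f z); [exact Hr| | |apply Hf; lra].
    - intros y Hy. exists (df y). apply Hf. replace (4 * rho) with (rho + 3 * rho) by ring. eauto.
    - intros y Hy. apply HM. replace (4 * rho) with (rho + 3 * rho) by ring. eauto. }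
  assert (Lip : forall z w, Cmod (z - z0) < 3 * rho -> Cmod (w - z0) < 3 * rho ->
            Cmod (f z - f w) <= M / rho * Cmod (z - w)).
  { intros z w Hz Hw. apply (mean_value_Cmod f df).
    - intros t Ht. apply Hf. apply Rlt_trans with (3 * rho); [apply Cmod_convex; assumption|lra].
    - intros t Ht. apply Bd. apply Cmod_convex; assumption. }
  set (L := M / rho / rho).
  assert (LipD : forall z w, Cmod (z - z0) < 2 * rho -> Cmod (w - z0) < 2 * rho ->
            Cmod (df z - df w) <= L * Cmod (z - w)).
  { intros z w Hz Hw. apply Rmult_le_reg_r with rho; [exact Hr|].
    replace (L * Cmod (z - w) * rho) with (M / rho * Cmod (z - w)) by (unfold L; field; lra).
    assert (D : forall y, Cmod (y - z) < rho ->
              Cderiv (fun y => f y - f (w - z + y)%C)%C y (df y - df (w - z + y)%C)%C).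
    { intros y Hy. assert (Hy' : Cmod (w - z + y - w)%C < rho)
        by (replace (w - z + y - w)%C with (y - z)%C by ring; exact Hy).
      apply Cderiv_minus.
      - apply Hf. assert (T := Tri _ _ _ _ _ Hy Hz). lra.
      - eapply Cderiv_eq.
        + apply (Cderiv_comp f (fun y => (w - z + y)%C)).
          * apply Hf. assert (T := Tri _ _ _ _ _ Hy' Hw). lra.
          * apply Cderiv_plus; [apply Cderiv_const|apply Cderiv_id].
        + ring. }
    apply (Cauchy_estimate (fun y => f y - f (w - z + y)%C)%C z); [exact Hr| | |].
    - intros y Hy. eexists. apply D, Hy.
    - intros y Hy. assert (Hy' : Cmod (w - z + y - w)%C < rho)
        by (replace (w - z + y - w)%C with (y - z)%C by ring; exact Hy).
      replace (z - w)%C with (y - (w - z + y))%C by ring. apply Lip.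
      + assert (T := Tri _ _ _ _ _ Hy Hz). lra.
      + assert (T := Tri _ _ _ _ _ Hy' Hw). lra.
    - replace (df z - df w)%C with (df z - df (w - z + z)%C)%C by (do 2 f_equal; ring).
      apply D. rewrite Cmod_minus_diag. exact Hr. }
  assert (HM0 : 0 <= M).
  { eapply Rle_trans; [apply Cmod_ge_0|apply (HM z0)].
    rewrite Cmod_minus_diag. lra. }
  assert (HL : 0 <= L) by (unfold L; repeat apply Rdiv_le_0_compat; lra).
  assert (Quad : forall z h, Cmod (z - z0) < 2 * rho -> Cmod (z + h - z0) < 2 * rho ->
            Cmod (f (z + h) - f z - df z * h)%C <= L * Cmod h * Cmod h).
  { intros z h Hz Hzh.
    replace (f (z + h) - f z - df z * h)%C
      with ((f (z + h) - df z * (z + h)) - (f z - df z * z))%C by ring.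
    replace (L * Cmod h * Cmod h) with (L * Cmod h * Cmod (z + h - z))
      by (do 2 f_equal; ring).
    assert (In : forall t, 0 <= t <= 1 -> Cmod (z + RtoC t * (z + h - z) - z0) < 2 * rho)
      by (intros t Ht; apply Cmod_convex; assumption).
    apply (mean_value_Cmod (fun y => (f y - df z * y)%C) (fun y => (df y - df z)%C)).
    - intros t Ht. apply Cderiv_minus; [apply Hf; specialize (In t Ht); lra|].
      eapply Cderiv_eq; [apply Cderiv_scal, Cderiv_id|ring].
    - intros t Ht. eapply Rle_trans; [apply LipD; [apply In, Ht|exact Hz]|].
      apply Rmult_le_compat_l; [exact HL|].
      replace (z + RtoC t * (z + h - z) - z)%C with (RtoC t * h)%C by ring.
      rewrite Cmod_mult, Cmod_RtoC_pos by lra.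
      assert (P := Cmod_ge_0 h). nra. }
  assert (HPI := PI_RGT_0).
  set (s := ln rho). assert (Hs : exp s = rho) by (apply exp_ln, Hr).
  assert (HsV : forall t, Cmod (Cexp (s, t)) = rho) by (intros t; rewrite Cmod_Cexp; exact Hs).
  assert (DfC : forall z, Cmod (z - z0) < 2 * rho -> Ccont df z).
  { intros z Hz eps He.
    exists (Rmin (2 * rho - Cmod (z - z0)) (eps / (L + 1))). split.
    - apply Rmin_pos; [lra|]. apply Rdiv_lt_0_compat; lra.
    - intros y Hy. assert (A1 := Rlt_le_trans _ _ _ Hy (Rmin_l _ _)).
      assert (A2 := Rlt_le_trans _ _ _ Hy (Rmin_r _ _)).
      apply Rle_lt_trans with (L * Cmod (y - z)).
      + apply LipD; [|exact Hz]. replace (y - z0)%C with ((y - z) + (z - z0))%C by ring.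
        eapply Rle_lt_trans; [apply Cmod_triangle|lra].
      + apply Rmult_lt_compat_r with (r := L + 1) in A2; [|lra].
        unfold Rdiv in A2. rewrite Rmult_assoc, Rinv_l, Rmult_1_r in A2 by lra.
        assert (P := Cmod_ge_0 (y - z)). nra. }
  set (J := fun g z => CI (fun t => g (z + Cexp (s, t)) * Cexp (- (s, t)))%C 0 (2 * PI)).
  set (k := RtoC (2 * PI)).
  assert (Hk : k <> 0) by (intros H; apply RtoC_inj in H; lra).
  assert (Rep : forall z, Cmod (z - z0) < rho -> J f z = (k * df z)%C).
  { intros z Hz. apply (circle_derivative f z (df z) (2 * rho) s).
    - intros y Hy. exists (df y). apply Hf. assert (T := Tri _ _ _ _ _ Hy Hz). lra.
    - apply Hf. lra.
    - rewrite Hs. lra. }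
  (* Differentiation under the integral sign: [k * df] is the circle integral of [f], so its
     derivative is that of [df], and the error is the circle integral of the Taylor remainder
     [g]. *)
  exists (J df z0 / k)%C. intros eps He.
  exists (Rmin rho (eps * rho / (L + 1))). split.
  { apply Rmin_pos; [exact Hr|]. apply Rdiv_lt_0_compat; [nra|lra]. }
  intros y Hy. assert (A1 := Rlt_le_trans _ _ _ Hy (Rmin_l _ _)).
  assert (A2 := Rlt_le_trans _ _ _ Hy (Rmin_r _ _)).
  set (h := (y - z0)%C) in *. assert (Ey : y = (z0 + h)%C) by (unfold h; ring).
  assert (In0 : forall t, Cmod (z0 + Cexp (s, t) - z0) < 2 * rho).
  { intros t. replace (z0 + Cexp (s, t) - z0)%C with (Cexp (s, t)) by ring. rewrite HsV. lra. }
  assert (In1 : forall t, Cmod (z0 + Cexp (s, t) + h - z0) < 2 * rho).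
  { intros t. replace (z0 + Cexp (s, t) + h - z0)%C with (Cexp (s, t) + h)%C by ring.
    eapply Rle_lt_trans; [apply Cmod_triangle|]. rewrite HsV. lra. }
  assert (Cf : forall z, Cmod (z - z0) < 2 * rho -> Ccont f z)
    by (intros z Hz; apply (Cderiv_cont f z (df z)), Hf; lra).
  set (g := fun z => (f (z + h) - f z - df z * h)%C).
  assert (Cfh : forall t, Ccont (fun z => f (z + h)%C) (z0 + Cexp (s, t))).
  { intros t. apply (Ccont_comp f (fun z => (z + h)%C)).
    - apply Ccont_plus; [apply Ccont_id|apply Ccont_const].
    - apply Cf, In1. }
  assert (Cg : forall t, Ccont g (z0 + Cexp (s, t))%C).
  { intros t. unfold g. apply Ccont_minus; [apply Ccont_minus|].
    - apply Cfh.
    - apply Cf, In0.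
    - apply Ccont_mult; [apply DfC, In0|apply Ccont_const]. }
  assert (Jg : (J g z0 = J f y - J f z0 - h * J df z0)%C).
  { unfold J. rewrite <- CI_scal; [|lra|intros t _; apply path_cont_circle, DfC, In0].
    rewrite <- CI_minus; [|lra| |].
    - rewrite <- CI_minus; [|lra| |].
      + apply CI_ext; [lra|]. intros t _. unfold g. rewrite Ey.
        replace (z0 + h + Cexp (s, t))%C with (z0 + Cexp (s, t) + h)%C by ring. ring.
      + intros t _. apply path_cont_minus; apply path_cont_circle; apply Cf; [|apply In0].
        replace (y + Cexp (s, t))%C with (z0 + Cexp (s, t) + h)%C by (rewrite Ey; ring). apply In1.
      + intros t _. apply path_cont_scal, path_cont_circle, DfC, In0.
    - intros t _. apply path_cont_circle, Cf.
      replace (y + Cexp (s, t))%C with (z0 + Cexp (s, t) + h)%C by (rewrite Ey; ring). apply In1.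
    - intros t _. apply path_cont_circle, Cf, In0. }
  assert (E : (df y - df z0 - J df z0 / k * h)%C = (J g z0 / k)%C).
  { rewrite Jg, (Rep y A1), (Rep z0).
    - field. exact Hk.
    - rewrite Cmod_minus_diag. exact Hr. }
  rewrite E, Cmod_div by exact Hk.
  assert (Mk : Cmod k = 2 * PI) by (apply Cmod_RtoC_pos; lra).
  rewrite Mk.
  assert (B := CI_circle_bound g z0 s (L * Cmod h * Cmod h) Cg
                 ltac:(intros t; apply Quad; [apply In0|apply In1])).
  fold (J g z0) in B. rewrite exp_Ropp, Hs in B.
  apply Rmult_le_reg_r with (2 * PI); [lra|].
  unfold Rdiv at 1. rewrite Rmult_assoc, Rinv_l, Rmult_1_r by lra.
  eapply Rle_trans; [exact B|]. apply Rmult_le_compat_r; [lra|].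
  assert (Ph := Cmod_ge_0 h).
  replace (L * Cmod h * Cmod h * / rho) with (L * Cmod h / rho * Cmod h) by (field; lra).
  apply Rmult_le_compat_r; [exact Ph|].
  apply Rmult_le_reg_r with rho; [exact Hr|].
  unfold Rdiv. rewrite Rmult_assoc, Rinv_l, Rmult_1_r by lra.
  apply Rmult_lt_compat_r with (r := L + 1) in A2; [|lra].
  unfold Rdiv in A2. rewrite Rmult_assoc, Rinv_l, Rmult_1_r in A2 by lra. nra.
Qed.

(** * The Schwarz-Pick lemma *)

Definition holo (f : C -> C) : Prop := forall z, D z -> exists l, Cderiv f z l.

Lemma analytic_holo (f : C -> C) : analytic f <-> holo f.
Proof. split; intros H z Hz; apply ex_derive_Cderiv, H, Hz. Qed.

Lemma holo_C_derive (f : C -> C) (z : C) : holo f -> D z -> Cderiv f z (C_derive f z).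
Proof.
  intros H Hz. destruct (H z Hz) as [l Hl]. rewrite (C_derive_Cderiv _ _ _ Hl). exact Hl.
Qed.

Lemma D_0 : D 0.
Proof. unfold D. rewrite Cmod_0. lra. Qed.

Lemma Cmod_lt_sqr (z : C) (r : R) : 0 < r -> (Cmod z < r <-> Re z ^ 2 + Im z ^ 2 < r ^ 2).
Proof.
  intros Hr. rewrite <- Cmod2_alt. assert (P := Cmod_ge_0 z). split; intros H; nra.
Qed.

Lemma Cmod_le_sqr (z : C) (r : R) : 0 <= r -> (Cmod z <= r <-> Re z ^ 2 + Im z ^ 2 <= r ^ 2).
Proof.
  intros Hr. rewrite <- Cmod2_alt. assert (P := Cmod_ge_0 z). split; intros H; nra.
Qed.

Lemma D_sqr (z : C) : D z <-> Re z ^ 2 + Im z ^ 2 < 1.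
Proof. unfold D. rewrite Cmod_lt_sqr by lra. rewrite pow1. reflexivity. Qed.

Lemma Cmod_1_sqr (x y : R) : Cmod (x, y) = 1 -> x ^ 2 + y ^ 2 = 1.
Proof. intros H. rewrite <- (pow1 2), <- H, Cmod2_alt. reflexivity. Qed.

Lemma Cmod_lt_Cmod (a b : C) : Cmod a ^ 2 < Cmod b ^ 2 -> Cmod a < Cmod b.
Proof. assert (P := Cmod_ge_0 a). assert (Q := Cmod_ge_0 b). intros H. nra. Qed.

Lemma D_div (a b : C) : Cmod a < Cmod b -> D (a / b)%C.
Proof.
  intros H. assert (P := Cmod_ge_0 a).
  assert (N : b <> 0) by (apply Cmod_gt_0; lra).
  unfold D. rewrite Cmod_div by exact N.
  apply Rmult_lt_reg_r with (Cmod b); [lra|]. unfold Rdiv.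
  rewrite Rmult_assoc, Rinv_l; lra.
Qed.

Definition moebius (a u : C) : C := ((u - a) / (1 - Cconj a * u))%C.

Lemma moebius_identity (a u : C) :
  Cmod (1 - Cconj a * u) ^ 2 - Cmod (u - a) ^ 2 = (1 - Cmod a ^ 2) * (1 - Cmod u ^ 2).
Proof. rewrite !Cmod2_alt. destruct a as [a1 a2], u as [u1 u2]. simpl. ring. Qed.

Lemma moebius_lt (a u : C) : D a -> D u -> Cmod (u - a) < Cmod (1 - Cconj a * u).
Proof.
  unfold D. intros Ha Hu. apply Cmod_lt_Cmod.
  assert (I := moebius_identity a u).
  assert (P := Cmod_ge_0 a). assert (Q := Cmod_ge_0 u).
  assert (0 < (1 - Cmod a ^ 2) * (1 - Cmod u ^ 2)) by (apply Rmult_lt_0_compat; nra). lra.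
Qed.

Lemma moebius_den (a u : C) : D a -> D u -> (1 - Cconj a * u)%C <> 0.
Proof.
  intros Ha Hu. apply Cmod_gt_0. assert (H := moebius_lt a u Ha Hu).
  assert (P := Cmod_ge_0 (u - a)). lra.
Qed.

Lemma moebius_D (a u : C) : D a -> D u -> D (moebius a u).
Proof. intros Ha Hu. apply D_div, moebius_lt; assumption. Qed.

Lemma moebius_deriv (a u : C) : D a -> D u ->
  Cderiv (moebius a) u (RtoC (1 - Cmod a ^ 2) / ((1 - Cconj a * u) * (1 - Cconj a * u)))%C.
Proof.
  intros Ha Hu. eapply Cderiv_eq.
  - apply Cderiv_div; [apply Cderiv_minus; [apply Cderiv_id|apply Cderiv_const]
      |apply Cderiv_minus; [apply Cderiv_const|apply Cderiv_scal, Cderiv_id]|].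
    apply moebius_den; assumption.
  - rewrite RtoC_minus, RtoC_pow, <- (RtoC_pow (Cmod a)), Cmod2_conj.
    field. apply moebius_den; assumption.
Qed.

(** Composing [w] with disk automorphisms on both sides gives a self-map [g] of the disk with
    [g 0 = 0]. Cauchy's estimate at 0, with radius 1 and bound 1, says that its derivative there has
    modulus at most 1; the chain rule turns this into the inequality at [z]. *)
Lemma Schwarz_Pick (w : C -> C) (z l : C) :
  holo w -> (forall u, D u -> D (w u)) -> D z -> Cderiv w z l ->
  Cmod l * (1 - Cmod z ^ 2) <= 1 - Cmod (w z) ^ 2.
Proof.
  intros Hw Hb Hz Hl.
  assert (Hmz : D (- z)%C) by (unfold D; rewrite Cmod_opp; exact Hz).
  set (m := moebius (- z)). set (a := w z). assert (Ha : D a) by (apply Hb, Hz).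
  assert (Hm : forall u, D u -> D (m u)) by (intros u Hu; apply moebius_D; assumption).
  assert (Hm0 : m 0 = z).
  { unfold m, moebius. rewrite Copp_conj. field. }
  assert (D1 := moebius_deriv (- z) 0 Hmz D_0). fold m in D1.
  replace (1 - Cconj (- z) * 0)%C with (RtoC 1) in D1 by ring.
  rewrite Cmod_opp in D1.
  assert (D2 := moebius_deriv a a Ha Ha).
  set (g := fun u => moebius a (w (m u))).
  assert (Pz : 0 <= 1 - Cmod z ^ 2) by (unfold D in Hz; assert (P := Cmod_ge_0 z); nra).
  assert (Pa : 0 < 1 - Cmod a ^ 2) by (unfold D in Ha; assert (P := Cmod_ge_0 a); nra).
  assert (Dg : Cderiv g 0 (RtoC (/ (1 - Cmod a ^ 2)) * (l * RtoC (1 - Cmod z ^ 2)))%C).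
  { eapply Cderiv_eq.
    - apply (Cderiv_comp (moebius a) (fun u => w (m u))).
      + rewrite Hm0. exact D2.
      + apply (Cderiv_comp w m); [rewrite Hm0; exact Hl|exact D1].
    - replace (1 - Cconj a * a)%C with (RtoC (1 - Cmod a ^ 2)).
      2:{ rewrite RtoC_minus, Cmod2_conj. ring. }
      rewrite RtoC_inv by lra. field.
      intros H. apply RtoC_inj in H. lra. }
  assert (B := fun l => Cauchy_estimate g 0 l 1 1 Rlt_0_1).
  apply B in Dg.
  - rewrite Cmod_mult, Cmod_mult, !Cmod_RtoC_pos in Dg by
      (try assumption; left; apply Rinv_0_lt_compat; assumption).
    apply Rmult_le_compat_l with (r := 1 - Cmod a ^ 2) in Dg; [|lra].
    replace ((1 - Cmod a ^ 2) * (/ (1 - Cmod a ^ 2) * (Cmod l * (1 - Cmod z ^ 2)) * 1))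
      with (Cmod l * (1 - Cmod z ^ 2)) in Dg by (field; lra).
    lra.
  - intros y Hy. replace (y - 0)%C with y in Hy by ring.
    assert (Hmy := Hm y Hy). destruct (Hw _ Hmy) as [k Hk].
    eexists. apply (Cderiv_comp (moebius a) (fun u => w (m u))).
    + apply moebius_deriv; [exact Ha|apply Hb, Hmy].
    + apply (Cderiv_comp w m); [exact Hk|apply moebius_deriv; assumption].
  - intros y Hy. replace (y - 0)%C with y in Hy by ring.
    left. apply moebius_D; [exact Ha|]. apply Hb, Hm, Hy.
Qed.

(** Apply the disk version to [(p - 1) / (p + 1)]; the identity [Id] converts [1 - |w| ^ 2] into
    [4 Re p / |p + 1| ^ 2]. *)
Lemma Schwarz_Pick_half_plane (p : C -> C) (z l : C) :
  holo p -> (forall u, D u -> 0 < Re (p u)) -> D z -> Cderiv p z l ->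
  Cmod l * (1 - Cmod z ^ 2) <= 2 * Re (p z).
Proof.
  intros Hp Hpos Hz Hl.
  assert (Id : forall a : C, Cmod (a + 1) ^ 2 - Cmod (a - 1) ^ 2 = 4 * Re a)
    by (intros [x y]; rewrite !Cmod2_alt; simpl; ring).
  assert (N : forall u, D u -> (p u + 1)%C <> 0).
  { intros u Hu H. apply (f_equal Re) in H. rewrite re_plus in H. simpl in H.
    specialize (Hpos u Hu). lra. }
  set (w := fun u => ((p u - 1) / (p u + 1))%C).
  assert (Dw : forall u k, D u -> Cderiv p u k ->
            Cderiv w u (2 * k / ((p u + 1) * (p u + 1)))%C).
  { intros u k Hu Hk. eapply Cderiv_eq.
    - apply Cderiv_div; [apply Cderiv_minus; [exact Hk|apply Cderiv_const]
        |apply Cderiv_plus; [exact Hk|apply Cderiv_const]|apply N, Hu].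
    - cbv beta; field. apply N, Hu. }
  assert (S := Schwarz_Pick w z (2 * l / ((p z + 1) * (p z + 1)))%C).
  assert (Nz := N z Hz). assert (P := proj1 (Cmod_gt_0 _) Nz).
  assert (Q : Cmod (2 * l / ((p z + 1) * (p z + 1))) * (1 - Cmod z ^ 2) <= 1 - Cmod (w z) ^ 2).
  { apply S; [| |exact Hz|apply Dw; assumption].
    - intros u Hu. destruct (Hp u Hu) as [k Hk]. eexists. apply Dw; eassumption.
    - intros u Hu. apply D_div, Cmod_lt_Cmod.
      specialize (Id (p u)). specialize (Hpos u Hu). lra. }
  unfold w in Q. specialize (Id (p z)).
  rewrite !Cmod_div in Q by (try apply Cmult_neq_0; assumption).
  rewrite !Cmod_mult, Cmod_RtoC_pos in Q by lra.
  set (A := Cmod (p z + 1)) in *. set (B := Cmod (p z - 1)) in *.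
  apply Rmult_le_compat_l with (r := A * A) in Q; [|nra].
  replace (A * A * (2 * Cmod l / (A * A) * (1 - Cmod z ^ 2)))
    with (2 * (Cmod l * (1 - Cmod z ^ 2))) in Q by (field; lra).
  replace (A * A * (1 - (B / A) ^ 2)) with (A ^ 2 - B ^ 2) in Q by (field; lra).
  lra.
Qed.

(** Makes [h'] analytic in [z h' / h]. The choice [rho = (1 - |z|) / 4] keeps the disk of radius
    [4 * rho] about [z] inside the unit disk. *)
Lemma holo_derive_bounded (f df : C -> C) (M : R) :
  (forall z, D z -> Cderiv f z (df z)) -> (forall z, D z -> Cmod (f z) <= M) -> holo df.
Proof.
  intros Hf HM z Hz. unfold D in *.
  assert (In : forall y, Cmod (y - z) < 4 * ((1 - Cmod z) / 4) -> Cmod y < 1).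
  { intros y Hy. assert (T := Cmod_le_triangle_minus y z). lra. }
  apply (bounded_deriv_deriv f df z ((1 - Cmod z) / 4) M); [lra| |].
  - intros y Hy. apply Hf, In, Hy.
  - intros y Hy. apply HM, In, Hy.
Qed.

Lemma near_D (z : C) : D z -> exists d, 0 < d /\ forall y, Cmod (y - z) < d -> D y.
Proof.
  unfold D. intros Hz. exists (1 - Cmod z). split; [lra|]. intros y Hy.
  assert (T := Cmod_le_triangle_minus y z). lra.
Qed.

Lemma holo_ext (f g : C -> C) : (forall z, D z -> f z = g z) -> holo f -> holo g.
Proof.
  intros E H z Hz. destruct (H z Hz) as [l Hl]. exists l.
  destruct (near_D z Hz) as [d [Hd K]].
  apply (Cderiv_ext_loc f g z l d Hd); [intros y Hy; apply E, K, Hy|exact Hl].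
Qed.

(** A function with values in a half-plane need not be bounded, but [1 / (p + 1)] has modulus at
    most 1. Its derivative is analytic, and [dp] is recovered from it by multiplying with
    [- (p + 1) ^ 2]. *)
Lemma holo_derive_half_plane (p dp : C -> C) :
  (forall z, D z -> Cderiv p z (dp z)) -> (forall u, D u -> 0 < Re (p u)) -> holo dp.
Proof.
  intros Hp Hpos.
  assert (N : forall u, D u -> 1 < Cmod (p u + 1)).
  { intros u Hu. eapply Rlt_le_trans; [|apply Re_le_Cmod]. rewrite re_plus.
    specialize (Hpos u Hu). simpl. lra. }
  assert (N0 : forall u, D u -> (p u + 1)%C <> 0).
  { intros u Hu. apply Cmod_gt_0. specialize (N u Hu). lra. }
  set (dB := fun z => (- dp z / ((p z + 1) * (p z + 1)))%C).
  assert (HB : forall z, D z -> Cderiv (fun z => / (p z + 1))%C z (dB z)).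
  { intros z Hz. eapply Cderiv_eq.
    - apply Cderiv_inv; [apply Cderiv_plus; [apply Hp, Hz|apply Cderiv_const]|apply N0, Hz].
    - unfold dB. field. apply N0, Hz. }
  assert (HdB : holo dB).
  { apply (holo_derive_bounded _ dB 1 HB). intros z Hz.
    rewrite Cmod_inv by (apply N0, Hz). specialize (N z Hz).
    apply Rle_trans with (/ 1); [apply Rinv_le_contravar; lra|rewrite Rinv_1; lra]. }
  apply (holo_ext (fun z => (- dB z * ((p z + 1) * (p z + 1)))%C)).
  - intros z Hz. unfold dB. field. apply N0, Hz.
  - intros z Hz. destruct (HdB z Hz) as [l Hl]. eexists.
    apply Cderiv_mult; [apply Cderiv_opp, Hl|].
    apply Cderiv_mult; (apply Cderiv_plus; [apply Hp, Hz|apply Cderiv_const]).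
Qed.

(* Integrates the Schwarz-Pick inequality along the radius: by it the pseudo-hyperbolic
   difference [(v t - t r) / (1 - v t * (t r))] decreases, [v] being the component of
   [w (t z)] in the direction of [w z]. *)
Lemma Schwarz (w : C -> C) (z : C) :
  holo w -> (forall u, D u -> D (w u)) -> w 0 = 0 -> D z -> Cmod (w z) <= Cmod z.
Proof.
  intros Hw Hb H0 Hz. set (r := Cmod z). assert (Pr : 0 <= r) by apply Cmod_ge_0.
  assert (Hr : r < 1) by exact Hz.
  destruct (Cmod_unit (w z)) as [u [Hu E]].
  assert (HD : forall t, 0 <= t <= 1 -> D (0 + RtoC t * z)%C).
  { intros t Ht. unfold D. replace (0 + RtoC t * z)%C with (RtoC t * z)%C by ring.
    rewrite Cmod_mult, Cmod_RtoC_pos by lra. fold r. nra. }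
  set (v := fun t => Re (u * w (0 + RtoC t * z)%C)%C).
  set (dv := fun t => Re (u * (C_derive w (0 + RtoC t * z) * z))%C).
  assert (Dv : forall t, 0 <= t <= 1 -> derivable_pt_lim v t (dv t)).
  { intros t Ht. apply Cderiv_real_path. apply holo_C_derive; [exact Hw|apply HD, Ht]. }
  assert (Bv : forall t, 0 <= t <= 1 -> -1 < v t < 1 /\ v t ^ 2 <= Cmod (w (0 + RtoC t * z)%C) ^ 2).
  { intros t Ht. assert (A := re_le_Cmod (u * w (0 + RtoC t * z)%C)%C).
    rewrite Cmod_mult, Hu, Rmult_1_l in A. fold (v t) in A.
    assert (B := Hb _ (HD t Ht)). unfold D in B.
    apply Rabs_le_between in A.
    split; [lra|]. assert (G := Cmod_ge_0 (w (0 + RtoC t * z)%C)). nra. }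
  assert (Bdv : forall t, 0 <= t <= 1 -> dv t * (1 - t ^ 2 * r ^ 2) <= r * (1 - v t ^ 2)).
  { intros t Ht. destruct (Bv t Ht) as [_ B2].
    assert (S := Schwarz_Pick w _ _ Hw Hb (HD t Ht) (holo_C_derive w _ Hw (HD t Ht))).
    replace (Cmod (0 + RtoC t * z)) with (t * r) in S.
    2:{ replace (0 + RtoC t * z)%C with (RtoC t * z)%C by ring.
        rewrite Cmod_mult, Cmod_RtoC_pos by lra. reflexivity. }
    assert (A := Re_le_Cmod (u * (C_derive w (0 + RtoC t * z) * z))%C). fold (dv t) in A.
    rewrite !Cmod_mult, Hu, Rmult_1_l in A. fold r in A.
    assert (0 <= 1 - t ^ 2 * r ^ 2)
      by (assert (0 <= t * r <= 1) by nra; replace (t ^ 2 * r ^ 2) with (t * r * (t * r)) by ring; nra).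
    apply Rle_trans with (Cmod (C_derive w (0 + RtoC t * z)) * r * (1 - t ^ 2 * r ^ 2)).
    - apply Rmult_le_compat_r; assumption.
    - replace ((t * r) ^ 2) with (t ^ 2 * r ^ 2) in S by ring.
      apply Rmult_le_compat_l with (r := r) in S; [|exact Pr].
      apply Rle_trans with (r * (1 - Cmod (w (0 + RtoC t * z)%C) ^ 2)); [lra|].
      apply Rmult_le_compat_l; lra. }
  set (k := fun t => (v t - t * r) / (1 - v t * (t * r))).
  assert (Den : forall t, 0 <= t <= 1 -> 0 < 1 - v t * (t * r)).
  { intros t Ht. destruct (Bv t Ht) as [B1 _].
    assert (0 <= t * r < 1) by nra. nra. }
  (* The terms mixing [v t] and [t * r] cancel in the quotient rule; what is left of the numerator
     is the difference of the two sides of [Bdv]. *)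
  destruct (MVT_cor2 k (fun t => (dv t * (1 - t ^ 2 * r ^ 2) - r * (1 - v t ^ 2))
                                 / (1 - v t * (t * r)) ^ 2) 0 1) as [c [C1 C2]]; [lra| |].
  - intros t Ht. specialize (Den t Ht).
    apply is_derive_Reals. unfold k.
    assert (Dt := Dv t Ht). apply is_derive_Reals in Dt.
    evar_last.
    + apply (is_derive_div (fun t => v t - t * r) (fun t => 1 - v t * (t * r))); [| |lra].
      * apply (is_derive_minus (V := R_NormedModule) v (fun t => t * r)); [exact Dt|].
        instantiate (1 := r). auto_derive; [exact I|ring].
      * instantiate (1 := - (dv t * (t * r) + v t * r)).
        apply (is_derive_ext (fun t => 1 + - (v t * (t * r)))); [intros; simpl; ring|].
        evar_last.
        -- apply (is_derive_plus (V := R_NormedModule)); [apply is_derive_const|].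
           apply (is_derive_opp (V := R_NormedModule)).
           apply (is_derive_mult (K := R_AbsRing) v (fun t => t * r)); [exact Dt| |exact Rmult_comm].
           instantiate (1 := r). auto_derive; [exact I|ring].
        -- unfold plus, opp, zero, mult; simpl. unfold mult; simpl. ring.
    + unfold minus, plus, opp; simpl. field. lra.
  - assert (Kc := Bdv c ltac:(lra)). specialize (Den c ltac:(lra)) as Dc.
    assert (k 1 - k 0 <= 0).
    { rewrite C1, Rminus_0_r, Rmult_1_r. apply Rmult_le_reg_r with ((1 - v c * (c * r)) ^ 2); [nra|].
      unfold Rdiv. rewrite Rmult_assoc, Rinv_l by nra. lra. }
    assert (K0 : k 0 = 0).
    { unfold k, v. replace (0 + RtoC 0 * z)%C with (RtoC 0) by ring. rewrite H0.
      replace (u * 0)%C with (RtoC 0) by ring. simpl. field. }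
    assert (V1 : v 1 = Cmod (w z)).
    { unfold v. replace (0 + RtoC 1 * z)%C with z by ring. rewrite E. reflexivity. }
    assert (K1 : k 1 <= 0) by lra. unfold k in K1. rewrite V1, Rmult_1_l in K1.
    specialize (Den 1 ltac:(lra)). rewrite V1, Rmult_1_l in Den.
    apply Rmult_le_compat_r with (r := 1 - Cmod (w z) * r) in K1; [|lra].
    unfold Rdiv in K1. rewrite Rmult_assoc, Rinv_l in K1; lra.
Qed.

(** * The logarithmic derivative on the class [class_F2] *)

(** Quotients with a removed singularity are given by a formula only off 0; this transfers an
    identity to the value at 0. *)
Lemma Ccont_unique (f g : C -> C) :
  Ccont f 0 -> Ccont g 0 -> (forall y, D y -> y <> 0 -> f y = g y) -> f 0 = g 0.
Proof.
  intros Hf Hg E. apply Ceq_minus, Cmod_eq_0. apply Rle_antisym; [|apply Cmod_ge_0].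
  apply Rnot_lt_le. intros HP. set (e := Cmod (f 0 - g 0)) in *.
  destruct (Hf (e / 2)) as [d1 [H1 K1]]; [lra|].
  destruct (Hg (e / 2)) as [d2 [H2 K2]]; [lra|].
  set (d := Rmin 1 (Rmin d1 d2)).
  assert (Hd : 0 < d) by (apply Rmin_pos; [lra|apply Rmin_pos; assumption]).
  assert (d <= 1) by apply Rmin_l.
  assert (M : d <= Rmin d1 d2) by apply Rmin_r.
  assert (M1 := Rmin_l d1 d2). assert (M2 := Rmin_r d1 d2).
  set (y := RtoC (d / 2)). assert (Hy : Cmod y = d / 2) by (apply Cmod_RtoC_pos; lra).
  assert (Hy0 : y <> 0) by (apply Cmod_gt_0; lra).
  assert (A1 := K1 y ltac:(replace (y - 0)%C with y by ring; lra)).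
  assert (A2 := K2 y ltac:(replace (y - 0)%C with y by ring; lra)).
  rewrite (E y) in A1; [|unfold D; lra|exact Hy0].
  assert (T := Cmod_triangle (- (g y - f 0)) (g y - g 0)).
  replace (- (g y - f 0) + (g y - g 0))%C with (f 0 - g 0)%C in T by ring.
  rewrite Cmod_opp in T. fold e in T. lra.
Qed.

Lemma D_1p (z : C) : D z -> (1 + z)%C <> 0.
Proof.
  intros Hz. apply Cmod_gt_0. assert (T := Cmod_le_triangle_minus 1 (- z)).
  rewrite Cmod_opp, Cmod_1 in T. replace (1 - - z)%C with (1 + z)%C in T by ring.
  unfold D in Hz. lra.
Qed.

Lemma Cinv_Cconj (z : C) : z <> 0 -> (/ z)%C = (Cconj z * RtoC (/ Cmod z ^ 2))%C.
Proof.
  intros N. assert (P := proj1 (Cmod_gt_0 z) N).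
  rewrite RtoC_inv by (apply pow_nonzero; lra). rewrite Cmod2_conj. field.
  split; [|exact N]. intros H. apply (f_equal Cmod) in H. rewrite Cmod_conj, Cmod_0 in H. lra.
Qed.

Definition disk_center (c : R) : R := 1 / (1 - c ^ 2).
Definition disk_radius (c : R) : R := c * (c + 4) / (1 - c ^ 2).

(** Says that the closed disk for [s] lies in the open disk for [c]. As the centre moves to the
    right, this amounts to the left end [1 - 4 c / (1 - c ^ 2)] moving strictly to the left. *)
Lemma disk_incr (s c : R) : 0 <= s < c -> c < 1 ->
  disk_center c - disk_center s + disk_radius s < disk_radius c /\ disk_center s <= disk_center c.
Proof.
  intros Hs Hc. unfold disk_center, disk_radius.
  assert (0 < 1 - c ^ 2) by nra. assert (0 < 1 - s ^ 2) by nra.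
  assert (E : c * (c + 4) / (1 - c ^ 2) - (1 / (1 - c ^ 2) - 1 / (1 - s ^ 2) + s * (s + 4) / (1 - s ^ 2))
          = 4 * (c - s) * (1 + s * c) / ((1 - c ^ 2) * (1 - s ^ 2))) by (field; lra).
  assert (0 < 4 * (c - s) * (1 + s * c) / ((1 - c ^ 2) * (1 - s ^ 2))).
  { apply Rdiv_lt_0_compat; [|nra]. apply Rmult_lt_0_compat; nra. }
  split; [lra|].
  unfold Rdiv. rewrite !Rmult_1_l. apply Rinv_le_contravar; nra.
Qed.

Definition inclusion_disk (c : R) (q : C) : Prop :=
  Cmod (q - RtoC (disk_center c)) < disk_radius c.

(** In fact an equality: the difference is [- z * Cconj (1 + z) / ((1 + z) * (1 - s ^ 2))], and
    [1 + z] has the same modulus as its conjugate. *)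
Lemma div_1p_disk (z : C) (s : R) : Cmod z = s -> s < 1 ->
  Cmod (1 / (1 + z) - RtoC (disk_center s)) <= s / (1 - s ^ 2).
Proof.
  intros Hz Hs. assert (P : 0 <= s) by (rewrite <- Hz; apply Cmod_ge_0).
  assert (N0 : (1 + z)%C <> 0) by (apply D_1p; unfold D; lra).
  assert (N := proj1 (Cmod_gt_0 _) N0).
  assert (Q : 0 < 1 - s ^ 2) by nra.
  assert (Q0 : RtoC (1 - s ^ 2) <> 0) by (intros H; apply RtoC_inj in H; lra).
  unfold disk_center. rewrite RtoC_div by lra.
  replace (1 / (1 + z) - 1 / RtoC (1 - s ^ 2))%C
    with (- (z * Cconj (1 + z)) / ((1 + z) * RtoC (1 - s ^ 2)))%C.
  - rewrite Cmod_div by (apply Cmult_neq_0; assumption).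
    rewrite Cmod_opp, !Cmod_mult, Cmod_conj, Hz, (Cmod_RtoC_pos (1 - s ^ 2)) by lra.
    right. field. lra.
  - rewrite Cplus_conj. replace (Cconj (RtoC 1)) with (RtoC 1)
      by (apply injective_projections; simpl; ring).
    replace (- (z * (1 + Cconj z)))%C with (- (z + z * Cconj z))%C by ring.
    rewrite <- Cmod2_conj, Hz. rewrite RtoC_minus in *. field. split; assumption.
Qed.

(** Collects in one function [Q] all that the radius proofs use of [class_F2]. The relation to [f]
    is stated as a product, which avoids the quotient at 0; [f] does not vanish off 0 because
    neither [p] nor [h] has zeros. *)
Lemma F2_log_derivative (f : C -> C) : class_F2 f ->
  exists Q : C -> C, holo Q /\ Q 0 = 1 /\
    (forall z, D z -> z <> 0 -> f z <> 0 /\ (z * C_derive f z = Q z * f z)%C) /\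
    (forall c z, 0 < c < 1 -> Cmod z < c -> inclusion_disk c (Q z)).
Proof.
  intros [[Hfa [Hf0 Hf1]] [g [[Hga [Hg0 Hg1]] [[p [[Hpa Hp] Hpos]] [h [[Hha Hh] Hh1]]]]]].
  apply analytic_holo in Hfa, Hga, Hpa, Hha.
  apply is_derive_Cderiv in Hf1, Hg1.
  assert (Np : forall z, D z -> p z <> 0).
  { intros z Hz H. specialize (Hpos z Hz). rewrite H in Hpos. simpl in Hpos. lra. }
  assert (Nh : forall z, D z -> h z <> 0).
  { intros z Hz H. specialize (Hh1 z Hz). rewrite H in Hh1.
    replace (0 - 1)%C with (- (1))%C in Hh1 by ring. rewrite Cmod_m1 in Hh1. lra. }
  assert (N1 := D_1p).
  assert (Ng : forall z, D z -> z <> 0 -> g z <> 0) by (intros z Hz Hz0; apply Hh; assumption).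
  (* Both [f] and [g] have derivative 1 at 0, so their slope functions [u] and [v] have the same
     value there and [h = u / v] tends to 1. *)
  assert (Hh0 : h 0 = 1).
  { apply Cderiv_caratheodory in Hf1, Hg1.
    destruct Hf1 as [u [U1 [U2 U3]]]. destruct Hg1 as [v [V1 [V2 V3]]].
    assert (E := Ccont_unique (fun y => h y * v y)%C u).
    cbv beta in E. rewrite U2, V2 in E.
    transitivity (h 0 * 1)%C; [ring|]. apply E.
    - apply Ccont_mult; [|exact V1].
      apply (Cderiv_cont _ _ _ (holo_C_derive h 0 Hha D_0)).
    - exact U1.
    - intros y Hy Hy0. destruct (Hh y Hy Hy0) as [Gy ->].
      specialize (U3 y). specialize (V3 y). rewrite Hf0 in U3. rewrite Hg0 in V3.
      replace (f y) with (u y * y)%C by (transitivity (u y * (y - 0))%C; [ring|rewrite <- U3; ring]).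
      assert (Gv : g y = (v y * y)%C) by (transitivity (g y - 0)%C; [ring|rewrite V3; ring]).
      rewrite Gv in *. field. split; [exact Hy0|]. intros H. apply Gy. rewrite H. ring. }
  assert (Df : forall z, D z -> f z = (z * p z * h z / (1 + z))%C).
  { intros z Hz. destruct (Ceq_dec z 0) as [->|Hz0].
    - rewrite Hf0. field.
    - destruct (Hp z Hz Hz0) as [_ ->]. destruct (Hh z Hz Hz0) as [_ ->].
      field. auto. }
  set (dp := C_derive p). set (dh := C_derive h).
  assert (Dp : forall z, D z -> Cderiv p z (dp z)) by (intros; apply holo_C_derive; assumption).
  assert (Dh : forall z, D z -> Cderiv h z (dh z)) by (intros; apply holo_C_derive; assumption).
  assert (Hdp : holo dp) by (apply (holo_derive_half_plane p); assumption).
  assert (Hdh : holo dh).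
  { apply (holo_derive_bounded h dh 2 Dh). intros z Hz. specialize (Hh1 z Hz).
    assert (T := Cmod_le_triangle_minus (h z) 1). rewrite Cmod_1 in T. lra. }
  exists (fun z => 1 / (1 + z) + z * (dp z / p z) + z * (dh z / h z))%C.
  split; [|split; [|split]].
  - intros z Hz. destruct (Hdp z Hz) as [l1 L1]. destruct (Hdh z Hz) as [l2 L2].
    eexists. apply Cderiv_plus; [apply Cderiv_plus|].
    + apply Cderiv_div; [apply Cderiv_const|apply Cderiv_plus; [apply Cderiv_const|apply Cderiv_id]|].
      apply N1, Hz.
    + apply Cderiv_mult; [apply Cderiv_id|]. apply Cderiv_div; [exact L1|apply Dp, Hz|apply Np, Hz].
    + apply Cderiv_mult; [apply Cderiv_id|]. apply Cderiv_div; [exact L2|apply Dh, Hz|apply Nh, Hz].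
  - field. repeat split; first [apply Nh, D_0|apply Np, D_0].
  - intros z Hz Hz0. split.
    { rewrite Df by exact Hz. intros H.
      assert (z * p z * h z = 0)%C.
      { transitivity (z * p z * h z / (1 + z) * (1 + z))%C; [field; auto|rewrite H; ring]. }
      revert H0. repeat apply Cmult_neq_0; auto. }
    erewrite (C_derive_Cderiv f z).
    2:{ destruct (near_D z Hz) as [d [Hd K]].
        apply (Cderiv_ext_loc (fun z => z * p z * h z / (1 + z))%C f z _ d Hd).
        - intros y Hy. symmetry. apply Df, K, Hy.
        - apply Cderiv_div; [|apply Cderiv_plus; [apply Cderiv_const|apply Cderiv_id]|apply N1, Hz].
          apply Cderiv_mult; [apply Cderiv_mult; [apply Cderiv_id|apply Dp, Hz]|apply Dh, Hz]. }
    rewrite (Df z Hz). cbv beta. field. auto.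
  - intros c z Hc Hzc. set (s := Cmod z) in *.
    assert (Ps : 0 <= s) by apply Cmod_ge_0.
    assert (Hz : D z) by (unfold D; fold s; lra).
    assert (Q : 0 < 1 - s ^ 2) by nra.
    assert (B1 := div_1p_disk z s eq_refl ltac:(lra)).
    assert (B2 : Cmod (z * (dp z / p z)) <= 2 * s / (1 - s ^ 2)).
    { assert (S := Schwarz_Pick_half_plane p z (dp z) Hpa Hpos Hz (Dp z Hz)). fold s in S.
      assert (R1 := Re_le_Cmod (p z)).
      assert (Pp := proj1 (Cmod_gt_0 _) (Np z Hz)).
      rewrite Cmod_mult, Cmod_div by (apply Np, Hz). fold s.
      apply Rmult_le_reg_r with (Cmod (p z) * (1 - s ^ 2)); [nra|].
      replace (s * (Cmod (dp z) / Cmod (p z)) * (Cmod (p z) * (1 - s ^ 2)))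
        with (s * (Cmod (dp z) * (1 - s ^ 2))) by (field; lra).
      replace (2 * s / (1 - s ^ 2) * (Cmod (p z) * (1 - s ^ 2)))
        with (s * (2 * Cmod (p z))) by (field; lra).
      apply Rmult_le_compat_l; lra. }
    (* With [m = |h - 1|], Schwarz-Pick bounds [|h'| (1 - s ^ 2)] by [(1 - m) (1 + m)]. Here
       [1 - m <= |h|], and [m <= s] by Schwarz since [h 0 = 1]. *)
    assert (B3 : Cmod (z * (dh z / h z)) <= s * (1 + s) / (1 - s ^ 2)).
    { set (w := fun z => (h z - 1)%C).
      assert (Dw : forall u, D u -> Cderiv w u (dh u)).
      { intros u Hu. eapply Cderiv_eq; [apply Cderiv_minus; [apply Dh, Hu|apply Cderiv_const]|ring]. }
      assert (Hw : holo w) by (intros u Hu; exists (dh u); apply Dw, Hu).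
      assert (S := Schwarz_Pick w z (dh z) Hw Hh1 Hz (Dw z Hz)). fold s in S.
      assert (S2 : Cmod (w z) <= s).
      { apply Schwarz; try assumption. unfold w. rewrite Hh0. ring. }
      set (m := Cmod (w z)) in *.
      assert (Pm : 0 <= m) by apply Cmod_ge_0.
      assert (R1 : 1 - m <= Cmod (h z)).
      { assert (T := Cmod_le_triangle_minus 1 (- w z)). rewrite Cmod_opp, Cmod_1 in T.
        replace (1 - - w z)%C with (h z) in T by (unfold w; ring). exact T. }
      assert (Ph : 0 < Cmod (h z)) by lra.
      rewrite Cmod_mult, Cmod_div by (apply Nh, Hz). fold s.
      apply Rmult_le_reg_r with (Cmod (h z) * (1 - s ^ 2)); [nra|].
      replace (s * (Cmod (dh z) / Cmod (h z)) * (Cmod (h z) * (1 - s ^ 2)))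
        with (s * (Cmod (dh z) * (1 - s ^ 2))) by (field; lra).
      replace (s * (1 + s) / (1 - s ^ 2) * (Cmod (h z) * (1 - s ^ 2)))
        with (s * ((1 + s) * Cmod (h z))) by (field; lra).
      apply Rmult_le_compat_l; [exact Ps|]. nra. }
    destruct (disk_incr s c) as [I1 I2]; [lra|lra|].
    unfold inclusion_disk.
    replace (1 / (1 + z) + z * (dp z / p z) + z * (dh z / h z) - RtoC (disk_center c))%C
      with ((1 / (1 + z) - RtoC (disk_center s)) + (RtoC (disk_center s - disk_center c)
            + (z * (dp z / p z) + z * (dh z / h z))))%C by (rewrite RtoC_minus; ring).
    eapply Rle_lt_trans; [apply Cmod_triangle|].
    eapply Rle_lt_trans; [apply Rplus_le_compat_l, Cmod_triangle|].
    eapply Rle_lt_trans; [apply Rplus_le_compat_l, Rplus_le_compat_l, Cmod_triangle|].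
    rewrite Cmod_R, Rabs_left1 by lra.
    assert (E : s / (1 - s ^ 2) + 2 * s / (1 - s ^ 2) + s * (1 + s) / (1 - s ^ 2) = disk_radius s)
      by (unfold disk_radius; field; lra).
    lra.
Qed.

(** * Radii of starlikeness *)

Lemma RtoC_neq_0 (x : R) : x <> 0 -> RtoC x <> 0.
Proof. intros H E. apply H, RtoC_inj, E. Qed.

Lemma RtoC_plus_neq_0 (x y : R) : x + y <> 0 -> (RtoC x + RtoC y)%C <> 0.
Proof. rewrite <- RtoC_plus. apply RtoC_neq_0. Qed.

Lemma D_scal (r : R) (z : C) : 0 <= r <= 1 -> D z -> D (RtoC r * z)%C.
Proof.
  unfold D. intros Hr Hz. rewrite Cmod_mult, Cmod_RtoC_pos by lra.
  assert (P := Cmod_ge_0 z). nra.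
Qed.

Lemma dilate_deriv (r : R) (f : C -> C) (z l : C) :
  r <> 0 -> Cderiv f (RtoC r * z)%C l -> Cderiv (dilate r f) z l.
Proof.
  intros Hr H. unfold dilate. eapply Cderiv_eq.
  - apply Cderiv_scal. apply (Cderiv_comp f (fun z => RtoC r * z)%C); [exact H|].
    apply Cderiv_scal, Cderiv_id.
  - field. apply RtoC_neq_0, Hr.
Qed.

Section Dilation.
Variables (f Q : C -> C) (r : R).
Hypothesis Hf : class_A f.
Hypothesis HQ : holo Q.
Hypothesis HfQ : forall z, D z -> z <> 0 -> f z <> 0 /\ (z * C_derive f z = Q z * f z)%C.
Hypothesis Hr : 0 < r <= 1.

Lemma dilate_class_A : class_A (dilate r f).
Proof using Hf Hr.
  destruct Hf as [Ha [H0 H1]]. apply analytic_holo in Ha. apply is_derive_Cderiv in H1.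
  split; [|split].
  - apply analytic_holo. intros z Hz. destruct (Ha (RtoC r * z)%C) as [l Hl].
    + apply D_scal; [lra|exact Hz].
    + exists l. apply dilate_deriv; [lra|exact Hl].
  - unfold dilate. replace (RtoC r * 0)%C with (RtoC 0) by ring. rewrite H0. ring.
  - apply is_derive_Cderiv, dilate_deriv; [lra|].
    replace (RtoC r * 0)%C with (RtoC 0) by ring. exact H1.
Qed.

Lemma dilate_log_derivative (z : C) : D z -> z <> 0 ->
  dilate r f z <> 0 /\
  (z * C_derive (dilate r f) z / dilate r f z)%C = Q (RtoC r * z)%C.
Proof using Hf HfQ Hr.
  intros Hz Hz0. assert (Nr : RtoC r <> 0) by (apply RtoC_neq_0; lra).
  assert (Hrz : D (RtoC r * z)%C) by (apply D_scal; [lra|exact Hz]).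
  assert (Hrz0 : (RtoC r * z)%C <> 0) by (apply Cmult_neq_0; assumption).
  destruct (HfQ _ Hrz Hrz0) as [N E].
  assert (N' : dilate r f z <> 0).
  { unfold dilate. apply Cmult_neq_0; [|exact N]. intros H.
    (* If [/ r] were 0, then [r = / / r] would be [/ 0], which is 0 because both components have
       numerator 0. *)
    apply Nr. apply (f_equal Cinv) in H.
    transitivity (/ / RtoC r)%C; [field; exact Nr|]. rewrite H.
    apply injective_projections; simpl; unfold Rdiv; ring. }
  split; [exact N'|].
  destruct Hf as [Ha _]. apply analytic_holo in Ha.
  rewrite (C_derive_Cderiv _ _ _ (dilate_deriv r f z _ ltac:(lra) (holo_C_derive f _ Ha Hrz))).
  unfold dilate.
  transitivity ((RtoC r * z * C_derive f (RtoC r * z)) / f (RtoC r * z))%C.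
  - field. split; assumption.
  - rewrite E. field. exact N.
Qed.

Lemma dilate_Q_holo : holo (fun z => Q (RtoC r * z)%C).
Proof using HQ Hr.
  intros z Hz. destruct (HQ (RtoC r * z)%C) as [l Hl]; [apply D_scal; [lra|exact Hz]|].
  eexists. apply (Cderiv_comp Q (fun z => RtoC r * z)%C); [exact Hl|].
  apply Cderiv_scal, Cderiv_id.
Qed.

(** The quotient [q] in [starlike_wrt] is unique: it is prescribed off 0, and by continuity at 0. So
    it must be [Q (r z)], and membership of the dilation becomes a statement on [Q] alone. *)
Lemma starlike_dilate (phi : C -> C) :
  starlike_wrt phi (dilate r f) <-> subordinate (fun z => Q (RtoC r * z)%C) phi.
Proof using Hf HQ HfQ Hr.
  split.
  - intros [_ [q [[Hq Eq] [w [W1 [W2 [W3 W4]]]]]]].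
    apply analytic_holo in Hq.
    assert (E : forall z, D z -> q z = Q (RtoC r * z)%C).
    { assert (E1 : forall z, D z -> z <> 0 -> q z = Q (RtoC r * z)%C).
      { intros z Hz Hz0. destruct (Eq z Hz Hz0) as [_ ->].
        apply (dilate_log_derivative z Hz Hz0). }
      intros z Hz. destruct (Ceq_dec z 0) as [->|n]; [|apply E1; assumption].
      apply (Ccont_unique q (fun z => Q (RtoC r * z)%C)); [| |exact E1].
      - apply (Cderiv_cont _ _ _ (holo_C_derive q 0 Hq D_0)).
      - apply (Cderiv_cont _ _ _ (holo_C_derive _ 0 dilate_Q_holo D_0)). }
    exists w. repeat split; try assumption. intros z Hz. rewrite <- E by exact Hz. auto.
  - intros Hsub. split; [apply dilate_class_A|].
    exists (fun z => Q (RtoC r * z)%C). split; [|exact Hsub].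
    split; [apply analytic_holo, dilate_Q_holo|]. intros z Hz Hz0.
    destruct (dilate_log_derivative z Hz Hz0) as [N E]. split; [exact N|]. symmetry. exact E.
Qed.

End Dilation.

Lemma radius_ok_of_inverse (phi W : C -> C) (c : R) :
  0 < c < 1 -> W 1 = 0 ->
  (forall q, inclusion_disk c q -> (exists l, Cderiv W q l) /\ D (W q) /\ phi (W q) = q) ->
  radius_ok (starlike_wrt phi) class_F2 c.
Proof.
  intros Hc HW1 HW. split; [lra|]. intros r f Hr Hf.
  destruct (F2_log_derivative f Hf) as [Q [Q1 [Q2 [Q3 Q4]]]].
  apply (starlike_dilate f Q r (proj1 Hf) Q1 Q3); [lra|].
  assert (In : forall z, D z -> inclusion_disk c (Q (RtoC r * z)%C)).
  { intros z Hz. apply Q4; [exact Hc|]. unfold D in Hz.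
    rewrite Cmod_mult, Cmod_RtoC_pos by lra. assert (P := Cmod_ge_0 z). nra. }
  exists (fun z => W (Q (RtoC r * z)%C)). split; [|split; [|split]].
  - apply analytic_holo. intros z Hz. destruct (HW _ (In z Hz)) as [[l Hl] _].
    destruct (dilate_Q_holo Q r Q1 ltac:(lra) z Hz) as [m Hm].
    eexists. apply (Cderiv_comp W (fun z => Q (RtoC r * z)%C)); eassumption.
  - intros z Hz. apply HW, In, Hz.
  - replace (RtoC r * 0)%C with (RtoC 0) by ring. rewrite Q2. exact HW1.
  - intros z Hz. symmetry. apply HW, In, Hz.
Qed.

(** The choice [p = (1 - z) / (1 + z)] and [h = 1 - z]. At a real [z] in []0, 1[] all three terms of
    [z f' / f] reach their extreme bounds with the same negative sign, so that their sum is the left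
    end of the disk. *)
Definition extremal (z : C) : C := (z * (1 - z) ^ 2 / (1 + z) ^ 2)%C.

Lemma D_1m (z : C) : D z -> (1 - z)%C <> 0.
Proof.
  intros Hz. replace (1 - z)%C with (1 + - z)%C by ring. apply D_1p.
  unfold D. rewrite Cmod_opp. exact Hz.
Qed.

Lemma cayley_Re_pos (w : C) : D w -> 0 < Re ((1 + w) / (1 - w))%C.
Proof.
  intros Hw. assert (N := D_1m w Hw). assert (P := proj1 (Cmod_gt_0 _) N).
  unfold Cdiv. rewrite Cinv_Cconj, Cmult_assoc, re_scal_r by exact N.
  apply Rmult_lt_0_compat; [|apply Rinv_0_lt_compat, pow_lt, P].
  apply D_sqr in Hw. destruct w as [x y]. simpl in *. nra.
Qed.

Lemma extremal_deriv (z : C) : D z ->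
  Cderiv extremal z ((1 - z) * (1 - 4 * z - z ^ 2) / (1 + z) ^ 3)%C.
Proof.
  intros Hz. assert (N := D_1p z Hz).
  apply (Cderiv_ext (fun z => z * ((1 - z) * (1 - z)) / ((1 + z) * (1 + z)))%C).
  { intros y. unfold extremal. f_equal; simpl; [ring|f_equal; ring]. }
  assert (A : Cderiv (fun z => 1 - z)%C z (0 - 1)%C)
    by (apply Cderiv_minus; [apply Cderiv_const|apply Cderiv_id]).
  assert (B : Cderiv (fun z => 1 + z)%C z (0 + 1)%C)
    by (apply Cderiv_plus; [apply Cderiv_const|apply Cderiv_id]).
  eapply Cderiv_eq.
  - apply Cderiv_div; [apply Cderiv_mult; [apply Cderiv_id|apply Cderiv_mult; exact A]
      |apply Cderiv_mult; exact B|apply Cmult_neq_0; exact N].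
  - cbv beta. field. exact N.
Qed.

Lemma extremal_F2 : class_F2 extremal.
Proof.
  set (g := fun z => (z * (1 - z) / ((1 + z) * (1 + z)))%C).
  assert (A : forall z, Cderiv (fun z => 1 - z)%C z (0 - 1)%C)
    by (intros; apply Cderiv_minus; [apply Cderiv_const|apply Cderiv_id]).
  assert (B : forall z, Cderiv (fun z => 1 + z)%C z (0 + 1)%C)
    by (intros; apply Cderiv_plus; [apply Cderiv_const|apply Cderiv_id]).
  assert (Dg : forall z, D z -> Cderiv g z ((1 - 3 * z) / (1 + z) ^ 3)%C).
  { intros z Hz. assert (N := D_1p z Hz). eapply Cderiv_eq.
    - apply Cderiv_div; [apply Cderiv_mult; [apply Cderiv_id|apply A]
        |apply Cderiv_mult; apply B|apply Cmult_neq_0; exact N].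
    - cbv beta. field. exact N. }
  split; [|exists g; split; [|split]].
  - split; [|split].
    + apply analytic_holo. intros z Hz. eexists. apply extremal_deriv, Hz.
    + unfold extremal. field; apply (D_1p 0 D_0).
    + apply is_derive_Cderiv. eapply Cderiv_eq; [apply extremal_deriv, D_0|].
      field; apply (D_1p 0 D_0).
  - split; [|split].
    + apply analytic_holo. intros z Hz. eexists. apply Dg, Hz.
    + unfold g. field; apply (D_1p 0 D_0).
    + apply is_derive_Cderiv. eapply Cderiv_eq; [apply Dg, D_0|].
      field; apply (D_1p 0 D_0).
  - exists (fun z => (1 - z) / (1 + z))%C. split; [split|].
    + apply analytic_holo. intros z Hz. eexists.
      apply Cderiv_div; [apply A|apply B|apply D_1p, Hz].
    + intros z Hz Hz0. split; [exact Hz0|]. unfold g. field. split; [apply D_1p, Hz|exact Hz0].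
    + intros z Hz. replace ((1 - z) / (1 + z))%C with ((1 + - z) / (1 - - z))%C
        by (f_equal; ring).
      apply cayley_Re_pos. unfold D. rewrite Cmod_opp. exact Hz.
  - exists (fun z => 1 - z)%C. split; [split|].
    + apply analytic_holo. intros z Hz. eexists. apply A.
    + intros z Hz Hz0. assert (N := D_1p z Hz). assert (N' := D_1m z Hz). split.
      * unfold g. intros H. assert (E : (z * (1 - z) = 0)%C).
        { transitivity (z * (1 - z) / ((1 + z) * (1 + z)) * ((1 + z) * (1 + z)))%C;
            [field; exact N|rewrite H; ring]. }
        revert E. apply Cmult_neq_0; assumption.
      * unfold extremal, g. field. auto.
    + intros z Hz. replace (1 - z - 1)%C with (- z)%C by ring. rewrite Cmod_opp. exact Hz.
Qed.

(** For [c < s < rho], dilating the extremal function by [rho] makes [Q s = 1 - 4 s / (1 - s ^ 2)]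
    the value at the point [s / rho] of the disk. It lies below the threshold, yet subordination
    would make it a value of [phi]. *)
Lemma radius_upper (phi : C -> C) (c rho : R) :
  0 < c < 1 ->
  (forall x w, x < 1 - 4 * c / (1 - c ^ 2) -> D w -> phi w <> RtoC x) ->
  radius_ok (starlike_wrt phi) class_F2 rho -> rho <= c.
Proof.
  intros Hc Hphi [Hrho Hok]. apply Rnot_lt_le. intros Hlt.
  set (s := (c + rho) / 2). assert (Hs : c < s < rho) by (unfold s; lra).
  assert (S := Hok rho extremal ltac:(lra) extremal_F2).
  destruct (F2_log_derivative extremal extremal_F2) as [Q [Q1 [_ [Q3 _]]]].
  apply (starlike_dilate extremal Q rho (proj1 extremal_F2) Q1 Q3) in S; [|lra].
  destruct S as [w [_ [W2 [_ W4]]]].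
  assert (Hz : D (RtoC (s / rho))).
  { unfold D. rewrite Cmod_RtoC_pos by (apply Rdiv_le_0_compat; lra).
    apply Rmult_lt_reg_r with rho; [lra|]. unfold Rdiv. rewrite Rmult_assoc, Rinv_l; lra. }
  specialize (W2 _ Hz). specialize (W4 _ Hz). cbv beta in W4.
  replace (RtoC rho * RtoC (s / rho))%C with (RtoC s) in W4.
  2:{ rewrite <- RtoC_mult. f_equal. field. lra. }
  assert (Hs' : D (RtoC s)) by (unfold D; rewrite Cmod_RtoC_pos; lra).
  assert (Ns : RtoC s <> 0) by (apply RtoC_neq_0; lra).
  destruct (Q3 _ Hs' Ns) as [N E].
  rewrite (C_derive_Cderiv _ _ _ (extremal_deriv _ Hs')) in E.
  assert (N1 := D_1p _ Hs'). assert (N2 := D_1m _ Hs').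
  assert (EQ : Q (RtoC s) = RtoC (1 - 4 * s / (1 - s ^ 2))).
  { transitivity (Q (RtoC s) * extremal (RtoC s) / extremal (RtoC s))%C; [field; exact N|].
    rewrite <- E. unfold extremal. rewrite RtoC_minus, RtoC_div by nra.
    rewrite RtoC_minus, RtoC_mult, RtoC_pow. field.
    repeat split; try assumption.
    replace (1 - RtoC s ^ 2)%C with ((1 - RtoC s) * (1 + RtoC s))%C by (simpl; ring).
    apply Cmult_neq_0; assumption. }
  apply (Hphi (1 - 4 * s / (1 - s ^ 2)) (w (RtoC (s / rho)))); [|exact W2|congruence].
  assert (0 < 1 - c ^ 2) by nra. assert (0 < 1 - s ^ 2) by nra.
  assert (E' : 4 * s / (1 - s ^ 2) - 4 * c / (1 - c ^ 2)
           = 4 * (s - c) * (1 + s * c) / ((1 - c ^ 2) * (1 - s ^ 2))) by (field; lra).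
  assert (0 < 4 * (s - c) * (1 + s * c) / ((1 - c ^ 2) * (1 - s ^ 2))).
  { apply Rdiv_lt_0_compat; [|nra]. apply Rmult_lt_0_compat; nra. }
  lra.
Qed.

(* The supremum of the admissible radii is admissible: near a given point the candidate
   [W (Q (rho z))] coincides with the Schwarz function of a smaller radius. *)
Lemma radius_ge_of_left_inverse (phi W : C -> C) (c : R) :
  (forall w, D w -> W (phi w) = w) -> W 1 = 0 ->
  radius_ok (starlike_wrt phi) class_F2 c -> 0 < c ->
  radius_ge (starlike_wrt phi) class_F2 c.
Proof.
  intros HW HW1 Hok Hc.
  destruct (completeness (radius_ok (starlike_wrt phi) class_F2)) as [rho [R1 R2]].
  - exists 1. intros x [Hx _]. lra.
  - exists c. exact Hok.
  - assert (Hcr : c <= rho) by (apply R1, Hok).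
    exists rho. split; [split|exact Hcr].
    2:{ intros r Hr. apply R1, Hr. }
    assert (Hrho : rho <= 1) by (apply R2; intros x [Hx _]; lra).
    split; [lra|]. intros r f Hr Hf.
    assert (Hlt : forall r', 0 < r' < rho -> starlike_wrt phi (dilate r' f)).
    { intros r' Hr'. apply NNPP. intros Hn.
      assert (rho <= r'); [|lra].
      apply R2. intros x [Hx Hx']. apply Rnot_lt_le. intros Hlt.
      apply Hn, Hx'; [lra|exact Hf]. }
    destruct (proj2 Hr) as [Hr'| ->]; [apply Hlt; lra|].
    destruct (F2_log_derivative f Hf) as [Q [Q1 [Q2 [Q3 _]]]].
    apply (starlike_dilate f Q rho (proj1 Hf) Q1 Q3); [lra|].
    assert (Loc : forall z0, D z0 -> exists w k d, holo w /\ (forall z, D z -> D (w z)) /\ 0 < d /\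
      forall y, Cmod (y - z0) < d -> D (RtoC k * y)%C /\
        phi (w (RtoC k * y)%C) = Q (RtoC rho * y)%C).
    (* With [|z0| < m < 1] the radius [rho * m] is below the supremum, hence admissible; its Schwarz
       function at [y / m] represents [Q (rho * y)] for [y] near [z0]. *)
    { intros z0 Hz0. unfold D in Hz0. set (m := (1 + Cmod z0) / 2).
      assert (Pz := Cmod_ge_0 z0).
      assert (Hm : Cmod z0 < m < 1) by (unfold m; lra).
      assert (Hmr : 0 < rho * m < rho) by nra.
      assert (S := Hlt (rho * m) ltac:(lra)).
      apply (starlike_dilate f Q (rho * m) (proj1 Hf) Q1 Q3) in S; [|lra].
      destruct S as [w [W1 [W2 [_ W4]]]]. apply analytic_holo in W1.
      exists w, (/ m), (m - Cmod z0). repeat split; try assumption; try lra.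
      - unfold D. assert (T := Cmod_le_triangle_minus y z0).
        rewrite Cmod_mult, Cmod_RtoC_pos by (left; apply Rinv_0_lt_compat; lra).
        apply Rmult_lt_reg_l with m; [lra|].
        rewrite <- Rmult_assoc, Rinv_r by lra. lra.
      - rewrite <- W4.
        + f_equal. rewrite Cmult_assoc, <- RtoC_mult. f_equal. f_equal. field. lra.
        + unfold D. assert (T := Cmod_le_triangle_minus y z0).
          rewrite Cmod_mult, Cmod_RtoC_pos by (left; apply Rinv_0_lt_compat; lra).
          apply Rmult_lt_reg_l with m; [lra|].
          rewrite <- Rmult_assoc, Rinv_r by lra. lra. }
    assert (At : forall z0, D z0 -> exists w k, (forall z, D z -> D (w z)) /\ D (RtoC k * z0)%C /\
                  phi (w (RtoC k * z0)%C) = Q (RtoC rho * z0)%C).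
    { intros z0 Hz0. destruct (Loc z0 Hz0) as [w [k [d [_ [L2 [L3 L4]]]]]].
      exists w, k. split; [exact L2|]. apply L4.
      rewrite Cmod_minus_diag. exact L3. }
    exists (fun z => W (Q (RtoC rho * z)%C)). split; [|split; [|split]].
    + apply analytic_holo. intros z0 Hz0.
      destruct (Loc z0 Hz0) as [w [k [d [L1 [L2 [L3 L4]]]]]].
      assert (Hk : D (RtoC k * z0)%C).
      { apply L4. rewrite Cmod_minus_diag. exact L3. }
      destruct (L1 _ Hk) as [l Hl]. eexists.
      apply (Cderiv_ext_loc (fun y => w (RtoC k * y)%C) _ z0 _ d L3).
      * intros y Hy. destruct (L4 y Hy) as [K1 K2]. rewrite <- K2. symmetry. apply HW, L2, K1.
      * apply (Cderiv_comp w (fun y => RtoC k * y)%C); [exact Hl|]. apply Cderiv_scal, Cderiv_id.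
    + intros z Hz. destruct (At z Hz) as [w [k [L2 [K1 K2]]]].
      rewrite <- K2, HW; apply L2, K1.
    + replace (RtoC rho * 0)%C with (RtoC 0) by ring. rewrite Q2. exact HW1.
    + intros z Hz. destruct (At z Hz) as [w [k [L2 [K1 K2]]]].
      rewrite <- K2, HW; [reflexivity|apply L2, K1].
Qed.

(** * Principal logarithms and roots *)

Lemma Carg_cos_sin (z : C) : z <> 0 ->
  Cmod z * cos (Carg z) = Re z /\ Cmod z * sin (Carg z) = Im z.
Proof.
  intros Hz. assert (P := proj1 (Cmod_gt_0 z) Hz).
  assert (E := Cmod2_alt z).
  assert (B : -1 <= Re z / Cmod z <= 1).
  { split; apply Rmult_le_reg_r with (Cmod z); try exact P;
      unfold Rdiv; rewrite Rmult_assoc, Rinv_l by lra; nra. }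
  assert (S : Cmod z * sin (acos (Re z / Cmod z)) = Rabs (Im z)).
  { rewrite sin_acos by exact B. rewrite <- sqrt_Rsqr_abs.
    rewrite <- (sqrt_Rsqr (Cmod z)) at 1 by lra.
    rewrite <- sqrt_mult_alt by apply Rle_0_sqr. f_equal.
    unfold Rsqr. field_simplify; [|lra]. lra. }
  unfold Carg. destruct (Rle_dec 0 (Im z)) as [H|H].
  - rewrite cos_acos by exact B. split; [field; lra|].
    rewrite S. apply Rabs_pos_eq, H.
  - rewrite cos_neg, sin_neg, cos_acos by exact B. split; [field; lra|].
    rewrite Ropp_mult_distr_r_reverse, S, Rabs_left by lra. ring.
Qed.

Lemma Cexp_Clog (z : C) : z <> 0 -> Cexp (Clog z) = z.
Proof.
  intros Hz. destruct (Carg_cos_sin z Hz) as [A B].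
  assert (P := proj1 (Cmod_gt_0 z) Hz).
  unfold Cexp, Clog; simpl. rewrite exp_ln, A, B by exact P. destruct z; reflexivity.
Qed.

Lemma Carg_bound (z : C) : - PI <= Carg z <= PI.
Proof.
  unfold Carg. assert (B := acos_bound (Re z / Cmod z)).
  destruct (Rle_dec 0 (Im z)); lra.
Qed.

Lemma Clog_Cexp (z : C) : Rabs (Im z) < PI -> Clog (Cexp z) = z.
Proof.
  intros H. apply Rabs_lt_between in H. unfold Clog, Carg.
  rewrite Cmod_Cexp, ln_exp. destruct z as [x y]. simpl in *.
  assert (P := exp_pos x).
  replace (exp x * cos y / exp x) with (cos y) by (field; lra).
  apply f_equal.
  destruct (Rle_dec 0 (exp x * sin y)) as [H'|H'].
  - apply acos_cos. split; [|lra]. apply Rnot_lt_le. intros Hy.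
    assert (S := sin_gt_0 (- y) ltac:(lra) ltac:(lra)). rewrite sin_neg in S. nra.
  - rewrite <- cos_neg, acos_cos; [ring|]. split; [|lra].
    apply Rnot_lt_le. intros Hy.
    apply H'. apply Rmult_le_pos; [lra|]. apply sin_ge_0; lra.
Qed.

Lemma Cpower_neq_0 (z : C) (a : R) : z <> 0 -> Cpower z a = Cexp (RtoC a * Clog z).
Proof. intros H. unfold Cpower. destruct (Ceq_dec z 0); [contradiction|reflexivity]. Qed.

Lemma Cpower_Cexp (z : C) (a : R) : Rabs (Im z) < PI -> Cpower (Cexp z) a = Cexp (RtoC a * z).
Proof. intros H. rewrite Cpower_neq_0, Clog_Cexp by (try apply Cexp_neq_0; exact H). reflexivity. Qed.

Lemma Csqrt_0 : Csqrt 0 = 0.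
Proof. unfold Csqrt, Cpower. destruct (Ceq_dec 0 0); [reflexivity|congruence]. Qed.

Lemma Csqrt_sqr (z : C) : (Csqrt z * Csqrt z)%C = z.
Proof.
  destruct (Ceq_dec z 0) as [->|n]; [rewrite Csqrt_0; ring|].
  unfold Csqrt. rewrite Cpower_neq_0 by exact n. rewrite <- Cexp_add.
  rewrite <- (Cexp_Clog z n) at 3. f_equal.
  apply injective_projections; simpl; field.
Qed.

Lemma Csqrt_Re_ge_0 (z : C) : 0 <= Re (Csqrt z).
Proof.
  destruct (Ceq_dec z 0) as [->|n]; [rewrite Csqrt_0; simpl; lra|].
  unfold Csqrt. rewrite Cpower_neq_0 by exact n. unfold Cexp. simpl.
  apply Rmult_le_pos; [left; apply exp_pos|].
  assert (B := Carg_bound z). apply cos_ge_0; lra.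
Qed.

Lemma Carg_Re_pos (z : C) : 0 < Re z -> Rabs (Carg z) < PI / 2.
Proof.
  intros H. assert (N : z <> 0) by (intros ->; simpl in H; lra).
  destruct (Carg_cos_sin z N) as [A _]. assert (P := proj1 (Cmod_gt_0 z) N).
  assert (B := Carg_bound z). assert (HPI := PI_RGT_0).
  apply Rabs_def1; apply Rnot_le_lt; intros Hb.
  - assert (cos (Carg z) <= 0) by (apply cos_le_0; lra). nra.
  - assert (cos (- Carg z) <= 0) by (apply cos_le_0; lra). rewrite cos_neg in H0. nra.
Qed.

Lemma Csqrt_of_sqr (s : C) : 0 < Re s -> Csqrt (s * s) = s.
Proof.
  intros H. assert (N : s <> 0) by (intros ->; simpl in H; lra).
  assert (B := Carg_Re_pos s H). assert (HPI := PI_RGT_0).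
  rewrite <- (Cexp_Clog s N), <- Cexp_add. unfold Csqrt. rewrite Cpower_Cexp.
  - f_equal. apply injective_projections; simpl; field.
  - simpl. apply Rabs_lt_between in B. apply Rabs_lt_between. lra.
Qed.

Lemma Ccont_components (f : C -> C) (z : C) :
  continuous (fun y : C => Re (f y)) z -> continuous (fun y : C => Im (f y)) z -> Ccont f z.
Proof.
  intros H1 H2 eps He. assert (He2 : 0 < eps / 2) by lra.
  destruct (proj1 (filterlim_locally _ _) H1 (mkposreal _ He2)) as [d1 K1].
  destruct (proj1 (filterlim_locally _ _) H2 (mkposreal _ He2)) as [d2 K2].
  exists (Rmin d1 d2). split; [apply Rmin_pos; apply cond_pos|]. intros y Hy.
  assert (A1 := K1 y (C_NormedModule_mixin_compat1 _ _ _ (Rlt_le_trans _ _ _ Hy (Rmin_l _ _)))).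
  assert (A2 := K2 y (C_NormedModule_mixin_compat1 _ _ _ (Rlt_le_trans _ _ _ Hy (Rmin_r _ _)))).
  change (Rabs (Re (f y) - Re (f z)) < eps / 2) in A1.
  change (Rabs (Im (f y) - Im (f z)) < eps / 2) in A2.
  eapply Rle_lt_trans; [apply Cmod_le_Rabs|].
  change (Rabs (Re (f y) - Re (f z)) + Rabs (Im (f y) - Im (f z)) < eps). lra.
Qed.

(** [Carg] is defined by [acos] and a case on the sign of the imaginary part; on the right
    half-plane the arctangent replaces it by an expression continuous across the real axis. *)
Lemma Clog_atan (z : C) : 0 < Re z -> Clog z = (ln (Cmod z), atan (Im z / Re z)).
Proof.
  intros H. assert (N : z <> 0) by (intros ->; simpl in H; lra).
  assert (P := proj1 (Cmod_gt_0 z) N). assert (HPI := PI_RGT_0).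
  assert (B := atan_bound (Im z / Re z)).
  rewrite <- (Clog_Cexp (ln (Cmod z), atan (Im z / Re z))).
  2:{ simpl. apply Rabs_lt_between. lra. }
  f_equal. unfold Cexp. simpl.
  assert (S : sqrt (1 + Rsqr (Im z / Re z)) = Cmod z / Re z).
  { replace (1 + Rsqr (Im z / Re z)) with (Rsqr (Cmod z / Re z)).
    - apply sqrt_Rsqr. apply Rdiv_le_0_compat; lra.
    - unfold Rsqr. assert (E := Cmod2_alt z). field_simplify; [|lra|lra].
      rewrite E. field. lra. }
  rewrite exp_ln, cos_atan, sin_atan, S by exact P.
  destruct z as [x y]. simpl in *. apply injective_projections; simpl; field; lra.
Qed.

Lemma Re_pos_near (z : C) : 0 < Re z -> forall y, Cmod (y - z) < Re z -> 0 < Re y.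
Proof.
  intros H y Hy. assert (A := re_le_Cmod (y - z)).
  change (Rabs (Re y - Re z) <= Cmod (y - z)) in A.
  apply Rabs_le_between in A. lra.
Qed.

Lemma Ccont_ext_loc (f g : C -> C) (z : C) (d : R) :
  0 < d -> (forall y, Cmod (y - z) < d -> f y = g y) -> Ccont f z -> Ccont g z.
Proof.
  intros Hd E H eps He. destruct (H eps He) as [d' [Hd' K]].
  exists (Rmin d d'). split; [apply Rmin_pos; assumption|]. intros y Hy.
  assert (A1 := Rlt_le_trans _ _ _ Hy (Rmin_l _ _)).
  assert (A2 := Rlt_le_trans _ _ _ Hy (Rmin_r _ _)).
  rewrite <- (E y A1), <- (E z); [apply K, A2|].
  rewrite Cmod_minus_diag. exact Hd.
Qed.

Lemma continuous_Cmod (z : C) : continuous (fun y : C => Cmod y) z.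
Proof.
  apply (proj2 (filterlim_locally (fun y : C => Cmod y) (Cmod z))). intros eps.
  assert (P := cond_pos eps).
  exists (mkposreal (eps / 2) ltac:(lra)). intros y Hy.
  (* The balls of the uniform structure on [C] are those of the product [R * R]; passing to [Cmod]
     costs a factor [sqrt 2], absorbed by [eps / 2]. *)
  apply C_NormedModule_mixin_compat2 in Hy. simpl in Hy.
  change (Cmod (y - z) < sqrt 2 * (eps / 2)) in Hy.
  assert (S : sqrt 2 < 2).
  { rewrite <- (sqrt_square 2) at 2 by lra. apply sqrt_lt_1; lra. }
  change (Rabs (Cmod y - Cmod z) < eps).
  assert (T1 := Cmod_le_triangle_minus y z). assert (T2 := Cmod_le_triangle_minus z y).
  rewrite (Cmod_minus_sym z y) in T2.
  apply Rabs_def1; nra.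
Qed.

Lemma Ccont_Clog (z : C) : 0 < Re z -> Ccont Clog z.
Proof.
  intros H. assert (N : z <> 0) by (intros ->; simpl in H; lra).
  assert (P := proj1 (Cmod_gt_0 z) N).
  apply (Ccont_ext_loc (fun z => (ln (Cmod z), atan (Im z / Re z))) Clog z (Re z) H).
  - intros y Hy. symmetry. apply Clog_atan, (Re_pos_near z H y Hy).
  - apply Ccont_components; simpl.
    + apply (continuous_comp (fun y : C => Cmod y) ln); [apply continuous_Cmod|].
      apply (ex_derive_continuous (V := R_NormedModule)). auto_derive. exact P.
    + apply (continuous_comp (fun y : C => snd y / fst y) atan).
      * apply (continuous_mult (K := R_AbsRing) (fun y : C => snd y) (fun y : C => / fst y)).
        -- apply continuous_snd.
        -- apply (continuous_comp (fun y : C => fst y) Rinv); [apply continuous_fst|].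
           apply (ex_derive_continuous (V := R_NormedModule)). auto_derive.
           change (Re z <> 0). lra.
      * apply (ex_derive_continuous (V := R_NormedModule)). auto_derive. exact I.
Qed.

Lemma Cderiv_Clog (z : C) : 0 < Re z -> Cderiv Clog z (/ z)%C.
Proof.
  intros H. assert (N : z <> 0) by (intros ->; simpl in H; lra).
  apply (Cderiv_inverse Cexp Clog z z (Re z) H).
  - intros y Hy. apply Cexp_Clog. assert (A := Re_pos_near z H y Hy).
    intros ->. simpl in A. lra.
  - apply Ccont_Clog, H.
  - rewrite <- (Cexp_Clog z N) at 2. apply Cderiv_Cexp.
  - exact N.
Qed.

(** * Differentiability without the value of the derivative *)

Definition Cdiff (f : C -> C) (z : C) : Prop := exists l, Cderiv f z l.

Lemma Cdiff_const (c z : C) : Cdiff (fun _ => c) z.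
Proof. eexists; apply Cderiv_const. Qed.

Lemma Cdiff_id (z : C) : Cdiff (fun y => y) z.
Proof. eexists; apply Cderiv_id. Qed.

Lemma Cdiff_plus (f g : C -> C) (z : C) : Cdiff f z -> Cdiff g z -> Cdiff (fun y => f y + g y)%C z.
Proof. intros [l L] [m M]. eexists; apply Cderiv_plus; eassumption. Qed.

Lemma Cdiff_opp (f : C -> C) (z : C) : Cdiff f z -> Cdiff (fun y => - f y)%C z.
Proof. intros [l L]. eexists; apply Cderiv_opp; eassumption. Qed.

Lemma Cdiff_minus (f g : C -> C) (z : C) : Cdiff f z -> Cdiff g z -> Cdiff (fun y => f y - g y)%C z.
Proof. intros [l L] [m M]. eexists; apply Cderiv_minus; eassumption. Qed.

Lemma Cdiff_mult (f g : C -> C) (z : C) : Cdiff f z -> Cdiff g z -> Cdiff (fun y => f y * g y)%C z.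
Proof. intros [l L] [m M]. eexists; apply Cderiv_mult; eassumption. Qed.

Lemma Cdiff_div (f g : C -> C) (z : C) :
  Cdiff f z -> Cdiff g z -> g z <> 0 -> Cdiff (fun y => f y / g y)%C z.
Proof. intros [l L] [m M] N. eexists; apply Cderiv_div; eassumption. Qed.

Lemma Cdiff_comp (f g : C -> C) (z : C) :
  Cdiff f (g z) -> Cdiff g z -> Cdiff (fun y => f (g y)) z.
Proof. intros [l L] [m M]. eexists; apply Cderiv_comp; eassumption. Qed.

Lemma Cdiff_ext_loc (f g : C -> C) (z : C) (d : R) :
  0 < d -> (forall y, Cmod (y - z) < d -> f y = g y) -> Cdiff f z -> Cdiff g z.
Proof. intros Hd E [l L]. exists l. exact (Cderiv_ext_loc f g z l d Hd E L). Qed.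

Lemma Cdiff_cont (f : C -> C) (z : C) : Cdiff f z -> Ccont f z.
Proof. intros [l L]. exact (Cderiv_cont _ _ _ L). Qed.

Lemma Cdiff_Cexp (z : C) : Cdiff Cexp z.
Proof. eexists; apply Cderiv_Cexp. Qed.

Lemma Cdiff_Clog (z : C) : 0 < Re z -> Cdiff Clog z.
Proof. eexists; apply Cderiv_Clog; assumption. Qed.

Lemma Cdiff_Cpower (a : R) (z : C) : 0 < Re z -> Cdiff (fun y => Cpower y a) z.
Proof.
  intros H. apply (Cdiff_ext_loc (fun y => Cexp (RtoC a * Clog y)) _ z (Re z) H).
  - intros y Hy. symmetry. apply Cpower_neq_0. assert (A := Re_pos_near z H y Hy).
    intros ->. simpl in A. lra.
  - apply (Cdiff_comp Cexp (fun y => RtoC a * Clog y)%C); [apply Cdiff_Cexp|].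
    apply Cdiff_mult; [apply Cdiff_const|apply Cdiff_Clog, H].
Qed.

Lemma Cdiff_Csqrt (z : C) : 0 < Re z -> Cdiff Csqrt z.
Proof. apply Cdiff_Cpower. Qed.

Lemma Csqrt_Re_pos (z : C) : 0 < Re z -> 0 < Re (Csqrt z).
Proof.
  intros H. assert (A := Csqrt_Re_ge_0 z). assert (E := f_equal Re (Csqrt_sqr z)).
  rewrite re_mult in E. nra.
Qed.

(** * Inclusion of disks in images *)

(** Along the segment from [a] to [q] the modulus of [W] starts below 1 and cannot cross 1, because
    a point with [|W| = 1] would be the image under [phi] of a boundary point, at distance at least
    [rho] from [a]. Thus [phi] only has to be estimated on the unit circle. *)
Lemma inverse_in_D (phi W : C -> C) (a : C) (rho : R) :
  (forall q, Cmod (q - a) < rho -> Ccont W q /\ phi (W q) = q) ->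
  D (W a) -> (forall w, Cmod w = 1 -> rho <= Cmod (phi w - a)) ->
  forall q, Cmod (q - a) < rho -> D (W q).
Proof.
  intros HW Ha Hb q Hq. unfold D in *. apply Rnot_le_lt. intros Hle.
  assert (In : forall t, 0 <= t <= 1 -> Cmod (a + RtoC t * (q - a) - a) < rho).
  { intros t Ht. apply Cmod_convex; try assumption.
    rewrite Cmod_minus_diag.
    assert (P := Cmod_ge_0 (q - a)). lra. }
  assert (No : forall t, 0 <= t <= 1 -> Cmod (W (a + RtoC t * (q - a))%C) <> 1).
  { intros t Ht H1. assert (A := Hb _ H1). rewrite (proj2 (HW _ (In t Ht))) in A.
    specialize (In t Ht). lra. }
  assert (Hlt : 1 < Cmod (W q)).
  { assert (N := No 1 ltac:(lra)). replace (a + RtoC 1 * (q - a))%C with q in N by ring. lra. }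
  destruct (IVT_interv (fun t => Cmod (W (a + RtoC t * (q - a))%C) - 1) 0 1) as [t [Ht1 Ht2]].
  - intros t Ht. apply continuity_pt_minus; [|apply continuity_pt_const; intros ? ?; reflexivity].
    apply continuity_pt_filterlim.
    apply (continuous_comp (U := R_UniformSpace) (V := C_UniformSpace)
             (fun t => W (a + RtoC t * (q - a))%C) (fun y : C => Cmod y)); [|apply continuous_Cmod].
    assert (PC : path_cont (fun t => W (a + RtoC t * (q - a))%C) t).
    { apply (path_cont_comp (fun z => W (a + z * (q - a))%C) (fun t => (t, 0))); [|apply path_cont_h].
      apply (Ccont_comp W (fun z => a + z * (q - a))%C).
      - apply Ccont_plus; [apply Ccont_const|apply Ccont_mult; [apply Ccont_id|apply Ccont_const]].
      - apply (HW _ (In t Ht)). }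
    apply (proj2 (filterlim_locally (F := locally t) (U := C_UniformSpace) _ _)).
    intros eps. destruct (PC eps (cond_pos eps)) as [d [Hd K]].
    exists (mkposreal d Hd). intros s Hs. apply C_NormedModule_mixin_compat1. apply K, Hs.
  - lra.
  - replace (a + RtoC 0 * (q - a))%C with a by ring. lra.
  - replace (a + RtoC 1 * (q - a))%C with q by ring. lra.
  - apply (No t Ht1). lra.
Qed.

(** [c] is the positive root of [k c ^ 2 + 4 c = k], in rationalised form; equivalently the left end
    of the disk is [1 - k]. From [k <= 1] follows [c <= 1 / 4], hence the bound [16 / 15] on the
    centre. *)
Lemma sharp_radius_root (k : R) : 0 < k <= 1 ->
  let c := k / (2 + sqrt (4 + k ^ 2)) in
  0 < c < 1 /\ k * c ^ 2 + 4 * c = k /\ 1 <= disk_center c <= 16 / 15 /\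
  disk_radius c = disk_center c - (1 - k) /\ 4 * c / (1 - c ^ 2) = k.
Proof.
  intros Hk c. set (s := sqrt (4 + k ^ 2)) in *.
  assert (Hs : s * s = 4 + k ^ 2) by (apply sqrt_sqrt; nra).
  assert (Hs0 : 0 <= s) by apply sqrt_pos.
  assert (Hs2 : 2 < s) by nra.
  assert (E : c * (2 + s) = k) by (unfold c; field; lra).
  assert (C0 : 0 < c) by (unfold c; apply Rdiv_lt_0_compat; lra).
  assert (C4 : c <= 1 / 4) by nra.
  assert (Q : k * c ^ 2 + 4 * c = k).
  { rewrite <- E at 2. assert (k * c = s - 2); [|nra].
    apply Rmult_eq_reg_r with (2 + s); [|lra].
    replace (k * c * (2 + s)) with (k * (c * (2 + s))) by ring. rewrite E. nra. }
  assert (P : 0 < 1 - c ^ 2) by nra.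
  split; [lra|]. split; [exact Q|]. unfold disk_radius, disk_center.
  split; [|split].
  - split; apply Rmult_le_reg_r with (1 - c ^ 2); try exact P;
      unfold Rdiv; rewrite ?Rmult_assoc, ?Rinv_l by lra; nra.
  - apply Rmult_eq_reg_r with (1 - c ^ 2); [|lra]. field_simplify; [|lra|lra]. nra.
  - apply Rmult_eq_reg_r with (1 - c ^ 2); [|lra]. field_simplify; [|lra]. nra.
Qed.

(** The same [c] serves for both bounds. The hypothesis on [W] covers every disk with left end
    [1 - k] and centre in [[1, 16 / 15]], so that the individual classes need not handle the formula
    for [c]. *)
Lemma sharp_radius (phi W : C -> C) (k : R) :
  0 < k <= 1 -> W 1 = 0 ->
  (forall a q, 1 <= a <= 16 / 15 -> Cmod (q - RtoC a) < a - (1 - k) ->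
     Cdiff W q /\ D (W q) /\ phi (W q) = q) ->
  (forall x w, x < 1 - k -> D w -> phi w <> RtoC x) ->
  is_radius (starlike_wrt phi) class_F2 (k / (2 + sqrt (4 + k ^ 2))).
Proof.
  intros Hk HW1 HW Hphi.
  destruct (sharp_radius_root k Hk) as [Hc [_ [Ha [Hr He]]]]. split.
  - apply (radius_ok_of_inverse phi W); [exact Hc|exact HW1|].
    intros q Hq. unfold inclusion_disk in Hq. rewrite Hr in Hq. exact (HW _ q Ha Hq).
  - intros rho. apply radius_upper; [exact Hc|]. rewrite He. exact Hphi.
Qed.

Lemma disk_sqr (q : C) (a rho : R) : 0 < rho ->
  (Cmod (q - RtoC a) < rho <-> (Re q - a) ^ 2 + Im q ^ 2 < rho ^ 2).
Proof.
  intros H. rewrite Cmod_lt_sqr by exact H. destruct q as [x y]. simpl.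
  replace (y + - 0) with y by ring. unfold Rminus. reflexivity.
Qed.

Lemma Cmod_lt_pos (z : C) (r : R) : Cmod z < r -> 0 < r.
Proof. intros H. assert (P := Cmod_ge_0 z). lra. Qed.

Lemma disk_Re (q : C) (a v : R) : Cmod (q - RtoC a) < a - v -> v < Re q.
Proof.
  intros H. assert (A := re_le_Cmod (q - RtoC a)).
  change (Rabs (Re q - a) <= Cmod (q - RtoC a)) in A.
  apply Rabs_le_between in A. lra.
Qed.

Lemma Re_pos_neq_0 (z : C) : 0 < Re z -> z <> 0.
Proof. intros H ->. simpl in H. lra. Qed.

(** * Starlikeness of order [alpha]: a half-plane *)

Lemma radius_S_order (alpha : R) : 0 <= alpha < 1 ->
  is_radius (S_order alpha) class_F2 ((1 - alpha) / (2 + sqrt (4 + (alpha - 1) ^ 2))).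
Proof.
  intros Ha. replace ((alpha - 1) ^ 2) with ((1 - alpha) ^ 2) by ring.
  assert (N2 : (2 - 2 * RtoC alpha)%C <> 0).
  { rewrite <- RtoC_mult, <- RtoC_minus. apply RtoC_neq_0. lra. }
  apply (sharp_radius _ (fun q => (q - 1) / (q + (1 - 2 * RtoC alpha)))%C); [lra| | |].
  - field. intros H. apply N2. rewrite <- H. ring.
  - intros a q _ Hq. replace (a - (1 - (1 - alpha))) with (a - alpha) in Hq by ring.
    apply disk_Re in Hq.
    assert (N : (q + (1 - 2 * RtoC alpha))%C <> 0).
    { apply Re_pos_neq_0. destruct q as [x y]. simpl in *. lra. }
    split; [|split].
    + apply Cdiff_div; [apply Cdiff_minus; [apply Cdiff_id|apply Cdiff_const]
        |apply Cdiff_plus; [apply Cdiff_id|apply Cdiff_const]|exact N].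
    (* The difference of the squared moduli is [4 * (1 - alpha) * (Re q - alpha)]. *)
    + apply D_div, Cmod_lt_Cmod. rewrite !Cmod2_alt. destruct q as [x y]. simpl in *. nra.
    + field. split; [exact N|].
      intros H. apply N2. rewrite <- H. ring.
  - intros x w Hx Hw H. assert (Nw := D_1m w Hw).
    assert (E : (w * RtoC (1 - 2 * alpha + x))%C = RtoC (x - 1)).
    { assert (E : (1 + (1 - 2 * RtoC alpha) * w = RtoC x * (1 - w))%C)
        by (rewrite <- H; field; exact Nw).
      rewrite RtoC_plus, !RtoC_minus, RtoC_mult.
      transitivity ((1 + (1 - 2 * RtoC alpha) * w) + RtoC x * w - 1)%C; [ring|].
      rewrite E. ring. }
    apply (f_equal (fun z => Cmod z ^ 2)) in E.
    rewrite Cmod_mult, !Cmod_R, Rpow_mult_distr, !pow2_abs in E.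
    assert (P := Cmod_ge_0 w). unfold D in Hw.
    assert (Q : Cmod w ^ 2 <= 1) by nra.
    assert (0 <= (1 - 2 * alpha + x) ^ 2) by apply pow2_ge_0. nra.
Qed.

(** * The cardioid *)

Lemma radius_S_c : is_radius S_c class_F2 (sqrt 10 - 3).
Proof.
  assert (S10 : sqrt 10 * sqrt 10 = 10) by (apply sqrt_sqrt; lra).
  assert (P10 := sqrt_pos 10).
  (* Completing the square, [phi w = 1 / 3 + 2 / 3 * (1 + w) ^ 2]: the real values on the disk
     exceed [1 / 3], whence [k = 2 / 3], and the inverse is a shifted square root. *)
  replace (sqrt 10 - 3) with (2 / 3 / (2 + sqrt (4 + (2 / 3) ^ 2))).
  2:{ replace (4 + (2 / 3) ^ 2) with (Rsqr (2 / 3 * sqrt 10)) by (unfold Rsqr; nra).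
      rewrite sqrt_Rsqr by lra. apply Rmult_eq_reg_r with (2 + 2 / 3 * sqrt 10); [|lra].
      unfold Rdiv at 1. rewrite Rmult_assoc, Rinv_l by lra. nra. }
  apply (sharp_radius _ (fun q => Csqrt ((3 * q - 1) / 2) - 1)%C); [lra| | |].
  - replace ((3 * 1 - 1) / 2)%C with (RtoC 1 * RtoC 1)%C by field.
    rewrite Csqrt_of_sqr by (simpl; lra). ring.
  - intros a q Ha Hq. assert (Hx := disk_Re _ _ _ Hq).
    assert (Hu : Re ((3 * q - 1) / 2)%C = (3 * Re q - 1) / 2)
      by (destruct q as [x y]; simpl; field).
    assert (Hv : Im ((3 * q - 1) / 2)%C = 3 * Im q / 2)
      by (destruct q as [x y]; simpl; field).
    assert (Pu : 0 < Re ((3 * q - 1) / 2)%C) by lra.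
    apply disk_sqr in Hq; [|lra].
    assert (Ps := Csqrt_Re_pos _ Pu). assert (Es := Csqrt_sqr ((3 * q - 1) / 2)%C).
    set (s := Csqrt ((3 * q - 1) / 2)%C) in *.
    split; [|split].
    + apply Cdiff_minus; [|apply Cdiff_const].
      apply (Cdiff_comp Csqrt (fun q => (3 * q - 1) / 2)%C); [apply Cdiff_Csqrt, Pu|].
      apply Cdiff_div; [|apply Cdiff_const|apply RtoC_neq_0; lra].
      apply Cdiff_minus; [|apply Cdiff_const]. apply Cdiff_mult; [apply Cdiff_const|apply Cdiff_id].
    + rewrite <- Es in Hu, Hv. apply D_sqr.
      destruct s as [p t], q as [x y]. simpl in *.
      set (N := p ^ 2 + t ^ 2).
      (* Here [s = 1 + w]. The disk gives [|s ^ 2| ^ 2 < 4 Re (s ^ 2)], hence [|s| ^ 2 < 2 Re s],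
         which is [|s - 1| < 1]. *)
      assert (H1 : N ^ 2 < 4 * (p ^ 2 - t ^ 2)).
      { replace (N ^ 2) with ((p * p - t * t) ^ 2 + (p * t + t * p) ^ 2) by (unfold N; ring).
        replace (4 * (p ^ 2 - t ^ 2)) with (4 * (p * p - t * t)) by ring.
        rewrite Hu, Hv. nra. }
      assert (H2 : N < 2 * p) by (unfold N in *; nra).
      unfold N in H2. nra.
    + transitivity (1 / 3 + 2 / 3 * (s * s))%C; [simpl; field|rewrite Es; field].
  - intros x w Hx Hw H. unfold D in Hw. apply D_sqr in Hw.
    destruct w as [p s]. assert (H1 := f_equal Re H). assert (H2 := f_equal Im H).
    simpl in H1, H2, Hw. field_simplify in H1. field_simplify in H2.
    assert (Hs : s = 0).
    { apply Rmult_eq_reg_r with (p + 1); nra. }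
    subst s. assert (0 <= (p + 1) ^ 2) by apply pow2_ge_0. nra.
Qed.

(** * The lune *)

Lemma sqrt2_sqr : sqrt 2 * sqrt 2 = 2.
Proof. apply sqrt_sqrt. lra. Qed.

Lemma sqrt2_bounds : 1.414 < sqrt 2 < 1.415.
Proof.
  assert (E := sqrt2_sqr). assert (P := sqrt_pos 2). split; nra.
Qed.

(** The image is the part of [|q - 1| < sqrt 2] outside the circle [|q + 1| = sqrt 2], with left end
    [sqrt 2 - 1], so [k = 2 - sqrt 2]. The equation [q = w + sqrt (1 + w ^ 2)] is solved by
    [w = (q - 1 / q) / 2]. *)
Lemma radius_S_lune :
  is_radius S_lune class_F2 ((2 - sqrt 2) / (2 + sqrt (10 - 4 * sqrt 2))).
Proof.
  assert (E2 := sqrt2_sqr). assert (B2 := sqrt2_bounds).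
  set (t := sqrt 2) in *.
  replace (10 - 4 * t) with (4 + (2 - t) ^ 2) by nra.
  apply (sharp_radius _ (fun q => (q * q - 1) / (2 * q))%C); [lra| | |].
  - field.
  - intros a q Ha Hq. assert (Hx := disk_Re _ _ _ Hq).
    assert (Nq : q <> 0) by (apply Re_pos_neq_0; lra).
    apply disk_sqr in Hq; [|lra].
    split; [|split].
    + apply Cdiff_div.
      * apply Cdiff_minus; [apply Cdiff_mult; apply Cdiff_id|apply Cdiff_const].
      * apply Cdiff_mult; [apply Cdiff_const|apply Cdiff_id].
      * apply Cmult_neq_0; [apply RtoC_neq_0; lra|exact Nq].
    + apply D_div, Cmod_lt_Cmod. rewrite !Cmod2_alt.
      destruct q as [x y]. simpl in *. set (N := x ^ 2 + y ^ 2).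
      (* [H1] is [|q - 1| < sqrt 2] and [H2] is [|q + 1| > sqrt 2]; their product [H3] is
         [|q ^ 2 - 1| < 2 |q|]. *)
      assert (H1 : N - 1 < 2 * x) by (unfold N; nra).
      assert (H2 : 1 - N < 2 * x) by (unfold N; nra).
      assert (H3 : 0 < (2 * x - (N - 1)) * (2 * x + (N - 1))) by (apply Rmult_lt_0_compat; lra).
      unfold N in H3. nra.
    + set (s := ((q * q + 1) / (2 * q))%C).
      replace (1 + ((q * q - 1) / (2 * q)) ^ 2)%C with (s * s)%C by (unfold s; field; exact Nq).
      rewrite Csqrt_of_sqr; [unfold s; field; exact Nq|].
      assert (Pq := proj1 (Cmod_gt_0 q) Nq).
      replace s with (RtoC (/ 2) * (q + Cconj q * RtoC (/ Cmod q ^ 2)))%C.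
      2:{ rewrite <- Cinv_Cconj, RtoC_inv by (exact Nq || lra). unfold s. field. exact Nq. }
      rewrite re_scal_l, re_plus, re_scal_r, re_conj.
      assert (0 < / Cmod q ^ 2) by (apply Rinv_0_lt_compat, pow_lt, Pq).
      assert (0 < Re q) by lra. nra.
  - intros x w Hx Hw H. set (s := Csqrt (1 + w ^ 2)) in *.
    assert (Es : (s * s = 1 + w ^ 2)%C) by apply Csqrt_sqr.
    (* The sign of the principal root matters: the squared equation alone also has solutions in the
       disk with [x < 0]. *)
    assert (Ps : 0 <= Re s) by apply Csqrt_Re_ge_0.
    replace s with (RtoC x - w)%C in Es, Ps by (rewrite <- H; ring).
    assert (E : (RtoC (2 * x) * w = RtoC (x * x - 1))%C).
    { rewrite RtoC_minus, !RtoC_mult.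
      transitivity (RtoC x * RtoC x + w ^ 2 - (RtoC x - w) * (RtoC x - w))%C; [simpl; ring|].
      rewrite Es. simpl. ring. }
    destruct w as [p u]. apply D_sqr in Hw.
    assert (I1 := f_equal Re E). assert (I2 := f_equal Im E). simpl in *.
    ring_simplify in I1. ring_simplify in I2.
    destruct (Req_dec x 0) as [->|Nx]; [lra|].
    assert (Hu : u = 0) by (apply Rmult_eq_reg_l with x; lra).
    subst u. assert (Hp : p < 1) by nra. assert (Hp' : -1 < p) by nra.
    destruct (Rle_dec x 0) as [H0|H0]; nra.
Qed.

(** * The rational function [psi_R] *)

Lemma Csqrt_RtoC (x : R) : 0 < x -> Csqrt (RtoC x) = RtoC (sqrt x).
Proof.
  intros H. rewrite <- (sqrt_sqrt x) at 1 by lra. rewrite RtoC_mult.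
  apply Csqrt_of_sqr. simpl. apply sqrt_lt_R0, H.
Qed.

(** For [x = Re w], [|w| = 1] and [b = a - 1], the left side is the squared modulus of the numerator
    of [psi_R w - a] minus [(a - (2 t - 2)) ^ 2] times that of the denominator. The factor [1 + x]
    shows the contact with the circle at [w = -1]. *)
Lemma psi_R_identity (t x b : R) : t * t = 2 ->
  ((t + 1) * x + 2 * x * x - 1 - b * (t + 1) * (t + 1 - x))
    * ((t + 1) * x + 2 * x * x - 1 - b * (t + 1) * (t + 1 - x))
  + (1 - x * x) * ((t + 1) + 2 * x + b * (t + 1)) * ((t + 1) + 2 * x + b * (t + 1))
  - (b + 3 - 2 * t) * (b + 3 - 2 * t)
    * ((t + 1) * (t + 1) * ((t + 1) * (t + 1) - 2 * (t + 1) * x + 1))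
  = 4 * (1 + x) * (t - b * (t + 1) * ((t + 1) * x - 1)).
Proof. intros H. nsatz. Qed.

(** By [psi_R_identity] it is enough that [(a - 1) * (t + 1) * ((t + 1) * x - 1) <= t]. Since
    [(t + 1) * x - 1 <= t], the bound [a - 1 <= 1 / 15] leaves ample room. *)
Lemma psi_R_boundary (a x y : R) :
  1 <= a <= 16 / 15 -> x ^ 2 + y ^ 2 = 1 ->
  a - (2 * sqrt 2 - 2) <= Cmod (psi_R (x, y) - RtoC a).
Proof.
  intros Ha Hw. assert (E2 := sqrt2_sqr). assert (B2 := sqrt2_bounds).
  unfold psi_R. set (t := sqrt 2) in *. set (k := RtoC (t + 1)). set (w := (x, y) : C).
  assert (Nk : k <> 0) by (apply RtoC_neq_0; lra).
  assert (Hk : Cmod k = t + 1) by (apply Cmod_RtoC_pos; lra).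
  assert (Hw1 : Cmod w <= 1) by (apply Cmod_le_sqr; [lra|simpl in *; lra]).
  assert (Nkw : (k - w)%C <> 0).
  { apply Cmod_gt_0. assert (T := Cmod_le_triangle_minus k w). lra. }
  replace (1 + (w * k + w ^ 2) / (k ^ 2 - k * w) - RtoC a)%C
    with ((w * k + w * w - RtoC (a - 1) * (k * (k - w))) / (k * (k - w)))%C.
  2:{ rewrite RtoC_minus. field. split; [|split; assumption].
      replace (k ^ 2 - k * w)%C with (k * (k - w))%C by (simpl; ring).
      apply Cmult_neq_0; assumption. }
  assert (Nd : (k * (k - w))%C <> 0) by (apply Cmult_neq_0; assumption).
  rewrite Cmod_div by exact Nd.
  assert (Pd := proj1 (Cmod_gt_0 _) Nd).
  apply Rmult_le_reg_r with (Cmod (k * (k - w))); [exact Pd|].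
  unfold Rdiv. rewrite Rmult_assoc, Rinv_l, Rmult_1_r by lra.
  set (n := (w * k + w * w - RtoC (a - 1) * (k * (k - w)))%C).
  assert (Pn := Cmod_ge_0 n).
  apply Rnot_lt_le. intros Hlt.
  assert (Hsq : Cmod n ^ 2 < ((a - (2 * t - 2)) * Cmod (k * (k - w))) ^ 2).
  { rewrite <- !Rsqr_pow2. apply Rsqr_incrst_1; lra. }
  rewrite Rpow_mult_distr in Hsq.
  assert (Id : Cmod n ^ 2 - (a - (2 * t - 2)) ^ 2 * Cmod (k * (k - w)) ^ 2
               = 4 * (1 + x) * (t - (a - 1) * (t + 1) * ((t + 1) * x - 1))).
  { rewrite <- (psi_R_identity t x (a - 1) E2). rewrite !Cmod2_alt.
    assert (Hy : y * y = 1 - x * x) by lra.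
    unfold n, k, w. simpl.
    transitivity
      (((t + 1) * x + (x * x - y * y) - (a - 1) * (t + 1) * (t + 1 - x))
        * ((t + 1) * x + (x * x - y * y) - (a - 1) * (t + 1) * (t + 1 - x))
      + y * y * (((t + 1) + 2 * x + (a - 1) * (t + 1)) * ((t + 1) + 2 * x + (a - 1) * (t + 1)))
      - (a - 1 + 3 - 2 * t) * (a - 1 + 3 - 2 * t)
         * ((t + 1) * (t + 1) * ((t + 1 - x) * (t + 1 - x) + y * y))); [ring|].
    rewrite Hy. ring. }
  assert (Hx : -1 <= x <= 1) by nra.
  assert (0 <= 4 * (1 + x) * (t - (a - 1) * (t + 1) * ((t + 1) * x - 1))); [|lra].
  apply Rmult_le_pos; [lra|].
  assert ((a - 1) * (t + 1) * ((t + 1) * x - 1) <= 1 / 15 * (t + 1) * t); [|nra].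
  apply Rle_trans with ((a - 1) * (t + 1) * t); [|nra].
  apply Rmult_le_compat_l; nra.
Qed.

Lemma radius_S_R :
  is_radius S_R class_F2 ((3 - 2 * sqrt 2) / (2 + sqrt (21 - 12 * sqrt 2))).
Proof.
  assert (E2 := sqrt2_sqr). assert (B2 := sqrt2_bounds).
  replace (21 - 12 * sqrt 2) with (4 + (3 - 2 * sqrt 2) ^ 2) by nra.
  set (t := sqrt 2) in *. set (k := RtoC (t + 1)).
  assert (Ek : (k * k = 2 * k + 1)%C).
  { unfold k. rewrite <- !RtoC_mult, <- RtoC_plus. f_equal. nra. }
  assert (Nk : k <> 0) by (apply RtoC_neq_0; lra).
  (* A root of the quadratic [w ^ 2 + k q w = k ^ 2 (q - 1)], which is [psi_R w = q] cleared of its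
     denominator. *)
  set (W := fun q => (k / 2 * (Csqrt (q * q + 4 * q - 4) - q))%C).
  apply (sharp_radius _ W); [lra| | |].
  - unfold W. replace (1 * 1 + 4 * 1 - 4)%C with (1 * 1)%C by ring.
    rewrite Csqrt_of_sqr by (simpl; lra). ring.
  - intros a q Ha. replace (a - (1 - (3 - 2 * t))) with (a - (2 * t - 2)) by ring.
    assert (Rad : forall q, Cmod (q - RtoC a) < a - (2 * t - 2) -> 0 < Re (q * q + 4 * q - 4)%C).
    { clear q. intros q Hq. assert (Hx := disk_Re _ _ _ Hq).
      apply disk_sqr in Hq; [|lra]. destruct q as [x y]. simpl in *.
      (* The radicand [(q + 2) ^ 2 - 8] vanishes exactly at the left end [2 * t - 2] of the disk, as
         [-1] is a critical point of [psi_R]. Measured from there, the disk inequality keeps its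
         real part positive. *)
      set (X := x - (2 * t - 2)).
      assert (H1 : X ^ 2 + y ^ 2 < 2 * (a - (2 * t - 2)) * X) by (unfold X; nra).
      replace (x * x - y * y + (4 * x - 0 * y) + - (4)) with (X ^ 2 - y ^ 2 + 4 * t * X)
        by (unfold X; nra).
      assert (0 < X) by (unfold X; lra). nra. }
    assert (Loc : forall q, Cmod (q - RtoC a) < a - (2 * t - 2) -> Cdiff W q /\ psi_R (W q) = q).
    { clear q. intros q Hq. assert (Hr := Rad q Hq).
      assert (Es := Csqrt_sqr (q * q + 4 * q - 4)). assert (Ps := Csqrt_Re_pos _ Hr).
      assert (Hx := disk_Re _ _ _ Hq). split.
      - apply Cdiff_mult; [apply Cdiff_const|]. apply Cdiff_minus; [|apply Cdiff_id].
        apply (Cdiff_comp Csqrt (fun q => q * q + 4 * q - 4)%C); [apply Cdiff_Csqrt, Hr|].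
        apply Cdiff_minus; [|apply Cdiff_const].
        apply Cdiff_plus; apply Cdiff_mult; try apply Cdiff_id. apply Cdiff_const.
      - unfold W. set (s := Csqrt (q * q + 4 * q - 4)) in *.
        unfold psi_R. fold t. fold k. set (w := (k / 2 * (s - q))%C).
        assert (Ew : (w * w + k * q * w = k * k * (q - 1))%C).
        { unfold w. transitivity (k * k / 4 * (s * s - q * q))%C; [field|]. rewrite Es. field. }
        assert (Nd : (2 - (s - q))%C <> 0).
        { intros H. assert (Hs : s = (q + 2)%C)
            by (transitivity (q + 2 - (2 - (s - q)))%C; [ring|rewrite H; ring]).
          rewrite Hs in Es.
          assert (E8 : (RtoC 8 = 0)%C).
          { transitivity ((q + 2) * (q + 2) - (q * q + 4 * q - 4))%C; [ring|rewrite Es; ring]. }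
          apply RtoC_inj in E8. lra. }
        assert (Nd' : (k ^ 2 - k * w)%C <> 0).
        { replace (k ^ 2 - k * w)%C with (k * (k / 2) * (2 - (s - q)))%C by (unfold w; simpl; field).
          repeat apply Cmult_neq_0; try assumption.
          intros H.
          assert (A := f_equal (Cmult 2) H). revert A.
          replace (2 * / 2)%C with (RtoC 1) by field. rewrite Cmult_0_r. apply C1_nz. }
        replace (w * k + w ^ 2)%C with ((q - 1) * (k ^ 2 - k * w))%C.
        + field. exact Nd'.
        + transitivity (k * k * (q - 1) - k * w * q + k * w)%C; [simpl; ring|].
          rewrite <- Ew. simpl. ring. }
    intros Hq. split; [|split]; try apply Loc, Hq.
    apply (inverse_in_D psi_R W (RtoC a) (a - (2 * t - 2))); [| | |exact Hq].
    + intros q' Hq'. split; [apply Cdiff_cont|]; apply Loc, Hq'.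
    + unfold W. rewrite <- !RtoC_mult, <- RtoC_plus, <- RtoC_minus.
      set (r := a * a + 4 * a - 4). assert (Hr : 1 <= r <= 1.41) by (unfold r; nra).
      rewrite Csqrt_RtoC by lra.
      assert (Er : sqrt r * sqrt r = r) by (apply sqrt_sqrt; lra).
      assert (Pr := sqrt_pos r).
      replace (k / 2 * (RtoC (sqrt r) - RtoC a))%C with (RtoC ((t + 1) / 2 * (sqrt r - a))).
      2:{ unfold k. rewrite RtoC_mult, RtoC_minus, RtoC_div by lra. reflexivity. }
      unfold D. rewrite Cmod_R. assert (1 <= sqrt r <= 1.2) by nra. apply Rabs_def1; nra.
    + intros [x y] Hw. apply psi_R_boundary, Cmod_1_sqr, Hw. exact Ha.
  - intros x w Hx Hw H.
    assert (Nkw : (k - w)%C <> 0).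
    { apply Cmod_gt_0. assert (T := Cmod_le_triangle_minus k w).
      assert (Hk : Cmod k = t + 1) by (apply Cmod_RtoC_pos; lra). unfold D in Hw. lra. }
    unfold psi_R in H. fold t in H. fold k in H.
    assert (E : (w * w + k * RtoC x * w = k * k * (RtoC x - 1))%C).
    { rewrite <- H. field.
      replace (k ^ 2 - k * w)%C with (k * (k - w))%C by (simpl; ring).
      apply Cmult_neq_0; assumption. }
    apply D_sqr in Hw. destruct w as [p u].
    assert (I1 := f_equal Re E). assert (I2 := f_equal Im E). unfold k in I1, I2. simpl in *.
    set (K := t + 1) in *. assert (EK : K * K = 2 * K + 1) by (unfold K; nra).
    assert (BK : 2.414 < K < 2.415) by (unfold K; lra).
    replace (2 * t) with (2 * K - 2) in Hx by (unfold K; ring).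
    assert (I2' : u * (2 * p + K * x) = 0) by nra.
    apply Rmult_integral in I2'. destruct I2' as [->|Hp].
    + assert (I1' : x * (K * (K - p)) = p ^ 2 + K * K) by nra.
      assert (-1 < p < 1) by (split; nra).
      assert (0 <= (p + 1) ^ 2) by apply pow2_ge_0.
      assert (0 < K * (K - p)) by nra.
      assert (x * (K * (K - p)) < (2 * K - 4) * (K * (K - p))) by (apply Rmult_lt_compat_r; lra).
      nra.
    (* In this case [w] and its conjugate have sum [- k x] and product [k ^ 2 (1 - x)], and that
       product exceeds 1 for [x < 2 * t - 2]. *)
    + assert (HN : p ^ 2 + u ^ 2 = K * K * (1 - x)) by nra.
      nra.
Qed.

(** * The exponential *)

Lemma exp_double_ge (x l m : R) : 0 <= l -> l <= exp (x / 2) -> m <= l * l -> m <= exp x.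
Proof.
  intros Hl H Hm. replace x with (x / 2 + x / 2) by lra. rewrite exp_plus. nra.
Qed.

Lemma exp_m1 : exp (-1) = / exp 1.
Proof. rewrite <- exp_Ropp. reflexivity. Qed.

(** The value is [3 * 15 / 16], so that [a * exp 1 <= 3] for [a <= 16 / 15]. Halving the argument
    brings it near 0, where [1 + x <= exp x] is accurate; the decimals are successive square roots,
    rounded up. *)
Lemma exp_1_le : exp 1 <= 2.8125.
Proof.
  assert (H : 1 / 2.8125 <= exp (-1)).
  { apply (exp_double_ge _ 0.5966); [lra| |lra].
    apply (exp_double_ge _ 0.7724); [lra| |lra].
    apply (exp_double_ge _ 0.87889); [lra| |lra].
    apply (exp_double_ge _ 0.9375); [lra| |lra].
    eapply Rle_trans; [|apply exp_ineq1_le]. lra. }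
  rewrite exp_m1 in H. assert (P := exp_pos 1).
  apply Rmult_le_compat_r with (r := exp 1) in H; [|lra]. rewrite Rinv_l in H; lra.
Qed.

(** 5 is the larger root of [E ^ 2 - 6 E + 5]; beyond it the inequality of [exp_boundary] holds
    whatever the value of the cosine. *)
Lemma exp_165_ge : 5 <= exp 1.65.
Proof.
  apply (exp_double_ge _ 2.25); [lra| |lra].
  apply (exp_double_ge _ 1.5); [lra| |lra].
  apply (exp_double_ge _ 1.225); [lra| |lra].
  apply (exp_double_ge _ 1.107); [lra| |lra].
  apply (exp_double_ge _ 1.0522); [lra| |lra].
  apply (exp_double_ge _ 1.02578); [lra| |lra].
  eapply Rle_trans; [|apply exp_ineq1_le]. lra.
Qed.

Lemma cos_le_quartic (s : R) : -1 <= s <= 1 -> cos s <= 1 - s ^ 2 / 2 + s ^ 4 / 24.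
Proof.
  intros Hs. destruct (pre_cos_bound s 0) as [_ H]; [lra|lra|].
  eapply Rle_trans; [exact H|]. unfold cos_approx, cos_term. simpl. right. field.
Qed.

(* With [d = c + 1] the inequality reads [E (E - 2 K cos s) + 2 K - 1 >= 0] for
   [E = exp d], [K = a e <= 3] and [s ^ 2 = d (2 - d)]; it is first-order near [d = 0],
   has negative discriminant for [1 / 2 <= d <= 1.65], and factors for larger [d]. *)
Lemma exp_boundary (a c s : R) : 1 <= a <= 16 / 15 -> c ^ 2 + s ^ 2 = 1 ->
  (a - exp (-1)) ^ 2 <= (exp c) ^ 2 - 2 * a * exp c * cos s + a ^ 2.
Proof.
  intros Ha Hcs. set (d := c + 1). set (E := exp d). set (e := exp 1). set (co := cos s).
  assert (He : 2 < e <= 2.8125).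
  { split; [|apply exp_1_le]. assert (A := exp_ineq1 1 ltac:(lra)). unfold e. lra. }
  assert (Ec : exp c = E / e).
  { unfold E, d. rewrite exp_plus. fold e. field. lra. }
  assert (Em : exp (-1) = 1 / e).
  { unfold e. rewrite exp_m1. field. apply Rgt_not_eq, exp_pos. }
  assert (Hd : 0 <= d <= 2) by (unfold d; nra).
  assert (Hs2 : s ^ 2 = d * (2 - d)) by (unfold d; lra).
  assert (Hs : -1 <= s <= 1) by nra.
  assert (Hco := cos_le_quartic s Hs). fold co in Hco.
  replace (s ^ 4) with (s ^ 2 * s ^ 2) in Hco by ring. rewrite Hs2 in Hco.
  assert (Hco1 : co <= 1) by apply COS_bound.
  assert (E1 : 1 + d <= E) by apply exp_ineq1_le.
  assert (Main : 0 <= E * E - 1 - 6 * (E * co - 1)).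
  { destruct (Rle_dec d (1 / 2)) as [D1|D1]; [|destruct (Rle_dec d 1.65) as [D2|D2]].
    - assert (E2 : E * (1 - d) <= 1).
      { assert (A := exp_ineq1_le (- d)). rewrite exp_Ropp in A. fold E in A.
        apply Rmult_le_compat_l with (r := E) in A; [|lra]. rewrite Rinv_r in A; lra. }
      assert (E3 : E <= 2) by nra.
      set (w := d * (2 - d)) in *.
      assert (A1 : (E - 1) * (5 - E) <= E * d * (5 - E)) by (apply Rmult_le_compat_r; lra).
      assert (A2 : d * (5 - E) <= d * (4 - d)) by (apply Rmult_le_compat_l; lra).
      assert (A3 : d * (4 - d) <= 3 * w - w * w / 4).
      { unfold w. assert (0 <= d * (2 - 2 * d - d * ((2 - d) * (2 - d)) / 4)); [|nra].
        apply Rmult_le_pos; [lra|].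
        assert ((2 - d) * (2 - d) <= 4) by nra. nra. }
      assert (A4 : E * (d * (5 - E)) <= E * (6 * (1 - co))).
      { apply Rmult_le_compat_l; [lra|]. lra. }
      nra.
    - assert (W : 0.5775 <= d * (2 - d) <= 1) by nra.
      set (w := d * (2 - d)) in *.
      assert (C1 : co <= 0.74) by nra.
      destruct (Rle_dec co 0) as [C0|C0]; [nra|].
      assert (0 <= (E - 3 * co) ^ 2) by apply pow2_ge_0.
      assert (co * co <= 0.74 * 0.74) by nra. nra.
    - assert (E5 : 5 <= E).
      { eapply Rle_trans; [apply exp_165_ge|]. left. apply exp_increasing. lra. }
      nra. }
  (* The expression is affine in [K = a * e]. If [E * co > 1] it is smallest at [K = 3], which is
     [Main]; otherwise it is at least [E * E - 1]. *)
  assert (Main' : 0 <= E * E - 1 - 2 * (a * e) * (E * co - 1)).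
  { assert (0 < a * e <= 3) by nra. destruct (Rle_dec (E * co - 1) 0); nra. }
  rewrite Ec, Em.
  assert (Q : (E / e) ^ 2 - 2 * a * (E / e) * co + a ^ 2 - (a - 1 / e) ^ 2
              = (E * E - 1 - 2 * (a * e) * (E * co - 1)) / (e * e)) by (field; lra).
  assert (0 <= (E * E - 1 - 2 * (a * e) * (E * co - 1)) / (e * e)).
  { apply Rdiv_le_0_compat; [exact Main'|nra]. }
  lra.
Qed.

Lemma radius_S_e : is_radius S_e class_F2
  ((2 * exp 1 - 2) / (4 * exp 1 + sqrt (20 * exp 1 ^ 2 - 8 * exp 1 + 4))).
Proof.
  assert (He : 2 < exp 1 <= 2.8125).
  { split; [|apply exp_1_le]. assert (A := exp_ineq1 1 ltac:(lra)). lra. }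
  assert (Em : exp (-1) = 1 / exp 1).
  { rewrite exp_m1. field. apply Rgt_not_eq, exp_pos. }
  set (e := exp 1) in *. assert (HPI := PI2_1).
  assert (Ee : exp (-1) * e = 1) by (rewrite Em; field; lra).
  assert (Pm := exp_pos (-1)). set (v := exp (-1)) in *.
  assert (Hv : v < 1 / 2) by nra.
  (* Here [k = 1 - 1 / e], the image of [-1] being [1 / e]; the stated form is multiplied above and
     below by [2 * e]. *)
  replace ((2 * e - 2) / (4 * e + sqrt (20 * e ^ 2 - 8 * e + 4)))
    with ((1 - v) / (2 + sqrt (4 + (1 - v) ^ 2))).
  2:{ replace (20 * e ^ 2 - 8 * e + 4) with (Rsqr (2 * e) * (4 + (1 - v) ^ 2)).
      2:{ rewrite Em. unfold Rsqr. field. lra. }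
      rewrite sqrt_mult_alt by apply Rle_0_sqr. rewrite sqrt_Rsqr by lra.
      assert (P := sqrt_pos (4 + (1 - v) ^ 2)). set (r := sqrt (4 + (1 - v) ^ 2)) in *.
      clearbody r. rewrite Em. field. split; [nra|lra]. }
  apply (sharp_radius _ Clog); [lra| | |].
  - rewrite <- Cexp_0, Clog_Cexp; [reflexivity|]. simpl. rewrite Rabs_R0. lra.
  - intros a q Ha. replace (a - (1 - (1 - v))) with (a - v) by ring.
    assert (Loc : forall q, Cmod (q - RtoC a) < a - v -> Cdiff Clog q /\ Cexp (Clog q) = q).
    { clear q. intros q Hq. apply disk_Re in Hq. split; [apply Cdiff_Clog; lra|].
      apply Cexp_Clog, Re_pos_neq_0. lra. }
    intros Hq. split; [|split]; try apply Loc, Hq.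
    apply (inverse_in_D Cexp Clog (RtoC a) (a - v)); [| | |exact Hq].
    + intros q' Hq'. split; [apply Cdiff_cont|]; apply Loc, Hq'.
    + replace (RtoC a) with (Cexp (RtoC (ln a))).
      2:{ unfold Cexp. simpl. rewrite exp_ln, cos_0, sin_0 by lra.
          apply injective_projections; simpl; ring. }
      rewrite Clog_Cexp by (simpl; rewrite Rabs_R0; lra).
      assert (L0 : 0 <= ln a) by (rewrite <- ln_1; apply ln_le; lra).
      unfold D. rewrite Cmod_RtoC_pos by exact L0.
      rewrite <- (ln_exp 1). apply ln_increasing; [lra|]. fold e. lra.
    + intros [c s] Hw.
      assert (Hw' := Cmod_1_sqr c s Hw).
      assert (B := exp_boundary a c s Ha Hw'). fold v in B.
      apply Rnot_lt_le. intros Hlt. apply disk_sqr in Hlt; [|lra].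
      unfold Cexp in Hlt. simpl in Hlt.
      assert (T := sin2_cos2 s). unfold Rsqr in T.
      assert (T' : exp c * exp c * (sin s * sin s + cos s * cos s) = exp c * exp c * 1)
        by (rewrite T; reflexivity).
      nra.
  - intros x w Hx Hw H. replace (1 - (1 - v)) with v in Hx by ring.
    assert (I1 := f_equal Re H). assert (I2 := f_equal Im H).
    unfold Cexp in I1, I2. simpl in I1, I2. unfold D in Hw.
    assert (R1 := re_le_Cmod w). assert (R2 := im_le_Cmod w).
    apply Rabs_le_between in R1, R2.
    assert (P := exp_pos (Re w)).
    assert (Hs : sin (Im w) = 0) by (apply Rmult_eq_reg_l with (exp (Re w)); lra).
    assert (H0 : Im w = 0).
    { destruct (Rtotal_order (Im w) 0) as [L|[L|L]]; [|exact L|].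
      - assert (S := sin_gt_0 (- Im w) ltac:(lra) ltac:(lra)). rewrite sin_neg in S. lra.
      - assert (S := sin_gt_0 (Im w) ltac:(lra) ltac:(lra)). lra. }
    rewrite H0, cos_0, Rmult_1_r in I1.
    assert (v < exp (Re w)) by (apply exp_increasing; lra). lra.
Qed.

(** * The parabolic region *)

(* [tanh (s / 2)] *)
Definition half_tanh (s : C) : C := ((Cexp s - 1) / (Cexp s + 1))%C.

Lemma half_tanh_opp_sqr (s : C) :
  (half_tanh (- s) * half_tanh (- s) = half_tanh s * half_tanh s)%C.
Proof.
  unfold half_tanh. rewrite Cexp_opp. assert (N := Cexp_neq_0 s).
  (* At a pole [Cexp s = -1] is its own inverse, so both sides are the same expression whatever
     division by 0 returns. *)
  destruct (Ceq_dec (Cexp s + 1) 0) as [H|H].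
  - assert (E : Cexp s = (- (1))%C) by (transitivity (Cexp s + 1 - 1)%C; [ring|rewrite H; ring]).
    rewrite E. replace (/ - (1))%C with (- (1))%C; [reflexivity|].
    apply injective_projections; simpl; field.
  - field. split; assumption.
Qed.

Lemma Cexp_Re_pos (s : C) : Rabs (Im s) < PI / 2 -> 0 < Re (Cexp s).
Proof.
  intros H. apply Rabs_lt_between in H. unfold Cexp. simpl.
  apply Rmult_lt_0_compat; [apply exp_pos|apply cos_gt_0; lra].
Qed.

Lemma Re_pos_p1 (z : C) : 0 < Re z -> (z + 1)%C <> 0.
Proof. intros H. apply Re_pos_neq_0. rewrite re_plus. simpl. lra. Qed.

Lemma D_cayley (z : C) : 0 < Re z -> D ((z - 1) / (z + 1))%C.
Proof.
  intros H. apply D_div, Cmod_lt_Cmod. rewrite !Cmod2_alt.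
  destruct z as [x y]. simpl in *. nra.
Qed.

Lemma Cdiff_half_tanh (s : C) : (Cexp s + 1)%C <> 0 -> Cdiff half_tanh s.
Proof.
  intros H. apply Cdiff_div; [| |exact H];
    [apply Cdiff_minus|apply Cdiff_plus]; try apply Cdiff_Cexp; apply Cdiff_const.
Qed.

Lemma Csqr_eq (a b : C) : (a * a = b * b)%C -> a = b \/ a = (- b)%C.
Proof.
  intros H. destruct (Ceq_dec (a - b) 0) as [E|E].
  - left. transitivity (a - b + b)%C; [ring|rewrite E; ring].
  - right. assert (E' : (a + b = 0)%C).
    { transitivity ((a * a - b * b) / (a - b))%C; [field; exact E|rewrite H; field; exact E]. }
    transitivity (a + b - b)%C; [ring|rewrite E'; ring].
Qed.

(** Solving [phi_PAR w = 1 + u] gives the logarithm as [PI / sqrt 2] times a square root of [u]; a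
    square root of [w] is then the hyperbolic tangent of half of it. *)
Definition par_scale : R := PI / sqrt 2.

(* The square of an odd function of [Csqrt u], hence analytic across the branch cut and
   at the branch point. *)
Definition par_inverse (u : C) : C :=
  (half_tanh (RtoC par_scale * Csqrt u) * half_tanh (RtoC par_scale * Csqrt u))%C.

Lemma par_inverse_branch (u s : C) : (s * s)%C = u ->
  par_inverse u = (half_tanh (RtoC par_scale * s) * half_tanh (RtoC par_scale * s))%C.
Proof.
  intros H. unfold par_inverse. destruct (Csqr_eq (Csqrt u) s) as [->| ->].
  - rewrite Csqrt_sqr, H. reflexivity.
  - reflexivity.
  - replace (RtoC par_scale * - s)%C with (- (RtoC par_scale * s))%C by ring.
    apply half_tanh_opp_sqr.
Qed.

Lemma Csqrt_continuous_0 : Ccont Csqrt 0.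
Proof.
  intros eps He. exists (eps * eps). split; [nra|]. intros y Hy.
  rewrite Csqrt_0. replace (Csqrt y - 0)%C with (Csqrt y) by ring.
  replace (y - 0)%C with (Csqrt y * Csqrt y)%C in Hy by (rewrite Csqrt_sqr; ring).
  rewrite Cmod_mult in Hy. assert (P := Cmod_ge_0 (Csqrt y)). nra.
Qed.

(** The parabolic region [|u| < 1 + Re u] is the image under squaring of the strip
    [2 (Im s) ^ 2 < 1], which the scale maps to the strip where [Cexp] has positive real part. *)
Lemma par_scale_strip (s : C) :
  Cmod (s * s) < 1 + Re (s * s)%C -> Rabs (Im (RtoC par_scale * s)%C) < PI / 2.
Proof.
  intros H. rewrite Cmod_mult in H. assert (E := Cmod2_alt s).
  replace (Cmod s * Cmod s) with (Cmod s ^ 2) in H by ring. rewrite E, re_mult in H.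
  assert (HPI := PI_RGT_0). assert (E2 := sqrt2_sqr). assert (B2 := sqrt2_bounds).
  rewrite im_scal_l. unfold par_scale.
  assert (A : 2 * Im s ^ 2 < 1) by nra.
  assert (B : Rabs (sqrt 2 * Im s) < 1) by (apply Rabs_def1; nra).
  replace (PI / sqrt 2 * Im s) with (PI / 2 * (sqrt 2 * Im s)).
  2:{ apply Rmult_eq_reg_r with (sqrt 2); [|lra]. field_simplify; [|lra].
      replace (sqrt 2 ^ 2) with 2 by (simpl; lra). field. }
  rewrite Rabs_mult, Rabs_pos_eq by lra. nra.
Qed.

(** At 0, write [tanh] as [p s * s] with its slope function [p]; then [p (Csqrt y) ^ 2] is a slope
    function for [par_inverse]. Elsewhere the local root [r * Csqrt (y / u)], differentiable at [u]
    even on the negative axis, may replace [Csqrt y]. *)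
Lemma Cdiff_par_inverse (u : C) : Cmod u < 1 + Re u -> Cdiff par_inverse u.
Proof.
  intros Hu. set (k := RtoC par_scale).
  destruct (Ceq_dec u 0) as [->|Nu].
  - assert (Dh : Cdiff (fun s => half_tanh (k * s)%C) 0).
    { apply (Cdiff_comp half_tanh (fun s => k * s)%C).
      - apply Cdiff_half_tanh. replace (k * 0)%C with (RtoC 0) by ring. rewrite Cexp_0.
        apply RtoC_plus_neq_0. lra.
      - apply Cdiff_mult; [apply Cdiff_const|apply Cdiff_id]. }
    destruct Dh as [l Hl]. apply Cderiv_caratheodory in Hl. destruct Hl as [p [P1 [P2 P3]]].
    exists (p 0 * p 0)%C. apply Cderiv_caratheodory.
    exists (fun y => p (Csqrt y) * p (Csqrt y))%C. split; [|split].
    + assert (Q : Ccont (fun y => p (Csqrt y)) 0).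
      { apply (Ccont_comp p Csqrt); [apply Csqrt_continuous_0|]. rewrite Csqrt_0. exact P1. }
      apply Ccont_mult; exact Q.
    + rewrite Csqrt_0. reflexivity.
    + assert (H0 : half_tanh (k * 0)%C = 0).
      { unfold half_tanh. replace (k * 0)%C with (RtoC 0) by ring. rewrite Cexp_0. field. }
      rewrite H0 in P3.
      assert (P4 : forall s, half_tanh (k * s)%C = (p s * s)%C).
      { intros s. transitivity (half_tanh (k * s) - 0)%C; [ring|rewrite P3; ring]. }
      intros y. unfold par_inverse. fold k. rewrite !P4, Csqrt_0.
      transitivity (p (Csqrt y) * p (Csqrt y) * (Csqrt y * Csqrt y))%C; [ring|].
      rewrite Csqrt_sqr. ring.
  - set (r := Csqrt u). assert (Er : (r * r)%C = u) by apply Csqrt_sqr.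
    apply (Cdiff_ext_loc (fun y => half_tanh (k * (r * Csqrt (y / u))) * half_tanh (k * (r * Csqrt (y / u))))%C
             par_inverse u 1 Rlt_0_1).
    + intros y _. symmetry. apply par_inverse_branch.
      transitivity ((r * r) * (Csqrt (y / u) * Csqrt (y / u)))%C; [ring|].
      rewrite Er, Csqrt_sqr. field. exact Nu.
    + assert (E1 : (u / u)%C = (1 * 1)%C) by (field; exact Nu).
      assert (Q : Cdiff (fun y => half_tanh (k * (r * Csqrt (y / u))))%C u).
      { apply (Cdiff_comp half_tanh (fun y => k * (r * Csqrt (y / u)))%C).
        - apply Cdiff_half_tanh. rewrite E1, Csqrt_of_sqr by (simpl; lra).
          apply Re_pos_p1, Cexp_Re_pos. replace (r * 1)%C with r by ring.
          apply par_scale_strip. rewrite Er. exact Hu.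
        - apply Cdiff_mult; [apply Cdiff_const|]. apply Cdiff_mult; [apply Cdiff_const|].
          apply (Cdiff_comp Csqrt (fun y => y / u)%C).
          + apply Cdiff_Csqrt. rewrite E1. simpl. lra.
          + apply Cdiff_div; [apply Cdiff_id|apply Cdiff_const|exact Nu]. }
      apply Cdiff_mult; exact Q.
Qed.

(** The principal root of [half_tanh S ^ 2] is [half_tanh S] up to sign, so the quotient in
    [phi_PAR] is [Cexp S] or [Cexp (- S)]. In the strip the logarithm returns [S] or [- S], and
    squaring removes the sign. *)
Lemma phi_PAR_par_inverse (u : C) :
  Cmod u < 1 + Re u -> D (par_inverse u) /\ phi_PAR (par_inverse u) = (1 + u)%C.
Proof.
  intros Hu. assert (Es := Csqrt_sqr u). set (s := Csqrt u) in *.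
  assert (Hb : Rabs (Im (RtoC par_scale * s)%C) < PI / 2) by (apply par_scale_strip; rewrite Es; exact Hu).
  unfold par_inverse. fold s. set (S := (RtoC par_scale * s)%C) in *.
  assert (HPI := PI_RGT_0).
  assert (HE := Cexp_Re_pos S Hb).
  assert (N := Re_pos_p1 _ HE). assert (NE := Cexp_neq_0 S).
  assert (HD : D (half_tanh S)) by (apply D_cayley, HE).
  split.
  { unfold D in *. rewrite Cmod_mult. assert (P := Cmod_ge_0 (half_tanh S)). nra. }
  assert (L : exists S', (S' = S \/ S' = (- S)%C) /\
            ((1 + Csqrt (half_tanh S * half_tanh S)) / (1 - Csqrt (half_tanh S * half_tanh S)))%C = Cexp S').
  { destruct (Csqr_eq (Csqrt (half_tanh S * half_tanh S)) (half_tanh S) (Csqrt_sqr _)) as [->| ->].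
    - exists S. split; [left; reflexivity|]. assert (N' := D_1m _ HD).
      unfold half_tanh in *. field. repeat split; try exact N.
      replace (Cexp S + 1 - (Cexp S - 1))%C with (RtoC 1 + 1)%C by ring.
      apply RtoC_plus_neq_0. lra.
    - exists (- S)%C. split; [right; reflexivity|]. rewrite Cexp_opp.
      unfold half_tanh in *. field. repeat split; try exact N; try exact NE.
      replace (Cexp S + 1 - - (Cexp S - 1))%C with ((1 + 1) * Cexp S)%C by ring.
      apply Cmult_neq_0; [|exact NE]. apply RtoC_plus_neq_0. lra. }
  destruct L as [S' [HS' L]]. unfold phi_PAR. rewrite L, Clog_Cexp.
  2:{ destruct HS' as [->| ->]; [|rewrite im_opp, Rabs_Ropp]; lra. }
  assert (E : (S' ^ 2 = RtoC (par_scale * par_scale) * u)%C).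
  { rewrite RtoC_mult, <- Es. destruct HS' as [->| ->]; unfold S; simpl; ring. }
  rewrite E. f_equal. rewrite Cmult_assoc, <- RtoC_mult.
  replace (2 / PI ^ 2 * (par_scale * par_scale)) with 1; [ring|].
  unfold par_scale. assert (E2 := sqrt2_sqr). assert (B2 := sqrt2_bounds).
  field_simplify; [|split; lra]. replace (sqrt 2 ^ 2) with 2 by (simpl; lra). field.
Qed.

Lemma radius_S_p : is_radius S_p class_F2 (sqrt 17 - 4).
Proof.
  assert (S17 : sqrt 17 * sqrt 17 = 17) by (apply sqrt_sqrt; lra).
  assert (P17 := sqrt_pos 17).
  (* [k = 1 / 2], because the vertex of the parabola is [1 / 2]. *)
  replace (sqrt 17 - 4) with (1 / 2 / (2 + sqrt (4 + (1 / 2) ^ 2))).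
  2:{ replace (4 + (1 / 2) ^ 2) with (Rsqr (1 / 2 * sqrt 17)) by (unfold Rsqr; nra).
      rewrite sqrt_Rsqr by lra. apply Rmult_eq_reg_r with (2 + 1 / 2 * sqrt 17); [|lra].
      unfold Rdiv at 1. rewrite Rmult_assoc, Rinv_l by lra. nra. }
  assert (HPI := PI_RGT_0).
  apply (sharp_radius _ (fun q => par_inverse (q - 1))%C); [lra| | |].
  - replace (1 - 1)%C with (RtoC 0) by ring.
    rewrite (par_inverse_branch 0 0) by ring.
    unfold half_tanh. replace (RtoC par_scale * 0)%C with (RtoC 0) by ring. rewrite Cexp_0. field.
  - intros a q Ha Hq. assert (Hx := disk_Re _ _ _ Hq).
    assert (Hu : Cmod (q - 1) < 1 + Re (q - 1)%C).
    (* With [X = Re q - 1 / 2] and [y = Im q], the disk is [y ^ 2 < 2 (a - 1 / 2) X - X ^ 2] and the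
       parabolic region is [y ^ 2 < 2 X]. *)
    { apply disk_sqr in Hq; [|lra].
      assert (Re (q - 1)%C = Re q - 1) by (destruct q; simpl; ring).
      rewrite H. apply disk_sqr; [lra|]. nra. }
    destruct (phi_PAR_par_inverse _ Hu) as [A B]. split; [|split].
    + apply (Cdiff_comp par_inverse (fun q => q - 1)%C); [apply Cdiff_par_inverse, Hu|].
      apply Cdiff_minus; [apply Cdiff_id|apply Cdiff_const].
    + exact A.
    + rewrite B. ring.
  - intros x w Hx Hw H. unfold phi_PAR in H.
    assert (Es := Csqrt_sqr w). set (s := Csqrt w) in *.
    assert (Hs : D s).
    { unfold D in *. rewrite <- Es, Cmod_mult in Hw. assert (P := Cmod_ge_0 s). nra. }
    assert (HM := cayley_Re_pos s Hs). set (M := ((1 + s) / (1 - s))%C) in *.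
    assert (HY := Carg_Re_pos M HM). apply Rabs_lt_between in HY.
    unfold Clog in H. set (X := ln (Cmod M)) in *. set (Y := Carg M) in *.
    assert (I1 := f_equal Re H). assert (I2 := f_equal Im H).
    rewrite re_plus, re_scal_l in I1. rewrite im_plus, im_scal_l in I2.
    simpl in I1, I2. set (j := 2 / (PI * (PI * 1))) in *.
    assert (Hj : j * (PI * PI) = 2) by (unfold j; field; lra).
    assert (Pj : 0 < j) by (unfold j; apply Rdiv_lt_0_compat; nra).
    (* A real value forces [(X + i Y) ^ 2] to be real. If [X = 0] the value is
       [1 - j * Y ^ 2 > 1 / 2], since [|Y| < PI / 2]; if [Y = 0] it is at least 1. *)
    assert (E : X * Y = 0) by (apply Rmult_eq_reg_l with j; nra).
    assert (Y * Y < PI * PI / 4) by nra.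
    apply Rmult_integral in E. destruct E as [E|E]; rewrite E in *; nra.
Qed.

(** * Lower bounds: the lemniscate and the sector *)

Lemma disk_center_ge_1 (c : R) : 0 < c < 1 -> 1 < disk_center c.
Proof.
  intros Hc. unfold disk_center. apply Rmult_lt_reg_r with (1 - c ^ 2); [nra|].
  unfold Rdiv. rewrite Rmult_assoc, Rinv_l by nra. nra.
Qed.

(** The rationalised root, meaningful for [A = 0] too; the sector uses it with [A = 1] and the sine
    with [A = 2 + sin 1]. *)
Lemma quadratic_root (A S : R) : 0 < S -> 0 <= A ->
  let c := S / (2 + sqrt (4 + S * A)) in 0 < c /\ A * c ^ 2 + 4 * c = S.
Proof.
  intros HS HA c. set (s := sqrt (4 + S * A)) in *.
  assert (Hs : s * s = 4 + S * A) by (apply sqrt_sqrt; nra).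
  assert (Hs0 : 0 <= s) by apply sqrt_pos.
  assert (E : c * (2 + s) = S) by (unfold c; field; lra).
  split; [unfold c; apply Rdiv_lt_0_compat; lra|].
  assert (HAc : A * c = s - 2).
  { apply Rmult_eq_reg_r with (2 + s); [|lra].
    replace (A * c * (2 + s)) with (A * (c * (2 + s))) by ring. rewrite E. nra. }
  nra.
Qed.

(** The image is the right half of the lemniscate [|q ^ 2 - 1| < 1], and [c] puts the right end of
    the disk at its vertex [sqrt 2]; cleared of denominators this is [Qc]. *)
Lemma radius_S_L : radius_ge S_L class_F2 ((sqrt 5 - 2) / (1 + sqrt 2)).
Proof.
  assert (E2 := sqrt2_sqr). assert (B2 := sqrt2_bounds). set (t := sqrt 2) in *.
  assert (E5 : sqrt 5 * sqrt 5 = 5) by (apply sqrt_sqrt; lra).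
  assert (P5 := sqrt_pos 5). assert (B5 : 2 < sqrt 5 < 2.3) by (split; nra).
  set (c := (sqrt 5 - 2) / (1 + t)).
  assert (Ec : c * (1 + t) = sqrt 5 - 2) by (unfold c; field; lra).
  assert (Hc : 0 < c < 1).
  { split; [unfold c; apply Rdiv_lt_0_compat; lra|nra]. }
  assert (Qc : (1 + t) * c ^ 2 + 4 * c = t - 1).
  { apply Rmult_eq_reg_r with (1 + t); [|lra].
    replace (((1 + t) * c ^ 2 + 4 * c) * (1 + t)) with ((c * (1 + t)) ^ 2 + 4 * (c * (1 + t))) by ring.
    rewrite Ec. nra. }
  assert (HT : 0 < 1 - c ^ 2) by nra.
  assert (Hr : disk_radius c = t - disk_center c).
  { unfold disk_radius, disk_center. apply Rmult_eq_reg_r with (1 - c ^ 2); [|lra].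
    field_simplify; [|lra|lra]. nra. }
  assert (Ha := disk_center_ge_1 c Hc).
  apply (radius_ge_of_left_inverse _ (fun q => q * q - 1)%C).
  - intros w _. rewrite Csqrt_sqr. ring.
  - ring.
  - apply (radius_ok_of_inverse _ (fun q => q * q - 1)%C); [exact Hc|ring|].
    intros q Hq. unfold inclusion_disk in Hq. rewrite Hr in Hq.
    set (a := disk_center c) in *.
    assert (Hx : 0 < Re q < t).
    { assert (A := re_le_Cmod (q - RtoC a)).
      change (Rabs (Re q - a) <= Cmod (q - RtoC a)) in A. apply Rabs_le_between in A. lra. }
    assert (Pr := Cmod_lt_pos _ _ Hq).
    apply disk_sqr in Hq; [|exact Pr].
    split; [|split].
    + apply Cdiff_minus; [apply Cdiff_mult; apply Cdiff_id|apply Cdiff_const].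
    + apply D_sqr. destruct q as [x y]. simpl in *. set (N := x ^ 2 + y ^ 2).
      (* As the centre exceeds 1, the disk lies in the one of centre 1 with the same right end,
         [|q - 1| < sqrt 2 - 1], which is [H1]; [H2] is [|q ^ 2 - 1| < 1] rewritten. *)
      assert (H1 : N < 2 - 2 * (t - x)) by (unfold N; nra).
      assert (H0 : 0 <= N) by (unfold N; nra).
      assert (H2 : N ^ 2 + 2 * N < 4 * x ^ 2) by nra.
      unfold N in H2. nra.
    + replace (1 + (q * q - 1))%C with (q * q)%C by ring. apply Csqrt_of_sqr. lra.
  - lra.
Qed.

(** The image is the sector [|arg q| < b]. A disk of centre [a] and radius [a * sin b] touches its
    sides from inside, and [c ^ 2 + 4 c = sin b] expresses this value of the radius. *)
Lemma radius_S_gamma (gamma : R) : 0 < gamma <= 1 ->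
  radius_ge (S_gamma gamma) class_F2
    (sin (PI * gamma / 2) / (2 + sqrt (4 + sin (PI * gamma / 2)))).
Proof.
  intros Hg. assert (HPI := PI_RGT_0). set (b := PI * gamma / 2).
  assert (Hb : 0 < b <= PI / 2) by (unfold b; split; nra).
  assert (HS : 0 < sin b) by (apply sin_gt_0; lra).
  assert (HS1 : sin b <= 1) by apply SIN_bound.
  assert (Hcb : 0 <= cos b) by (apply cos_ge_0; lra).
  assert (HSC := sin2_cos2 b). unfold Rsqr in HSC.
  set (S := sin b) in *.
  replace (4 + S) with (4 + S * 1) by ring.
  destruct (quadratic_root 1 S HS Rle_0_1) as [Hc0 Qc].
  set (c := S / (2 + sqrt (4 + S * 1))) in *.
  assert (Hc : 0 < c < 1) by nra.
  assert (HT : 0 < 1 - c ^ 2) by nra.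
  assert (Hr : disk_radius c = disk_center c * S).
  { unfold disk_radius, disk_center. rewrite <- Qc. field. lra. }
  assert (Ha := disk_center_ge_1 c Hc).
  set (W := fun q => ((Cpower q (1 / gamma) - 1) / (Cpower q (1 / gamma) + 1))%C).
  assert (EW : forall P, (P + 1)%C <> 0 ->
             ((1 + (P - 1) / (P + 1)) / (1 - (P - 1) / (P + 1)))%C = P).
  { intros P N. field. split; [exact N|].
    replace (P + 1 - (P - 1))%C with (RtoC 1 + 1)%C by ring.
    apply RtoC_plus_neq_0. lra. }
  assert (HW1 : W 1 = 0).
  { unfold W. rewrite <- Cexp_0, Cpower_Cexp by (simpl; rewrite Rabs_R0; lra).
    replace (RtoC (1 / gamma) * 0)%C with (RtoC 0) by ring. rewrite Cexp_0. field. }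
  assert (Im_scal_log : forall r z, Im (RtoC r * Clog z)%C = r * Carg z)
    by (intros; rewrite im_scal_l; reflexivity).
  apply (radius_ge_of_left_inverse _ W).
  - intros w Hw. assert (HM := cayley_Re_pos w Hw). set (M := ((1 + w) / (1 - w))%C) in *.
    assert (NM := Re_pos_neq_0 M HM). assert (HA := Carg_Re_pos M HM).
    assert (EM : Cpower (Cpower M gamma) (1 / gamma) = M).
    { rewrite (Cpower_neq_0 M) by exact NM. rewrite Cpower_Cexp.
      - rewrite <- (Cexp_Clog M NM) at 2. f_equal. rewrite Cmult_assoc, <- RtoC_mult.
        replace (1 / gamma * gamma) with 1 by (field; lra). ring.
      - rewrite Im_scal_log, Rabs_mult, Rabs_pos_eq by lra. nra. }
    unfold W. rewrite EM. unfold M. assert (N := D_1m w Hw). field. split; [exact N|].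
    replace (1 + w + (1 - w))%C with (RtoC 1 + 1)%C by ring.
    apply RtoC_plus_neq_0. lra.
  - exact HW1.
  - apply (radius_ok_of_inverse _ W); [exact Hc|exact HW1|].
    intros q Hq. unfold inclusion_disk in Hq. rewrite Hr in Hq.
    set (a := disk_center c) in *.
    assert (Hx : 0 < Re q) by (apply (disk_Re q a 0); nra).
    apply disk_sqr in Hq; [|nra].
    assert (Nq := Re_pos_neq_0 q Hx). assert (Pq := proj1 (Cmod_gt_0 q) Nq).
    assert (Mq := Cmod2_alt q).
    assert (HA : Rabs (Carg q) < b).
    { destruct (Carg_cos_sin q Nq) as [A _]. assert (Bd := Carg_bound q).
      assert (Hcos : Cmod q * cos b < Re q).
      (* The disk gives [|q| ^ 2 + (a cos b) ^ 2 < 2 a Re q], whose left side is at least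
         [2 a |q| cos b]. *)
      { assert (0 <= (Cmod q - a * cos b) ^ 2) by apply pow2_ge_0.
        assert (Cmod q ^ 2 + a ^ 2 * (cos b * cos b) < 2 * a * Re q) by nra.
        assert (2 * a * (Cmod q * cos b) < 2 * a * Re q) by nra.
        apply Rmult_lt_reg_l with (2 * a); lra. }
      apply Rnot_le_lt. intros Hle.
      assert (Bd' : Rabs (Carg q) <= PI) by (apply Rabs_le; lra).
      assert (Cd : cos (Rabs (Carg q)) <= cos b) by (apply cos_decr_1; lra).
      assert (Ce : cos (Rabs (Carg q)) = cos (Carg q)).
      { unfold Rabs. destruct (Rcase_abs (Carg q)); [apply cos_neg|reflexivity]. }
      rewrite Ce in Cd. nra. }
    assert (HI : Rabs (Im (RtoC (1 / gamma) * Clog q)%C) < PI / 2).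
    { rewrite Im_scal_log, Rabs_mult, Rabs_pos_eq.
      - apply Rmult_lt_reg_l with gamma; [lra|].
        replace (gamma * (1 / gamma * Rabs (Carg q))) with (Rabs (Carg q)) by (field; lra).
        unfold b in HA. lra.
      - apply Rdiv_le_0_compat; lra. }
    assert (EP := Cpower_neq_0 q (1 / gamma) Nq).
    assert (HP := Cexp_Re_pos _ HI). rewrite <- EP in HP.
    split; [|split].
    + apply Cdiff_div; [apply Cdiff_minus|apply Cdiff_plus|apply Re_pos_p1, HP];
        try apply Cdiff_const; apply Cdiff_Cpower, Hx.
    + apply D_cayley, HP.
    + unfold W. rewrite EW by (apply Re_pos_p1, HP).
      rewrite EP, Cpower_Cexp by lra.
      rewrite <- (Cexp_Clog q Nq) at 2. f_equal. rewrite Cmult_assoc, <- RtoC_mult.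
      replace (gamma * (1 / gamma)) with 1 by (field; lra). ring.
  - exact Hc0.
Qed.

(** * The sine *)

Lemma sinh_ge_id (y : R) : 0 <= y -> 2 * y <= exp y - exp (- y).
Proof.
  intros Hy. destruct (Req_dec y 0) as [->|n]; [rewrite Ropp_0; lra|].
  destruct (MVT_cor2 (fun y => exp y - exp (- y)) (fun y => exp y + exp (- y)) 0 y)
    as [x [Hx1 Hx2]]; [lra| |].
  - intros x _. apply is_derive_Reals. auto_derive; [exact I|]. ring.
  - rewrite Ropp_0 in Hx1.
    assert (P := exp_pos x). assert (E : exp x * exp (- x) = 1) by (rewrite <- exp_plus, Rplus_opp_r; apply exp_0).
    assert (0 <= (exp x - 1) ^ 2) by apply pow2_ge_0.
    assert (2 <= exp x + exp (- x)).
    { apply Rmult_le_reg_l with (exp x); [exact P|]. nra. }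
    nra.
Qed.

Lemma Cmod_Csin (x y : R) :
  Cmod (Csin (x, y)) ^ 2 = sin x ^ 2 + ((exp y - exp (- y)) / 2) ^ 2.
Proof.
  unfold Csin. rewrite Cmod_div.
  2:{ apply Cmult_neq_0; [apply RtoC_neq_0; lra|apply Ci_nz]. }
  rewrite Cmod_mult, Cmod_Ci, Cmod_RtoC_pos, Rmult_1_r by lra.
  unfold Rdiv at 1. rewrite Rpow_mult_distr, Cmod2_alt.
  replace (Ci * (x, y))%C with ((- y, x) : C) by (apply injective_projections; simpl; ring).
  unfold Cexp. simpl. rewrite Ropp_involutive, cos_neg, sin_neg.
  assert (E : exp y * exp (- y) = 1) by (rewrite <- exp_plus, Rplus_opp_r; apply exp_0).
  assert (T := sin2_cos2 x). unfold Rsqr in T.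
  assert (T' : cos x * cos x = 1 - sin x * sin x) by lra.
  transitivity (/ 4 * ((exp y - exp (- y)) * (exp y - exp (- y)) * (cos x * cos x)
     + ((exp y - exp (- y)) * (exp y - exp (- y)) + 4 * (exp y * exp (- y))) * (sin x * sin x)));
    [field|].
  rewrite E, T'. field.
Qed.

(** [|sin w| ^ 2 = sin x ^ 2 + sinh y ^ 2 >= sin x ^ 2 + y ^ 2], while [sin 1 ^ 2 - sin x ^ 2 = sin
    (1 - x) sin (1 + x) <= (1 - x) (1 + x) = y ^ 2]. *)
Lemma Csin_boundary (w : C) : Cmod w = 1 -> sin 1 <= Cmod (Csin w).
Proof.
  intros Hw. destruct w as [x y].
  assert (Hw' := Cmod_1_sqr x y Hw).
  assert (HPI := PI2_1).
  assert (Hx : -1 <= x <= 1) by nra.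
  assert (Hs1 : 0 < sin 1) by (apply sin_gt_0; lra).
  assert (P := Cmod_ge_0 (Csin (x, y))).
  assert (M := Cmod_Csin x y).
  assert (Hy : y ^ 2 <= ((exp y - exp (- y)) / 2) ^ 2).
  { destruct (Rle_dec 0 y) as [H|H].
    - assert (A := sinh_ge_id y H). nra.
    - assert (A := sinh_ge_id (- y) ltac:(lra)). rewrite Ropp_involutive in A. nra. }
  assert (Id : sin 1 ^ 2 - sin x ^ 2 = sin (1 - x) * sin (1 + x)).
  { rewrite sin_minus, sin_plus. assert (T := sin2_cos2 x). assert (T1 := sin2_cos2 1).
    unfold Rsqr in T, T1.
    transitivity (sin 1 * sin 1 * (cos x * cos x) - cos 1 * cos 1 * (sin x * sin x)); [|ring].
    replace (cos x * cos x) with (1 - sin x * sin x) by lra.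
    replace (cos 1 * cos 1) with (1 - sin 1 * sin 1) by lra. ring. }
  assert (Le : forall u, 0 <= u <= 2 -> 0 <= sin u <= u).
  { intros u Hu. split; [apply sin_ge_0; lra|].
    destruct (Req_dec u 0) as [->|n]; [rewrite sin_0; lra|]. left. apply sin_lt_x. lra. }
  assert (L1 := Le (1 - x) ltac:(lra)). assert (L2 := Le (1 + x) ltac:(lra)).
  assert (sin (1 - x) * sin (1 + x) <= (1 - x) * (1 + x)) by (apply Rmult_le_compat; lra).
  nra.
Qed.

Definition arcsin (z : C) : C := (- (Ci * Clog (Ci * z + Csqrt (1 - z * z))))%C.

Lemma Ci_sqr : (Ci * Ci = - (1))%C.
Proof. apply injective_projections; simpl; ring. Qed.

(** [|Re w| < 1 < PI / 2] makes the real part of the cosine positive, so the principal root of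
    [1 - sin ^ 2] is the cosine itself. *)
Lemma arcsin_Csin (w : C) : D w -> arcsin (Csin w) = w.
Proof.
  intros Hw. unfold D in Hw. assert (HPI := PI2_1).
  assert (R1 := re_le_Cmod w). assert (R2 := Rle_lt_trans _ _ _ R1 Hw).
  unfold arcsin, Csin. rewrite Cexp_opp.
  assert (NE := Cexp_neq_0 (Ci * w)). set (E := Cexp (Ci * w)) in *.
  assert (N2 : RtoC 2 <> 0) by (apply RtoC_neq_0; lra). assert (Ni := Ci_nz).
  assert (ImI : Im (Ci * w)%C = Re w) by (destruct w; simpl; ring).
  set (co := ((E + / E) / 2)%C).
  assert (Hco : 0 < Re co).
  { unfold co, E. rewrite <- Cexp_opp. destruct w as [x y]. unfold Cexp. simpl in *.
    apply Rabs_lt_between in R2.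
    assert (Px := exp_pos (0 * x - 1 * y)). assert (Py := exp_pos (- (0 * x - 1 * y))).
    assert (Pc : 0 < cos (0 * y + 1 * x)) by (apply cos_gt_0; lra).
    rewrite cos_neg. field_simplify. apply Rdiv_lt_0_compat; [|lra]. nra. }
  replace (1 - (E - / E) / (2 * Ci) * ((E - / E) / (2 * Ci)))%C with (co * co)%C.
  2:{ unfold co.
      transitivity (1 - (E - / E) * (E - / E) / (4 * (Ci * Ci)))%C.
      - rewrite Ci_sqr. field. exact NE.
      - field. repeat split; assumption. }
  rewrite Csqrt_of_sqr by exact Hco.
  replace (Ci * ((E - / E) / (2 * Ci)) + co)%C with E by (unfold co; field; repeat split; assumption).
  unfold E. rewrite Clog_Cexp by (rewrite ImI; lra).
  transitivity (- (Ci * Ci) * w)%C; [ring|]. rewrite Ci_sqr. ring.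
Qed.

Section Arcsin.
Variable z : C.
Hypothesis Hz : Cmod z < 1.
Let r := Csqrt (1 - z * z).
Let M := (Ci * z + r)%C.

Lemma arcsin_radicand : 0 < Re (1 - z * z)%C.
Proof using Hz.
  apply (D_sqr z) in Hz. destruct z as [x y]. simpl in *. nra.
Qed.

Lemma arcsin_inv : (M * (r - Ci * z) = 1)%C.
Proof using.
  unfold M. transitivity (r * r - Ci * Ci * (z * z))%C; [ring|].
  unfold r. rewrite Csqrt_sqr, Ci_sqr. ring.
Qed.

(** [M] and [/ M = r - Ci * z] have real parts of the same sign, and these add up to
    [2 * Re r > 0]. *)
Lemma arcsin_Re_pos : 0 < Re M.
Proof using Hz.
  assert (Hr : 0 < Re r) by (apply Csqrt_Re_pos, arcsin_radicand).
  assert (NM : M <> 0).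
  { intros H. assert (E := arcsin_inv). rewrite H in E. apply C1_nz.
    rewrite <- E. ring. }
  assert (P := proj1 (Cmod_gt_0 M) NM).
  assert (E1 : (Cconj M * RtoC (/ Cmod M ^ 2))%C = (r - Ci * z)%C).
  { rewrite <- Cinv_Cconj by exact NM.
    transitivity (M * (r - Ci * z) / M)%C; [rewrite arcsin_inv; field; exact NM|field; exact NM]. }
  apply (f_equal Re) in E1. rewrite re_scal_r, re_conj in E1.
  assert (E2 : Re M + Re (r - Ci * z)%C = 2 * Re r)
    by (unfold M; destruct r as [r1 r2], (Ci * z)%C as [m1 m2]; simpl; ring).
  assert (0 < / Cmod M ^ 2) by (apply Rinv_0_lt_compat, pow_lt, P).
  rewrite <- E1 in E2. nra.
Qed.

Lemma Csin_arcsin : Csin (arcsin z) = z.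
Proof using Hz.
  assert (NM := Re_pos_neq_0 M arcsin_Re_pos).
  unfold Csin. rewrite Cexp_opp. unfold arcsin. fold r. fold M.
  replace (Ci * - (Ci * Clog M))%C with (Clog M)
    by (transitivity (- (Ci * Ci) * Clog M)%C; [rewrite Ci_sqr|]; ring).
  rewrite Cexp_Clog by exact NM.
  assert (EI : (/ M = r - Ci * z)%C).
  { transitivity (M * (r - Ci * z) / M)%C; [rewrite arcsin_inv; field; exact NM|field; exact NM]. }
  rewrite EI. unfold M. field. apply Ci_nz.
Qed.

Lemma Cdiff_arcsin : Cdiff arcsin z.
Proof using Hz.
  apply (Cdiff_opp (fun z => Ci * Clog (Ci * z + Csqrt (1 - z * z)))%C).
  apply Cdiff_mult; [apply Cdiff_const|].
  apply (Cdiff_comp Clog (fun z => Ci * z + Csqrt (1 - z * z))%C); [apply Cdiff_Clog, arcsin_Re_pos|].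
  apply Cdiff_plus; [apply Cdiff_mult; [apply Cdiff_const|apply Cdiff_id]|].
  apply (Cdiff_comp Csqrt (fun z => 1 - z * z)%C); [apply Cdiff_Csqrt, arcsin_radicand|].
  apply Cdiff_minus; [apply Cdiff_const|apply Cdiff_mult; apply Cdiff_id].
Qed.

End Arcsin.

Lemma arcsin_0 : arcsin 0 = 0.
Proof.
  unfold arcsin. replace (1 - 0 * 0)%C with (1 * 1)%C by ring.
  rewrite Csqrt_of_sqr by (simpl; lra). replace (Ci * 0 + 1)%C with (RtoC 1) by ring.
  rewrite <- Cexp_0, Clog_Cexp; [ring|]. simpl. rewrite Rabs_R0. apply PI_RGT_0.
Qed.

Lemma arcsin_D (z : C) : Cmod z < sin 1 -> D (arcsin z).
Proof.
  intros Hz. assert (HS1 : sin 1 <= 1) by apply SIN_bound.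
  apply (inverse_in_D Csin arcsin 0 (sin 1)).
  - intros q Hq. replace (q - 0)%C with q in Hq by ring.
    split; [apply Cdiff_cont, Cdiff_arcsin; lra|apply Csin_arcsin; lra].
  - rewrite arcsin_0. apply D_0.
  - intros w Hw. replace (Csin w - 0)%C with (Csin w) by ring. apply Csin_boundary, Hw.
  - replace (z - 0)%C with z by ring. exact Hz.
Qed.

(** The sine maps the unit disk onto a set containing the disk of radius [sin 1] about 0. The
    inclusion disk is fitted into the translate [|q - 1| < sin 1] with the same right end, which is
    the quadratic with [A = 2 + sin 1]. *)
Lemma radius_S_sin :
  radius_ge S_sin class_F2 (sin 1 / (2 + sqrt (4 + sin 1 * (2 + sin 1)))).
Proof.
  assert (HPI := PI2_1).
  assert (HS : 0 < sin 1) by (apply sin_gt_0; lra).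
  assert (HS1 : sin 1 <= 1) by apply SIN_bound.
  set (S := sin 1) in *.
  destruct (quadratic_root (2 + S) S HS ltac:(lra)) as [Hc0 Qc].
  set (c := S / (2 + sqrt (4 + S * (2 + S)))) in *.
  assert (Hc : 0 < c < 1) by nra.
  assert (HT : 0 < 1 - c ^ 2) by nra.
  assert (Hr : disk_radius c = S - (disk_center c - 1)).
  { unfold disk_radius, disk_center. apply Rmult_eq_reg_r with (1 - c ^ 2); [|lra].
    field_simplify; [|lra|lra]. nra. }
  assert (Ha := disk_center_ge_1 c Hc).
  set (W := fun q => arcsin (q - 1)%C).
  assert (HW1 : W 1 = 0).
  { unfold W. replace (1 - 1)%C with (RtoC 0) by ring. apply arcsin_0. }
  apply (radius_ge_of_left_inverse _ W); [|exact HW1| |exact Hc0].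
  - intros w Hw. unfold W. replace (1 + Csin w - 1)%C with (Csin w) by ring.
    apply arcsin_Csin, Hw.
  - apply (radius_ok_of_inverse _ W); [exact Hc|exact HW1|].
    intros q Hq. unfold inclusion_disk in Hq. rewrite Hr in Hq.
    assert (Hq1 : Cmod (q - 1) < S).
    { replace (q - 1)%C with ((q - RtoC (disk_center c)) + RtoC (disk_center c - 1))%C
        by (rewrite RtoC_minus; ring).
      eapply Rle_lt_trans; [apply Cmod_triangle|]. rewrite (Cmod_RtoC_pos (_ - 1)); lra. }
    split; [|split].
    + apply (Cdiff_comp arcsin (fun q => q - 1)%C); [apply Cdiff_arcsin; lra|].
      apply Cdiff_minus; [apply Cdiff_id|apply Cdiff_const].
    + apply arcsin_D, Hq1.
    + unfold W. rewrite Csin_arcsin by lra. ring.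
Qed.

(** * The left half of the shifted lemniscate *)

Definition RL_function (r : R) : R :=
  r ^ 2 * (r + 4) ^ 2 + (r ^ 2 - 1) ^ 2
  + (r ^ 2 - 1) * sqrt ((r ^ 2 + sqrt 2) * (2 - sqrt 2 - r ^ 2))
  - (1 + sqrt 2 * (r ^ 2 - 1)) ^ 2.

Lemma RL_function_continuous (r : R) : continuity_pt RL_function r.
Proof.
  apply continuity_pt_filterlim.
  assert (P : forall f : R -> R, ex_derive f r -> continuous f r)
    by (intros f H; apply (ex_derive_continuous (V := R_NormedModule)), H).
  apply (continuous_minus (V := R_NormedModule)).
  - apply (continuous_plus (V := R_NormedModule)).
    + apply P. auto_derive. exact I.
    + apply (continuous_mult (K := R_AbsRing)).
      * apply P. auto_derive. exact I.
      * apply (continuous_comp (fun r => (r ^ 2 + sqrt 2) * (2 - sqrt 2 - r ^ 2)) sqrt).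
        -- apply P. auto_derive. exact I.
        -- apply continuous_sqrt.
  - apply P. auto_derive. exact I.
Qed.

(** A sign change gives a root in [[0, 1 / 10]], where the guard on the radicand holds
    automatically. The infimum of all roots lies there as well, is a root by continuity, and is not
    0 because [RL_function 0 < 0]. *)
Lemma RL_smallest_root_exists : exists r, 0 < r <= 1 / 10 /\ RL_smallest_root r.
Proof.
  assert (E2 := sqrt2_sqr). assert (B2 := sqrt2_bounds).
  assert (Rad : forall r, 0 <= r <= 1 / 10 -> 0 <= (r ^ 2 + sqrt 2) * (2 - sqrt 2 - r ^ 2)).
  { intros r Hr. assert (0 <= r ^ 2 <= 1 / 100) by nra. apply Rmult_le_pos; lra. }
  assert (F0 : RL_function 0 < 0).
  { unfold RL_function.
    set (y := (0 ^ 2 + sqrt 2) * (2 - sqrt 2 - 0 ^ 2)).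
    assert (Ey : y = 2 * sqrt 2 - 2) by (unfold y; nra).
    assert (Sy : sqrt y * sqrt y = y) by (apply sqrt_sqrt; lra).
    assert (Py := sqrt_pos y). assert (y < sqrt y) by nra. nra. }
  assert (F1 : 0 < RL_function (1 / 10)).
  { unfold RL_function.
    set (y := ((1 / 10) ^ 2 + sqrt 2) * (2 - sqrt 2 - (1 / 10) ^ 2)).
    assert (Ey : y <= 0.8217) by (unfold y; nra).
    assert (Hy : 0 <= y) by (apply Rad; lra).
    assert (Sy : sqrt y * sqrt y = y) by (apply sqrt_sqrt; lra).
    assert (Py := sqrt_pos y). assert (sqrt y <= 0.907) by nra. nra. }
  destruct (IVT_interv RL_function 0 (1 / 10)) as [r0 [Hr0 Er0]];
    [intros; apply RL_function_continuous|lra|exact F0|exact F1|].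
  assert (Root0 : RL_root r0) by (split; [lra|split; [apply Rad, Hr0|exact Er0]]).
  (* The infimum of the roots, as minus the supremum of their opposites. *)
  destruct (completeness (fun x => RL_root (- x))) as [M [M1 M2]].
  - exists 0. intros x [Hx _]. lra.
  - exists (- r0). rewrite Ropp_involutive. exact Root0.
  - assert (Low : forall s, RL_root s -> - M <= s).
    { intros s Hs. assert (A := M1 (- s)). cbv beta in A. rewrite Ropp_involutive in A.
      specialize (A Hs). lra. }
    assert (Hm0 : - M <= r0) by (apply Low, Root0).
    assert (Hm1 : 0 <= - M).
    { assert (M <= 0); [|lra]. apply M2. intros x [Hx _]. lra. }
    assert (Fm : RL_function (- M) = 0).
    { apply NNPP. intros Hn.
      destruct (RL_function_continuous (- M) (Rabs (RL_function (- M))) (Rabs_pos_lt _ Hn))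
        as [d [Hd K]].
      (* If [- M] were not a root, there would be no root within [d] of it, and [M - d] would still
         be an upper bound. *)
      assert (M <= M - d); [|lra].
      apply M2. intros x Hx. apply Rnot_lt_le. intros Hlt.
      assert (A := M1 x Hx).
      destruct (Req_dec (- M) (- x)) as [e|n].
      - apply Hn. rewrite e. apply Hx.
      - specialize (K (- x)). unfold D_x, no_cond in K. simpl in K. unfold Rdist in K.
        assert (Z : RL_function (- x) = 0) by apply Hx.
        rewrite Z, Rminus_0_l, Rabs_Ropp in K.
        assert (B : Rabs (RL_function (- M)) < Rabs (RL_function (- M))); [|lra].
        apply K. split; [split; [exact I|exact n]|]. apply Rabs_def1; lra. }
    exists (- M). split; [|split; [|exact Low]].
    + split; [|lra]. destruct Hm1 as [H|H]; [exact H|]. rewrite <- H in Fm. lra.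
    + split; [lra|]. split; [apply Rad; lra|exact Fm].
Qed.

(* With [d = sqrt (1 - c0 ^ 2)] the disk of centre [c0] and squared radius [d - d ^ 2]
   touches the lemniscate [|u ^ 2 - 1| = 1]; for [m = |u| ^ 2 + 1] the inclusion amounts to
   [0 <= (1 - d * m) ^ 2]. *)
Lemma lemniscate_disk (c0 d x y : R) :
  0 < c0 -> 0 <= d < 1 -> d ^ 2 = 1 - c0 ^ 2 ->
  (x - c0) ^ 2 + y ^ 2 < d - d ^ 2 ->
  0 < x /\ (x ^ 2 + y ^ 2) ^ 2 < 2 * (x ^ 2 - y ^ 2).
Proof.
  intros Hc Hd Ed Hxy. set (m := x ^ 2 + y ^ 2 + 1).
  assert (H1 : m - d < 2 * c0 * x) by (unfold m; nra).
  assert (Hm : 1 <= m) by (unfold m; nra).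
  assert (Hx : 0 < x).
  { apply Rmult_lt_reg_l with (2 * c0); lra. }
  split; [exact Hx|].
  assert (H2 : (m - d) ^ 2 < 4 * c0 ^ 2 * x ^ 2).
  { replace (4 * c0 ^ 2 * x ^ 2) with ((2 * c0 * x) ^ 2) by ring.
    rewrite <- !Rsqr_pow2. apply Rsqr_incrst_1; nra. }
  assert (0 <= (1 - d * m) ^ 2) by apply pow2_ge_0.
  assert (H3 : c0 ^ 2 * (m ^ 2 - 1) < c0 ^ 2 * (4 * x ^ 2)).
  { replace (c0 ^ 2) with (1 - d ^ 2) at 1 by lra. nra. }
  apply Rmult_lt_reg_l in H3; [|nra].
  unfold m in H3. nra.
Qed.

(** In the variable [u = sqrt 2 - q] the target is [|u ^ 2 - 1| < 1] with [Re u > 0], and the disk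
    has centre [c0 = sqrt 2 - a]. Divided by [(1 - c ^ 2) ^ 2], the equation says that its squared
    radius is [d - d ^ 2], as [lemniscate_disk] requires. *)
Lemma radius_S_RL (c : R) : 0 < c <= 1 / 10 -> RL_equation c -> radius_ge S_RL class_F2 c.
Proof.
  intros Hc Eq. assert (E2 := sqrt2_sqr). assert (B2 := sqrt2_bounds).
  unfold RL_equation in Eq.
  set (t := sqrt 2) in *.
  assert (HT : 0 < 1 - c ^ 2) by nra. set (T := 1 - c ^ 2) in *.
  assert (Ha : disk_center c = 1 / T) by reflexivity.
  assert (Ha1 := disk_center_ge_1 c ltac:(lra)).
  assert (T9 : 0.99 <= T) by (unfold T; nra).
  set (a := disk_center c) in *.
  assert (Ha2 : a <= 1.02).
  { rewrite Ha. apply Rmult_le_reg_r with T; [exact HT|].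
    unfold Rdiv. rewrite Rmult_assoc, Rinv_l; lra. }
  set (c0 := t - a). assert (Hc0 : 0 < c0 < 1) by (unfold c0; lra).
  set (d := sqrt (1 - c0 ^ 2)).
  assert (Ed : d ^ 2 = 1 - c0 ^ 2) by (apply pow2_sqrt; nra).
  assert (Pd : 0 <= d) by apply sqrt_pos. assert (Hd1 : d < 1) by nra.
  assert (Es : sqrt ((c ^ 2 + t) * (2 - t - c ^ 2)) = T * d).
  { replace ((c ^ 2 + t) * (2 - t - c ^ 2)) with (Rsqr T * (1 - c0 ^ 2)).
    - rewrite sqrt_mult_alt by apply Rle_0_sqr. rewrite sqrt_Rsqr by lra. reflexivity.
    - unfold c0. rewrite Ha. unfold Rsqr. field_simplify; [|lra]. unfold T. nra. }
  rewrite Es in Eq.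
  assert (Er : disk_radius c ^ 2 = d - d ^ 2).
  { rewrite Ed. unfold disk_radius, c0. fold T. rewrite Ha.
    apply Rmult_eq_reg_r with (T * T); [|nra].
    replace ((c * (c + 4) / T) ^ 2 * (T * T)) with (c ^ 2 * (c + 4) ^ 2) by (field; lra).
    replace ((d - (1 - (t - 1 / T) ^ 2)) * (T * T)) with (d * T * T - T ^ 2 + (t * T - 1) ^ 2)
      by (field; lra).
    replace (c ^ 2 - 1) with (- T) in Eq by (unfold T; ring). nra. }
  set (b := RtoC (2 * (t - 1))). set (j := RtoC (t - 1)).
  assert (Nj : j <> 0) by (apply RtoC_neq_0; lra).
  assert (Ebj : (1 - b = j * j)%C).
  { unfold b, j. rewrite <- RtoC_mult, <- RtoC_minus. f_equal. nra. }
  assert (N1b : (1 + b)%C <> 0).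
  { unfold b. apply RtoC_plus_neq_0. lra. }
  (* [phi_RL w = t - j * Csqrt (V w)], and the homography [V] is an involution, so the inverse of
     [phi_RL] is [V] applied to [((t - q) / j) ^ 2]. *)
  set (V := fun v => ((1 - v) / (1 + b * v))%C).
  assert (VV : forall v, (1 + b * v)%C <> 0 -> V (V v) = v /\ (1 + b * V v)%C <> 0).
  { intros v N. assert (E : (1 + b * V v = (1 + b) / (1 + b * v))%C) by (unfold V; field; exact N).
    assert (N' : ((1 + b) / (1 + b * v))%C <> 0).
    { intros H. apply N1b. transitivity ((1 + b) / (1 + b * v) * (1 + b * v))%C; [field; exact N|].
      rewrite H. ring. }
    split; [|rewrite E; exact N'].
    unfold V at 1. rewrite E. unfold V. field. split; assumption. }
  set (W := fun q => V (((RtoC t - q) / j) * ((RtoC t - q) / j))%C).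
  assert (HW1 : W 1 = 0).
  { unfold W. replace ((RtoC t - 1) / j)%C with (RtoC 1).
    - unfold V. replace (1 - 1 * 1)%C with (RtoC 0) by ring. unfold Cdiv. ring.
    - unfold j. rewrite RtoC_minus in *. field. unfold j in Nj. rewrite RtoC_minus in Nj. exact Nj. }
  apply (radius_ge_of_left_inverse _ W).
  - intros w Hw. unfold W, phi_RL. fold t. fold b. fold j.
    assert (N : (1 + b * w)%C <> 0).
    { replace (1 + b * w)%C with (1 - (- (b * w)))%C by ring. apply D_1m. unfold D in *.
      rewrite Cmod_opp, Cmod_mult. unfold b. rewrite Cmod_RtoC_pos by lra.
      assert (P := Cmod_ge_0 w). nra. }
    set (s := Csqrt ((1 - w) / (1 + b * w))).
    replace ((RtoC t - (RtoC t - j * s)) / j)%C with s by (field; exact Nj).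
    unfold s. rewrite Csqrt_sqr. apply (VV w N).
  - exact HW1.
  - apply (radius_ok_of_inverse _ W); [lra|exact HW1|].
    intros q Hq. unfold inclusion_disk in Hq. fold a in Hq.
    assert (Pr := Cmod_lt_pos _ _ Hq).
    apply disk_sqr in Hq; [|exact Pr]. rewrite Er in Hq.
    destruct (lemniscate_disk c0 d (t - Re q) (- Im q)) as [L1 L2]; try lra.
    { unfold c0. nra. }
    set (s := ((RtoC t - q) / j)%C).
    assert (Hs : s = (RtoC (/ (t - 1)) * (RtoC t - q))%C).
    { unfold s. rewrite RtoC_inv by lra. fold j. unfold Cdiv. ring. }
    assert (Pj : 0 < / (t - 1)) by (apply Rinv_0_lt_compat; lra).
    assert (Res : 0 < Re s).
    { rewrite Hs, re_scal_l. apply Rmult_lt_0_compat; [exact Pj|].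
      destruct q as [x y]. simpl in *. lra. }
    assert (Hv : Cmod (1 - s * s) < Cmod (1 + b * (s * s))).
    { replace (1 - s * s)%C with ((j * j - (RtoC t - q) * (RtoC t - q)) * (/ j * / j))%C
        by (unfold s; field; exact Nj).
      replace (1 + b * (s * s))%C with ((j * j + b * ((RtoC t - q) * (RtoC t - q))) * (/ j * / j))%C
        by (unfold s; field; exact Nj).
      rewrite !(Cmod_mult _ (/ j * / j)).
      assert (Pjj : 0 < Cmod (/ j * / j)).
      { rewrite Cmod_mult, Cmod_inv by exact Nj. assert (P := proj1 (Cmod_gt_0 _) Nj).
        assert (0 < / Cmod j) by (apply Rinv_0_lt_compat, P). nra. }
      apply Rmult_lt_compat_r; [exact Pjj|].
      apply Cmod_lt_Cmod. rewrite !Cmod2_alt. unfold b, j.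
      destruct q as [x y]. simpl in L1, L2 |- *.
      set (X := t - x) in *.
      set (A := X * X - y * y). set (B := 2 * X * y).
      assert (LN : A * A + B * B < 2 * A).
      { unfold A, B. nra. }
      set (g := (t - 1) * (t - 1)). assert (Hg : 2 * (t - 1) = 1 - g) by (unfold g; nra).
      assert (Pg : 0 < g < 1) by (unfold g; nra).
      (* With [A + i B = u ^ 2] and [g = j ^ 2], the difference of the two sides is
         [g (2 - g) (2 A - A ^ 2 - B ^ 2)], positive exactly when [|u ^ 2 - 1| < 1]. *)
      assert (Main : (g - A) * (g - A) + B * B < (g + (1 - g) * A) * (g + (1 - g) * A) + (1 - g) * B * ((1 - g) * B)).
      { assert (0 < g * (2 - g) * (2 * A - (A * A + B * B))); [|nra].
        apply Rmult_lt_0_compat; nra. }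
      rewrite Hg. fold X.
      replace ((t + - x)) with X by (unfold X; ring).
      unfold A, B, g in *. nra. }
    assert (N : (1 + b * (s * s))%C <> 0).
    { apply Cmod_gt_0. assert (P := Cmod_ge_0 (1 - s * s)). lra. }
    split; [|split].
    + apply (Cdiff_comp V (fun q => ((RtoC t - q) / j) * ((RtoC t - q) / j))%C).
      * apply Cdiff_div; [apply Cdiff_minus; [apply Cdiff_const|apply Cdiff_id]| |exact N].
        apply Cdiff_plus; [apply Cdiff_const|apply Cdiff_mult; [apply Cdiff_const|apply Cdiff_id]].
      * assert (Q : Cdiff (fun q => (RtoC t - q) / j)%C q).
        { apply Cdiff_div; [apply Cdiff_minus; [apply Cdiff_const|apply Cdiff_id]|apply Cdiff_const|exact Nj]. }
        apply Cdiff_mult; exact Q.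
    + apply D_div, Hv.
    + unfold phi_RL. fold t. fold b. fold j. unfold W. fold s.
      change ((1 - V (s * s)) / (1 + b * V (s * s)))%C with (V (V (s * s)%C)).
      rewrite (proj1 (VV _ N)), Csqrt_of_sqr by exact Res.
      unfold s. field. exact Nj.
  - lra.
Qed.

Theorem theorem2p4 :
  (forall alpha : R, 0 <= alpha < 1 ->
     is_radius (S_order alpha) class_F2
       ((1 - alpha) / (2 + sqrt (4 + (alpha - 1) ^ 2)))) /\
  radius_ge S_L class_F2 ((sqrt 5 - 2) / (1 + sqrt 2)) /\
  is_radius S_p class_F2 (sqrt 17 - 4) /\
  is_radius S_e class_F2
    ((2 * exp 1 - 2) / (4 * exp 1 + sqrt (20 * exp 1 ^ 2 - 8 * exp 1 + 4))) /\
  is_radius S_c class_F2 (sqrt 10 - 3) /\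
  radius_ge S_sin class_F2 (sin 1 / (2 + sqrt (4 + sin 1 * (2 + sin 1)))) /\
  is_radius S_lune class_F2 ((2 - sqrt 2) / (2 + sqrt (10 - 4 * sqrt 2))) /\
  is_radius S_R class_F2 ((3 - 2 * sqrt 2) / (2 + sqrt (21 - 12 * sqrt 2))) /\
  (exists r : R, RL_smallest_root r /\ radius_ge S_RL class_F2 r) /\
  (forall gamma : R, 0 < gamma <= 1 ->
     radius_ge (S_gamma gamma) class_F2
       (sin (PI * gamma / 2) / (2 + sqrt (4 + sin (PI * gamma / 2))))).
Proof.
  refine (conj radius_S_order (conj radius_S_L (conj radius_S_p (conj radius_S_e
    (conj radius_S_c (conj radius_S_sin (conj radius_S_lune (conj radius_S_R
    (conj _ radius_S_gamma))))))))).
  destruct RL_smallest_root_exists as [r [Hr Hroot]].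
  exists r. split; [exact Hroot|]. apply radius_S_RL; [exact Hr|apply Hroot].
Qed.
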